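(* Let $\lambda\ge0$ be any jump rate, and let $X$ and $\hat X$ be jumpy Brownian motions of rate $\lambda$ on the circle with $X_0=0$ and $\hat X_0=\pi$. Let $\tau$ be the first hitting time of $\{-\pi/2,\pi/2\}$ by $\tfrac12 B$, where $B$ is a standard real Brownian motion started at $0$, and let $J\sim\mathrm{Exp}(2\lambda)$ be independent of $\tau$. Then for all $t\ge0$, $$\left\|\mathcal{L}(X_t\,|\,X_0=0)-\mathcal{L}(\hat X_t\,|\,\hat X_0=\pi)\right\|_{\mathrm{TV}}=e^{-2\lambda t}\,\mathbb{P}(\tau>t)=\mathbb{P}(\min\{J,\tau\}>t).$$ Moreover, the pair $(X,\hat X)$ constructed explicitly in the context is a valid coupling of two jumpy Brownian motions of rate $\lambda$ started from $0$ and $\pi$ respectively, with coupling time almost surely equal to $T^\star=\min\{J_1,\tau\}$; this coupling is maximal but not co-adapted.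
   Context: **Jumpy Brownian motion.** A jumpy Brownian motion of rate $\lambda\ge0$ is the process on the circle $(-\pi,\pi]$ (identified with $\mathbb{R}/2\pi\mathbb{Z}$) given by $X_t=X_0+\tfrac12 B_t+\pi N^\lambda_t\ (\mathrm{mod}\ 2\pi)$, where $B$ is a standard real Brownian motion (the diffusion component being $\tfrac12B$) and $N^\lambda$ an independent Poisson process of rate $\lambda$. **Couplings.** A coupling is a process $(X,\hat X)$ whose marginals are each jumpy Brownian motions of rate $\lambda$. The coupling time is $T=\inf\{t\ge0:X_s=\hat X_s\text{ for all }s\ge t\}$. Total variation distance is $\|\mu-\nu\|_{\mathrm{TV}}=\sup_A\{\mu(A)-\nu(A)\}$ over Borel $A\subseteq(-\pi,\pi]$. A coupling is maximal if $\|\mathcal{L}(X_t)-\mathcal{L}(\hat X_t)\|_{\mathrm{TV}}=\mathbb{P}(T>t)$ for all $t\ge0$. It is co-adapted if there is a filtration $(\mathcal{F}_t)$ to which $X$ and $\hat X$ are both adapted and such that for all $0\le s\le t$, $\mathcal{L}(X_t|\mathcal{F}_s)=\mathcal{L}(X_t|X_s)$ and $\mathcal{L}(\hat X_t|\mathcal{F}_s)=\mathcal{L}(\hat X_t|\hat X_s)$. **Construction.** Let $N^{2\lambda}$ be a marked Poisson process of rate $2\lambda$ with incident times $J_1<J_2<\cdots$ and i.i.d. Bernoulli$(1/2)$ marks $Y_k$, and let $B$ be an independent standard Brownian motion started at $0$ with $\tau$ the first hitting time of $\{-\pi/2,\pi/2\}$ by $\tfrac12B$. The process $X$ starts at $0$,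 has diffusion component $\tfrac12B$, and jumps by $\pi$ at time $J_k$ if and only if $Y_k=1$. The process $\hat X$ starts at $\pi$ and is defined as follows. - On $\{\tau<J_1\}$: until time $\tau$ the diffusion component of $\hat X$ is $-\tfrac12B$ (and there are no jumps), so that $\hat X$ is the reflection of $X$ about the points $\pm\pi/2$ and the two processes meet at time $\tau$. - On $\{J_1<\tau\}$: until time $J_1$ the diffusion component of $\hat X$ is $\tfrac12B$ (so the processes stay at distance $\pi$), and $\hat X$ jumps by $\pi$ at time $J_1$ if and only if $Y_1=0$, i.e. if and only if $X$ does not jump then; the two processes meet at time $J_1$. - From time $\min\{J_1,\tau\}$ onwards, the diffusion and jump components of $\hat X$ equal those of $X$ (in the sense of increments).
   Formalization: The claim that the coupling is not co-adapted is stated only for λ>0: at λ=0 it is the ordinary reflection coupling, which is co-adapted, so the claim fails there; all else is for every λ≥0. *)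

(* Defs.v *)
From HB Require Import structures.
From mathcomp Require Import all_boot all_order all_algebra.
From mathcomp Require Import all_classical all_reals all_analysis.
From mathcomp Require Import measurable_realfun.

Set Implicit Arguments.
Unset Strict Implicit.
Unset Printing Implicit Defensive.

Import Order.TTheory GRing.Theory Num.Theory.
Import numFieldNormedType.Exports.

Local Open Scope classical_set_scope.
Local Open Scope ring_scope.

(* A real-time process is a function [R -> T -> U] of which only the values at
   times [t >= 0] are ever used. *)

(* The representative in (-pi, pi] of x modulo 2 pi. *)
Definition wrap {R : realType} (x : R) : R :=
  x - 2 * pi * (Num.ceil ((x - pi) / (2 * pi)))%:~R.

(* Total variation distance of two laws on the circle (-pi, pi]. *)
Definition tv_dist {R : realType} (mu nu : set R -> \bar R) : \bar R :=
  ereal_sup [set (mu A - nu A)%E | A in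
    [set A | measurable A /\ A `<=` `]- pi, pi]%classic]].

Section processes.
Context {d : measure_display} {T : measurableType d} {R : realType}.
Variable P : probability T R.

Definition sigma_rv d' (U : measurableType d') (X : T -> U) : set_system T :=
  preimage_set_system setT X measurable.

Definition sigma_family (I : Type) (D : set I) d' (U : measurableType d')
    (X : I -> T -> U) : set_system T :=
  <<s \bigcup_(i in D) sigma_rv (X i) >>.

Definition sigma_process d' (U : measurableType d') (X : R -> T -> U) :=
  sigma_family [set t : R | 0 <= t] X.

Definition independent2 (F G : set_system T) : Prop :=
  forall A B, F A -> G B -> P (A `&` B) = (P A * P B)%E.

(* Mutual independence of three sigma-algebras: as each contains the full set,
   the triple product rule also gives the product rule for pairs. *)
Definition independent3 (F G H : set_system T) : Prop :=
  forall A B C, F A -> G B -> H C ->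
    P (A `&` B `&` C) = (P A * P B * P C)%E.

Definition mutually_independent (I : eqType) (F : I -> set_system T) : Prop :=
  forall (s : seq I) (A : I -> set T), uniq s ->
    (forall i, i \in s -> F i (A i)) ->
    P (\bigcap_(i in [set` s]) A i) = (\prod_(i <- s) P (A i))%E.

(* Standard real Brownian motion started at 0. In [bm_indep] an infinite
   nondecreasing sequence of times covers all finite ones, which may be
   continued by a constant. [bm_gauss] is restricted to [s < t] because
   [normal_prob m 0] is not a Dirac mass in the library. *)
Record brownian_motion (B : R -> T -> R) : Prop := {
  bm_meas : forall t, 0 <= t -> measurable_fun setT (B t) ;
  bm_0 : forall w, B 0 w = 0 ;
  bm_cont : forall w, {within `[0, +oo[%classic, continuous (B ^~ w)} ;
  bm_indep : forall u : nat -> R, 0 <= u 0%N -> {homo u : i j / (i <= j)%N >-> i <= j} ->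
    mutually_independent
      (fun i => sigma_rv (fun w => B (u i.+1) w - B (u i) w)) ;
  bm_gauss : forall s t, 0 <= s -> s < t -> forall A : set R, measurable A ->
    pushforward P (fun w => B t w - B s w) A
    = normal_prob 0 (Num.sqrt (t - s)) A }.

(* Poisson process, given by its counting process. The second argument of
   [poisson_prob] is ignored by the library, and at rate 0 [poisson_prob] is
   the Dirac mass at 0. *)
Record poisson_process (rate : R) (N : R -> T -> nat) : Prop := {
  pp_meas : forall t, 0 <= t -> measurable_fun setT (N t) ;
  pp_0 : forall w, N 0 w = 0%N ;
  pp_mono : forall w s t, 0 <= s -> s <= t -> (N s w <= N t w)%N ;
  pp_rcont : forall w t, 0 <= t -> \forall u \near t^'+, N u w = N t w ;
  pp_indep : forall u : nat -> R, 0 <= u 0%N -> {homo u : i j / (i <= j)%N >-> i <= j} ->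
    mutually_independent
      (fun i => sigma_rv (fun w => (N (u i.+1) w - N (u i) w)%N)) ;
  pp_law : forall s t, 0 <= s -> s <= t -> forall A : set nat,
    pushforward P (fun w => (N t w - N s w)%N) A
    = poisson_prob (rate * (t - s)) 0%N A }.

(* Exp(rate), allowing rate = 0: then [exponential_prob] is the zero measure on
   R, so that J = +oo almost surely. *)
Definition exponential_rv (rate : R) (J : T -> \bar R) : Prop :=
  [/\ measurable_fun setT J,
      {ae P, forall w, (0 <= J w)%E} &
      forall A : set R, measurable A ->
        pushforward P J (EFin @` A) = exponential_prob rate A].

Definition jumpy_path (x : T -> R) (B : R -> T -> R) (N : R -> T -> nat)
    (t : R) (w : T) : R :=
  wrap (x w + B t w / 2 + pi * (N t w)%:R).

Definition jumpy_brownian_motion (lam : R) (X : R -> T -> R) : Prop :=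
  [/\ measurable_fun setT (X 0),
      forall w, - pi < X 0 w <= pi &
      exists (B : R -> T -> R) (N : R -> T -> nat),
        [/\ brownian_motion B,
            poisson_process lam N,
            independent3 (sigma_rv (X 0)) (sigma_process B) (sigma_process N) &
            forall t w, 0 <= t -> X t w = jumpy_path (X 0) B N t w]].

Definition is_coupling (lam : R) (X Xh : R -> T -> R) : Prop :=
  jumpy_brownian_motion lam X /\ jumpy_brownian_motion lam Xh.

Definition coupling_time (X Xh : R -> T -> R) (w : T) : \bar R :=
  ereal_inf [set t%:E | t in
    [set t : R | 0 <= t /\ forall s, t <= s -> X s w = Xh s w]].

Definition maximal_coupling (X Xh : R -> T -> R) : Prop :=
  forall t, 0 <= t ->
    tv_dist (pushforward P (X t)) (pushforward P (Xh t))
    = P [set w | (t%:E < coupling_time X Xh w)%E].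

Definition filtration (F : R -> set_system T) : Prop :=
  [/\ forall t, 0 <= t -> sigma_algebra setT (F t),
      forall t, 0 <= t -> F t `<=` measurable &
      forall s t, 0 <= s -> s <= t -> F s `<=` F t].

Definition adapted (F : R -> set_system T) (X : R -> T -> R) : Prop :=
  forall t, 0 <= t -> sigma_rv (X t) `<=` F t.

(* Z is a version of the conditional probability P(E | G). *)
Definition cond_prob_version (G : set_system T) (E : set T) (Z : T -> R) :
    Prop :=
  [/\ sigma_rv Z `<=` G,
      P.-integrable setT (EFin \o Z) &
      forall D, G D -> (\int[P]_(w in D) (Z w)%:E)%E = P (E `&` D)].

(* L(X | G) = L(X | H), that is, P(X \in A | G) = P(X \in A | H) a.s. for all
   Borel sets A. *)
Definition cond_law_eq (X : T -> R) (G H : set_system T) : Prop :=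
  forall A : set R, measurable A ->
    exists Z1 Z2 : T -> R,
      [/\ cond_prob_version G (X @^-1` A) Z1,
          cond_prob_version H (X @^-1` A) Z2 &
          {ae P, forall w, Z1 w = Z2 w}].

Definition co_adapted (X Xh : R -> T -> R) : Prop :=
  exists F : R -> set_system T,
    [/\ filtration F, adapted F X, adapted F Xh &
        forall s t, 0 <= s -> s <= t ->
          cond_law_eq (X t) (F s) (sigma_rv (X s)) /\
          cond_law_eq (Xh t) (F s) (sigma_rv (Xh s))].

(* First hitting time of {-pi/2, pi/2} by B/2; it is +oo if there is none. *)
Definition hit_time (B : R -> T -> R) (w : T) : \bar R :=
  ereal_inf [set t%:E | t in
    [set t : R | 0 <= t /\ (B t w / 2 = - (pi / 2) \/ B t w / 2 = pi / 2)]].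

(* Incident times, numbered from 0: [incident_time N k] is J_{k+1}, and
   [Y k] below is its mark Y_{k+1}. *)
Definition incident_time (N : R -> T -> nat) (k : nat) (w : T) : \bar R :=
  ereal_inf [set t%:E | t in [set t : R | 0 <= t /\ (k < N t w)%N]].

Definition marked_count (N : R -> T -> nat) (Y : nat -> T -> bool)
    (t : R) (w : T) : nat :=
  (\sum_(k < N t w) Y k w)%N.

Record construction_data (lam : R) (B : R -> T -> R) (N : R -> T -> nat)
    (Y : nat -> T -> bool) : Prop := {
  cd_bm : brownian_motion B ;
  cd_poisson : poisson_process (2 * lam) N ;
  cd_mark_meas : forall k, measurable_fun setT (Y k) ;
  cd_mark_law : forall k (A : set bool),
    pushforward P (Y k) A = bernoulli_prob (2^-1 : R) A ;
  cd_mark_indep : mutually_independent (fun k => sigma_rv (Y k)) ;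
  cd_indep : independent3 (sigma_process B) (sigma_process N)
    (sigma_family setT Y) }.

Definition constructed_X (B : R -> T -> R) (N : R -> T -> nat)
    (Y : nat -> T -> bool) : R -> T -> R :=
  jumpy_path (fun=> 0) B (marked_count N Y).

(* On the null event J_1 = tau, on which the construction is not specified, the
   second branch (J_1 < tau) is followed. *)
Definition constructed_Bh (B : R -> T -> R) (N : R -> T -> nat)
    (t : R) (w : T) : R :=
  let tau := hit_time B w in
  if (tau < incident_time N 0 w)%E then
    if (t%:E <= tau)%E then - B t w
    else - B (fine tau) w + (B t w - B (fine tau) w)
  else B t w.

Definition constructed_Yh (B : R -> T -> R) (N : R -> T -> nat)
    (Y : nat -> T -> bool) (k : nat) (w : T) : bool :=
  if (k == 0%N) && ~~ (hit_time B w < incident_time N 0 w)%E then ~~ Y k w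
  else Y k w.

Definition constructed_Xh (B : R -> T -> R) (N : R -> T -> nat)
    (Y : nat -> T -> bool) : R -> T -> R :=
  jumpy_path (fun=> pi) (constructed_Bh B N)
    (marked_count N (constructed_Yh B N Y)).

End processes.

(* Main.v *)
(* At a fixed time only the parity of the number of jumps matters, and the
   probabilities of an even and of an odd number differ by exp(- 2 lam t). What
   remains is to compare B_t / 2 and pi + B_t / 2 modulo 2 pi. By the reflection
   principle they have the same law off {t < tau}, so their distance is at most
   P(t < tau), and the half circle (- pi / 2, pi / 2] attains this value.

   The explicit pair is a coupling because reflecting B at tau on {tau < J_1}
   and flipping the first mark off that event leave the joint law of (B, N, Y)
   unchanged, and because the points of a Poisson process of rate 2 lam that
   carry the mark 1 form a Poisson process of rate lam.

   It is not co-adapted: at a small time s, a filtration to which both processes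
   are adapted knows whether they are mirror images of each other, that is,
   whether tau < J_1. In that case X does not jump before tau, so it can be
   outside the half circle at time 2 s only if tau <= 2 s, which has probability
   O(s^2), whereas given X_s alone it jumps once in [s, 2 s], and is then likely
   to be there, with probability of order s. *)

Require Import Defs.
From HB Require Import structures.
From mathcomp Require Import all_boot all_order all_algebra.
From mathcomp Require Import all_classical all_reals all_analysis.
From mathcomp Require Import measurable_realfun.
From mathcomp Require Import ring lra zify.

Set Implicit Arguments.
Unset Strict Implicit.
Unset Printing Implicit Defensive.

Import Order.TTheory GRing.Theory Num.Theory.
Import numFieldNormedType.Exports.

Local Open Scope classical_set_scope.
Local Open Scope ring_scope.

(** * Generated sigma-algebras and independence *)

(** A Brownian motion is given by the joint law of its increments at fixed times, and reflecting at
    a fixed time only changes signs of increments. Reflection at tau is therefore approximated by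
    reflection at the next point of a grid. Rounding up matters: the cell of tau is then determined
    by |B| up to the new reflection time, so it survives the reflection. Since the branch tau < J_1
    involves N as well as the later path, every identity carries along an event of (N, Y), and J_1
    is compared with the rounded time, which independence separates from the path. The same result
    with J = +oo is the reflection principle used for the total variation distance.

    Laws of paths live on the product sigma-algebra, where an event depends on countably many times
    only; continuity is what makes tau visible there.

    Failure of co-adaptedness has to hold for every filtration, so conditional laws are used only
    through lower bounds on the events of F s. It is a statement about lam > 0: at rate 0 almost
    surely J_1 = +oo, and the pair is the plain reflection coupling, which does not anticipate. *)

Lemma bigcap_seq_eqType (I : eqType) (U : Type) (s : seq I) (F : I -> set U) :
  \bigcap_(i in [set` s]) F i = \big[setI/setT]_(i <- s) F i.
Proof.
elim: s => [|i s IH]; first by rewrite set_nil bigcap_set0 big_nil.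
rewrite big_cons -IH; apply/seteqP; split => w /= h.
  by split => [|j js]; apply: h; rewrite /= inE ?eqxx// js orbT.
by move=> j /=; rewrite inE => /orP[/eqP ->|]; [exact: h.1|exact: h.2].
Qed.

Lemma trivIset_preimage_fun (U V : Type) (f : U -> V) (F : (set V)^nat) :
  trivIset setT F -> trivIset setT (fun n => f @^-1` F n).
Proof. by move=> tF i j _ _ [w [wi wj]]; apply: tF => //; exists (f w). Qed.

Section g_sigma_closure.
Context {U : Type} {C : set_system U}.

Lemma g_sigma_setT : <<s C >> setT.
Proof.
by have [h0 hD _] := smallest_sigma_algebra setT C; rewrite -[X in _ X](setD0 setT); exact: hD.
Qed.

Lemma g_sigma_setC E : <<s C >> E -> <<s C >> (~` E).
Proof.
by move=> sE; have [_ hD _] := smallest_sigma_algebra setT C; rewrite -setTD; exact: hD.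
Qed.

Lemma g_sigmaS (D : set_system U) : C `<=` D -> <<s C >> `<=` <<s D >>.
Proof.
move=> CD; apply: smallest_sub; first exact: smallest_sigma_algebra.
by move=> E /CD; exact: sub_sigma_algebra.
Qed.

Lemma g_sigma_bigcup (F : (set U)^nat) :
  (forall n, <<s C >> (F n)) -> <<s C >> (\bigcup_n F n).
Proof. by have [_ _] := smallest_sigma_algebra setT C; exact. Qed.

Lemma g_sigma_bigcap (F : (set U)^nat) :
  (forall n, <<s C >> (F n)) -> <<s C >> (\bigcap_n F n).
Proof.
move=> sF; rewrite -(setCK (\bigcap_n _)) setC_bigcap.
by apply: g_sigma_setC; apply: g_sigma_bigcup => n; exact: g_sigma_setC.
Qed.

Lemma g_sigma_setI E F : <<s C >> E -> <<s C >> F -> <<s C >> (E `&` F).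
Proof.
move=> sE sF; rewrite -bigcap2E; apply: g_sigma_bigcap => -[|[|n]] //=.
exact: g_sigma_setT.
Qed.

End g_sigma_closure.

(** Dynkin's pi-lambda theorem as an induction principle. The closure steps also provide membership
    in [<<s C >>]. *)
Lemma dynkin_g_sigma_ind (U : Type) (C Q : set_system U) :
  setI_closed C -> C `<=` Q -> Q setT ->
  (forall E, <<s C >> E -> Q E -> Q (~` E)) ->
  (forall F : (set U)^nat, trivIset setT F ->
    (forall n, <<s C >> (F n) /\ Q (F n)) -> Q (\bigcup_n F n)) ->
  <<s C >> `<=` Q.
Proof.
move=> CI CQ QT QC QU E sE.
suff : <<s C >> `<=` [set A | <<s C >> A /\ Q A] by move=> /(_ _ sE)[].
apply: lambda_system_subset => //; last first.
  by move=> A CA; split; [exact: sub_sigma_algebra|exact: CQ].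
apply/dynkin_lambda_system; split => /=.
- by split => //; exact: g_sigma_setT.
- by move=> A [sA qA]; split; [exact: g_sigma_setC|exact: QC].
- by move=> F tF FQ; split; [apply: g_sigma_bigcup => n; have [] := FQ n|exact: QU].
Qed.

Section measure_uniqueness.
Context {R : realType}.

(** The target [U] is a bare type, such as a space of paths, so measurability of preimages is proved
    in the same induction as the equality. The two measures may live on different spaces. *)
Lemma preimage_measure_unique d d' (T : measurableType d) (T' : measurableType d')
    (m : {measure set T -> \bar R}) (m' : {measure set T' -> \bar R})
    (U : Type) (C : set_system U) (phi : T -> U) (phi' : T' -> U) :
  setI_closed C ->
  (forall E, C E -> measurable (phi @^-1` E)) ->
  (forall E, C E -> measurable (phi' @^-1` E)) ->
  m setT = m' setT -> (m setT < +oo)%E ->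
  (forall E, C E -> m (phi @^-1` E) = m' (phi' @^-1` E)) ->
  forall E, <<s C >> E ->
    [/\ measurable (phi @^-1` E), measurable (phi' @^-1` E) &
        m (phi @^-1` E) = m' (phi' @^-1` E)].
Proof.
move=> CI mphi mphi' mT moo mE E; move: E; apply: dynkin_g_sigma_ind => //=.
- by move=> E CE; split; [exact: mphi|exact: mphi'|exact: mE].
- by rewrite !preimage_setT.
- move=> E _ [mA mB e]; rewrite -!preimage_setC; split; [exact: measurableC..|].
  have moo' : (m' setT < +oo)%E by rewrite -mT.
  rewrite -(setTD (phi @^-1` E)) -(setTD (phi' @^-1` E)) !measureD// !setTI.
  by congr (_ - _)%E; [exact: mT|exact: e].
- move=> F tF FQ; rewrite !preimage_bigcup; split.
  + by apply: bigcupT_measurable => n; have [_ []] := FQ n.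
  + by apply: bigcupT_measurable => n; have [_ []] := FQ n.
  + rewrite !measure_semi_bigcup//.
    * by apply: eq_eseriesr => n _; have [_ []] := FQ n.
    * by move=> n; have [_ []] := FQ n.
    * exact: trivIset_preimage_fun.
    * by apply: bigcupT_measurable => n; have [_ []] := FQ n.
    * by move=> n; have [_ []] := FQ n.
    * exact: trivIset_preimage_fun.
    * by apply: bigcupT_measurable => n; have [_ []] := FQ n.
Qed.

End measure_uniqueness.

Section product_rules.
Context {d} {T : measurableType d} {R : realType}.
Variable P : probability T R.

Lemma g_sigma_measurable (C : set_system T) :
  C `<=` measurable -> <<s C >> `<=` measurable.
Proof. by move=> CM; apply: smallest_sub => //; exact: sigma_algebra_measurable. Qed.

(** As functions of [E], both sides are finite measures, the restriction of [P] to [H] and the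
    multiple of [P] by [P H]; agreement on a pi-system extends to the sigma-algebra it generates. *)
Lemma product_rule_g_sigma (C : set_system T) (H : set T) :
  setI_closed C -> C `<=` measurable -> measurable H ->
  (forall E, C E -> P (E `&` H) = (P E * P H)%E) ->
  forall E, <<s C >> E -> P (E `&` H) = (P E * P H)%E.
Proof.
move=> CI CM mH CE E sE.
pose m := mrestr P mH.
have PH0 : 0 <= fine (P H) by apply: fine_ge0.
pose m' := mscale (NngNum PH0) P.
have PHE A : (P A * P H)%E = m' A.
  by rewrite muleC /m' /mscale/= fineK// fin_num_measure.
have [] := @preimage_measure_unique R _ _ T T m m' T C idfun idfun CI _ _ _ _ _ E sE.
- by move=> A /CM.
- by move=> A /CM.
- by rewrite {1}/m /= /mrestr setTI -[LHS]mul1e -(probability_setT P); exact: PHE.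
- by rewrite /m /= /mrestr setTI -ge0_fin_numE// fin_num_measure.
- by move=> A CA; apply: etrans (CE A CA) _; exact: PHE.
- by move=> _ _ e; rewrite PHE; exact: e.
Qed.

Lemma independent2_g_sigma (C D : set_system T) :
  setI_closed C -> setI_closed D -> C `<=` measurable -> D `<=` measurable ->
  independent2 P C D -> independent2 P <<s C >> <<s D >>.
Proof.
move=> CI DI CM DM CD E F sE sF.
apply: (@product_rule_g_sigma C F) => //; first exact: g_sigma_measurable sF.
move=> A CA; rewrite setIC muleC.
apply: (@product_rule_g_sigma D A) => //; first exact: CM.
by move=> B DB; rewrite setIC muleC; exact: CD.
Qed.

End product_rules.

Section finite_rectangles.
Context {U : Type} {I : eqType}.
Implicit Types (D : set I) (F : I -> set_system U).

(** A pi-system for the sigma-algebra generated by the [F i] with [i] in [D]. The sides form a total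
    family, equal to [setT] off the list, so that rectangles over different lists intersect
    coordinatewise. *)
Definition fin_rect D F : set_system U :=
  [set E | exists (s : seq I) (A : I -> set U),
    [/\ forall i, F i (A i), forall i, i \notin s -> A i = setT,
        forall i, i \in s -> D i & E = \bigcap_(i in [set` s]) A i]].

Lemma fin_rectI D F : (forall i, setI_closed (F i)) -> setI_closed (fin_rect D F).
Proof.
move=> FI _ _ [s1 [A1 [F1 T1 D1 ->]]] [s2 [A2 [F2 T2 D2 ->]]].
exists (s1 ++ s2), (fun i => A1 i `&` A2 i); split.
- by move=> i; exact: FI.
- by move=> i; rewrite mem_cat negb_or => /andP[/T1 -> /T2 ->]; rewrite setTI.
- by move=> i; rewrite mem_cat => /orP[/D1|/D2].
- apply/seteqP; split => w /=.
    move=> [h1 h2] i _; split.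
      by have [/h1//|/T1 ->] := boolP (i \in s1).
    by have [/h2//|/T2 ->] := boolP (i \in s2).
  by move=> h; split=> i si; [have [] := h i|have [] := h i]; rewrite //= mem_cat si ?orbT.
Qed.

Lemma sub_fin_rect D F i : (forall i, F i setT) -> D i -> F i `<=` fin_rect D F.
Proof.
move=> FT Di A FA; exists [:: i], (fun j => if j == i then A else setT); split.
- by move=> j; case: eqP => // ->.
- by move=> j; rewrite inE => /negbTE ->.
- by move=> j; rewrite inE => /eqP ->.
- by rewrite bigcap_seq_eqType big_seq1 eqxx.
Qed.

Lemma g_sigma_fin_rect D F : (forall i, F i setT) ->
  <<s fin_rect D F >> = <<s \bigcup_(i in D) F i >>.
Proof.
move=> FT; apply/seteqP; split.
  apply: smallest_sub; first exact: smallest_sigma_algebra.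
  move=> _ [s [A [FA _ Ds ->]]]; rewrite bigcap_seq_eqType.
  rewrite big_seq; apply: big_ind => [||i si].
  - exact: g_sigma_setT.
  - exact: g_sigma_setI.
  - by apply: sub_sigma_algebra; exists i; [exact: Ds|exact: FA].
apply: smallest_sub; first exact: smallest_sigma_algebra.
move=> A [i Di FA]; apply: sub_sigma_algebra; exact: sub_fin_rect FA.
Qed.

End finite_rectangles.

Lemma sigma_algebra_g_sigma (U : Type) (C : set_system U) :
  sigma_algebra setT C -> <<s C >> = C.
Proof.
move=> sC; apply/seteqP; split; last exact: sub_sigma_algebra.
exact: smallest_sub.
Qed.

Section sigma_rv_theory.
Context {d} {T : measurableType d} {d'} {V : measurableType d'}.
Implicit Types X : T -> V.

Lemma sigma_rvE X E : sigma_rv X E <-> exists2 A, measurable A & E = X @^-1` A.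
Proof.
split=> [[A mA <-]|[A mA ->]]; first by exists A; rewrite ?setTI.
by exists A; rewrite ?setTI.
Qed.

Lemma sigma_rvT X : sigma_rv X setT.
Proof. by apply/sigma_rvE; exists setT. Qed.

Lemma sigma_rvI X : setI_closed (sigma_rv X).
Proof.
move=> _ _ /sigma_rvE[A mA ->] /sigma_rvE[B mB ->].
by apply/sigma_rvE; exists (A `&` B); [exact: measurableI|].
Qed.

Lemma sigma_rv_measurable X : measurable_fun setT X -> sigma_rv X `<=` measurable.
Proof.
move=> mX _ /sigma_rvE[A mA ->]; rewrite -[X in measurable X]setTI.
exact: mX.
Qed.

Lemma sigma_rv_preimage X A : measurable A -> sigma_rv X (X @^-1` A).
Proof. by move=> mA; apply/sigma_rvE; exists A. Qed.

Lemma sigma_family_fin_rect (I : eqType) (D : set I) (X : I -> T -> V) :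
  sigma_family D X = <<s fin_rect D (fun i => sigma_rv (X i)) >>.
Proof. by rewrite g_sigma_fin_rect// => i; exact: sigma_rvT. Qed.

Lemma sigma_family_measurable (I : Type) (D : set I) (X : I -> T -> V) :
  (forall i, D i -> measurable_fun setT (X i)) -> sigma_family D X `<=` measurable.
Proof.
move=> mX; apply: g_sigma_measurable => E [i Di]; apply: sigma_rv_measurable.
exact: mX.
Qed.

End sigma_rv_theory.

Section independence.
Context {d} {T : measurableType d} {R : realType}.
Variable P : probability T R.

(* In each coordinate one of the two rectangles is the full set. *)
Lemma mutually_independent_blocks (I : eqType) (F : I -> set_system T)
    (D D' : set I) :
  mutually_independent P F -> (forall i, F i setT) ->
  (forall i, setI_closed (F i)) -> (forall i, F i `<=` measurable) ->
  D `&` D' `<=` set0 ->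
  independent2 P <<s \bigcup_(i in D) F i >> <<s \bigcup_(i in D') F i >>.
Proof.
move=> indF FT FI FM DD'; rewrite -!g_sigma_fin_rect//.
have rM E : fin_rect E F `<=` measurable.
  move=> _ [s [A [FA _ _ ->]]]; rewrite bigcap_seq_eqType.
  by apply: big_ind => // [|i _]; [exact: measurableI|exact: FM].
apply: independent2_g_sigma; [exact: fin_rectI|exact: fin_rectI|exact: rM|exact: rM|].
move=> _ _ [s1 [A1 [F1 T1 D1 ->]]] [s2 [A2 [F2 T2 D2 ->]]].
pose s := undup (s1 ++ s2).
have us : uniq s by exact: undup_uniq.
have E1 : \bigcap_(i in [set` s1]) A1 i = \bigcap_(i in [set` s]) A1 i.
  apply/seteqP; split => w /= h i.
    by have [/h//|/T1 ->] := boolP (i \in s1).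
  by move=> si; apply: h; rewrite /= mem_undup mem_cat si.
have E2 : \bigcap_(i in [set` s2]) A2 i = \bigcap_(i in [set` s]) A2 i.
  apply/seteqP; split => w /= h i.
    by have [/h//|/T2 ->] := boolP (i \in s2).
  by move=> si; apply: h; rewrite /= mem_undup mem_cat si orbT.
rewrite E1 E2 -bigcapI !indF//; last by move=> i _; exact: FI.
rewrite -big_split/=; apply: eq_bigr => i _.
have [i1|/T1 ->] := boolP (i \in s1); last by rewrite setTI probability_setT mul1e.
rewrite (T2 i) ?setIT ?probability_setT ?mule1//.
by apply/negP => i2; apply: (DD' i); split; [exact: D1|exact: D2].
Qed.

End independence.

(** * Laws of paths *)

Section path_space.
Context {R : realType}.

Definition coord_system (I : Type) (i : I) : set_system (I -> R) :=
  preimage_set_system setT (fun f => f i) measurable.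

Definition path_sigma : set_system (R -> R) :=
  <<s \bigcup_(t in [set t : R | 0 <= t]) coord_system t >>.

Lemma coord_systemE I (i : I) E :
  coord_system i E <-> exists2 A, measurable A & E = [set f | A (f i)].
Proof.
split=> [[A mA <-]|[A mA ->]]; first by exists A; rewrite ?setTI.
by exists A; rewrite ?setTI.
Qed.

Lemma coord_systemT I (i : I) : coord_system i setT.
Proof. by apply/coord_systemE; exists setT. Qed.

Lemma coord_systemI I (i : I) : setI_closed (coord_system i).
Proof.
move=> _ _ /coord_systemE[A mA ->] /coord_systemE[B mB ->].
by apply/coord_systemE; exists (A `&` B); [exact: measurableI|].
Qed.

Lemma path_sigma_coord t A : 0 <= t -> measurable A -> path_sigma [set f | A (f t)].
Proof.
by move=> t0 mA; apply: sub_sigma_algebra; exists t => //; apply/coord_systemE; exists A.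
Qed.

Lemma coord_rect_choose (I : Type) (A : I -> set (I -> R)) :
  (forall i, coord_system i (A i)) ->
  exists B : I -> set R, forall i, measurable (B i) /\ A i = [set f | B i (f i)].
Proof.
move=> hA.
have h i : exists B : set R, measurable B /\ A i = [set f | B (f i)].
  by have /coord_systemE[B mB ->] := hA i; exists B.
by have [B hB] := choice h; exists B.
Qed.

Lemma g_sigma_partial_sum (n : nat) (A : set R) : measurable A ->
  <<s fin_rect setT (@coord_system nat) >> [set x : nat -> R | A (\sum_(i < n) x i)].
Proof.
move=> mA; set C := fin_rect _ _.
have mX (i : nat) :
    measurable_fun setT (fun x : g_sigma_algebraType C => (x : nat -> R) i).
  move=> _ B mB; rewrite setTI; apply: sub_sigma_algebra.
  apply: (@sub_fin_rect _ _ setT (@coord_system nat) i) => //.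
    by move=> j; exact: coord_systemT.
  by apply/coord_systemE; exists B.
have mS : measurable_fun setT
    (fun x : g_sigma_algebraType C => \sum_(i < n) (x : nat -> R) i).
  by apply: measurable_sum => i; exact: mX.
by have := mS measurableT A mA; rewrite setTI.
Qed.

(** Finitely many times are put into the form in which independence of increments is stated, a
    nondecreasing sequence; it is constant after the last of them. *)
Lemma sorted_time_grid (s : seq R) : all (>= 0) s ->
  exists u : nat -> R,
    [/\ u 0%N = 0, {homo u : i j / (i <= j)%N >-> i <= j} &
        forall t, t \in s -> exists i, u i = t].
Proof.
move=> s0; pose g := sort <=%O (0 :: s).
have sg : sorted <=%O g by exact: sort_le_sorted.
have g0 : (0 < size g)%N by rewrite size_sort.
pose u i := nth 0 g (minn i (size g).-1).
have um i j : (i <= j)%N -> u i <= u j.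
  move=> ij; apply: (sorted_leq_nth le_trans le_refl 0 sg); rewrite ?inE; lia.
have us t : t \in 0 :: s -> exists i, u i = t.
  move=> ts; exists (index t g); rewrite /u (minn_idPl _) ?nth_index ?mem_sort//.
  by rewrite -ltnS prednK// index_mem mem_sort.
exists u; split => //.
- apply/eqP; rewrite eq_le; apply/andP; split.
    by have [i <-] := us 0 (mem_head _ _); exact: um.
  rewrite /u min0n; have : nth 0 g 0 \in g by exact: mem_nth.
  by rewrite mem_sort inE => /orP[/eqP ->//|/(allP s0)].
- by move=> t ts; apply: us; rewrite inE ts orbT.
Qed.

(** Both processes start at 0, so values at grid times are partial sums of increments: the law of
    the increments along a common grid gives the finite-dimensional laws, and these give the law on
    [path_sigma]. The grid can be made to pass through a prescribed time [v], as a reflection at [v]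
    requires. *)
Lemma path_law_unique d d' (T : measurableType d) (T' : measurableType d')
    (m : {measure set T -> \bar R}) (m' : {measure set T' -> \bar R})
    (Z : R -> T -> R) (Z' : R -> T' -> R) (v : R) :
  0 <= v -> m setT = m' setT -> (m setT < +oo)%E ->
  (forall w, Z 0 w = 0) -> (forall w, Z' 0 w = 0) ->
  (forall t : R, 0 <= t -> measurable_fun setT (Z t)) ->
  (forall t : R, 0 <= t -> measurable_fun setT (Z' t)) ->
  (forall u : nat -> R, u 0%N = 0 -> {homo u : i j / (i <= j)%N >-> i <= j} ->
    (exists i, u i = v) ->
    forall (s : seq nat) (A : nat -> set R), uniq s -> (forall i, measurable (A i)) ->
    m (\bigcap_(i in [set` s]) [set w | A i (Z (u i.+1) w - Z (u i) w)])
    = m' (\bigcap_(i in [set` s]) [set w | A i (Z' (u i.+1) w - Z' (u i) w)])) ->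
  forall E, path_sigma E ->
    [/\ measurable [set w | E (Z ^~ w)], measurable [set w | E (Z' ^~ w)] &
        m [set w | E (Z ^~ w)] = m' [set w | E (Z' ^~ w)]].
Proof.
move=> v0 mT moo Z0 Z0' mZ mZ' mm E.
rewrite /path_sigma -g_sigma_fin_rect; last by move=> i; exact: coord_systemT.
set C := fin_rect _ _.
have main F : C F -> [/\ measurable [set w | F (Z ^~ w)],
    measurable [set w | F (Z' ^~ w)] &
    m [set w | F (Z ^~ w)] = m' [set w | F (Z' ^~ w)]].
  move=> [s [A [/coord_rect_choose[B hB] _ s0 ->]]].
  have [|u [u0 um us]] := @sorted_time_grid (v :: s).
    by rewrite /= v0; apply/allP => t /s0.
  have uge0 i : 0 <= u i by rewrite -u0; exact: um.
  have [k hk] : exists k, forall t, t \in s -> u (k t) = t.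
    have h t : exists i, t \in s -> u i = t.
      have [ts|nts] := boolP (t \in s); last by exists 0%N.
      by have [|i ui] := us t; [rewrite inE ts orbT|exists i].
    by have [k hk] := choice h; exists k.
  pose E' : set (nat -> R) :=
    \bigcap_(t in [set` s]) [set x : nat -> R | B t (\sum_(i < k t) x i)].
  have sE' : <<s fin_rect setT (@coord_system nat) >> E'.
    rewrite /E' bigcap_seq_eqType; apply: big_ind => [||t _].
    - exact: g_sigma_setT.
    - exact: g_sigma_setI.
    - by apply: g_sigma_partial_sum; have [] := hB t.
  have tele (W : R -> R) : W 0 = 0 -> forall t, t \in s ->
      \sum_(i < k t) (W (u i.+1) - W (u i)) = W t.
    move=> W0 t ts; rewrite -(big_mkord xpredT (fun i => W (u i.+1) - W (u i))).
    by rewrite (telescope_sumr (W \o u))//= u0 W0 subr0 hk.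
  have ZE (V : Type) (W : R -> V -> R) : (forall w, W 0 w = 0) ->
      [set w | (\bigcap_(t in [set` s]) A t) (W ^~ w)] =
      (fun w i => W (u i.+1) w - W (u i) w) @^-1` E'.
    move=> W0; apply/seteqP; split => w /= h t ts.
      by rewrite /= (tele (W ^~ w))//; have := h t ts; rewrite (hB t).2.
    by rewrite (hB t).2/= -(tele (W ^~ w))//; exact: h t ts.
  rewrite (ZE _ Z)// (ZE _ Z')//; move: sE'.
  have rectE F' : fin_rect setT (@coord_system nat) F' -> exists s' B',
      [/\ uniq s', forall i, measurable (B' i) & forall (V : Type) (W : R -> V -> R),
       (fun w i => W (u i.+1) w - W (u i) w) @^-1` F' =
       \bigcap_(i in [set` s']) [set w | B' i (W (u i.+1) w - W (u i) w)]].
    move=> [s' [A' [/coord_rect_choose[B' hB'] _ _ ->]]].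
    exists (undup s'), B'; split; [exact: undup_uniq|by move=> i; have [] := hB' i|].
    move=> V W; apply/seteqP; split => w /= h i /=.
      by rewrite mem_undup => is'; have := h i is'; rewrite (hB' i).2.
    by move=> is'; rewrite (hB' i).2/=; apply: h; rewrite /= mem_undup.
  have mrect d0 (T0 : measurableType d0) (W : R -> T0 -> R) F' :
      (forall t : R, 0 <= t -> measurable_fun setT (W t)) ->
      fin_rect setT (@coord_system nat) F' ->
      measurable ((fun w i => W (u i.+1) w - W (u i) w) @^-1` F').
    move=> mW /rectE[s' [B' [_ mB' ->]]]; rewrite bigcap_seq_eqType.
    apply: big_ind => // [|i _]; first exact: measurableI.
    have mWi : measurable_fun setT (fun w => W (u i.+1) w - W (u i) w).
      by apply: measurable_funB; exact: mW.
    by have := mWi measurableT _ (mB' i); rewrite setTI.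
  apply: preimage_measure_unique => //.
  - by apply: fin_rectI => i; exact: coord_systemI.
  - by move=> F' /(mrect _ _ Z); apply.
  - by move=> F' /(mrect _ _ Z'); apply.
  - move=> F' /rectE[s' [B' [us' mB' e]]]; rewrite !e; apply: mm => //.
    by have [|i ui] := us v; [rewrite mem_head|exists i].
move=> sE; have := @preimage_measure_unique R _ _ T T' m m' _ C
   (fun w => Z ^~ w) (fun w => Z' ^~ w).
apply => //.
- by apply: fin_rectI => i; exact: coord_systemI.
- by move=> F /main[].
- by move=> F /main[].
- by move=> F /main[].
Qed.

Lemma sigma_process_path (d : measure_display) (T : measurableType d)
    (Z : R -> T -> R) E :
  sigma_process Z E -> exists2 F, path_sigma F & E = [set w | F (Z ^~ w)].
Proof.
have sP : sigma_algebra setT path_sigma by exact: smallest_sigma_algebra.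
suff : sigma_process Z `<=` preimage_set_system setT (fun w => Z ^~ w) path_sigma.
  by move=> h /h[F pF <-]; exists F; rewrite ?setTI.
apply: smallest_sub; first exact: sigma_algebra_preimage.
move=> _ [t /= t0 /sigma_rvE[A mA ->]].
by exists [set f | A (f t)]; [exact: path_sigma_coord|rewrite setTI].
Qed.

Lemma path_sigma_process (d : measure_display) (T : measurableType d)
    (Z : R -> T -> R) F :
  path_sigma F -> sigma_process Z [set w | F (Z ^~ w)].
Proof.
have sP : sigma_algebra setT (sigma_process Z) by exact: smallest_sigma_algebra.
move: F; suff : path_sigma `<=` image_set_system setT (fun w => Z ^~ w) (sigma_process Z).
  by move=> h F /h; rewrite /image_set_system/= setTI.
apply: smallest_sub; first exact: sigma_algebra_image.
move=> _ [t /= t0 /coord_systemE[A mA ->]]; rewrite /image_set_system/= setTI.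
by apply: sub_sigma_algebra; exists t => //; exact: sigma_rv_preimage.
Qed.

End path_space.

Section normal_symmetry.
Context {R : realType}.

Lemma normal_probN (sigma : R) (A : set R) : sigma != 0 -> measurable A ->
  normal_prob 0 sigma [set x | A (- x)] = normal_prob 0 sigma A.
Proof.
move=> s0 mA.
have pdfN x : normal_pdf 0 sigma (- x) = normal_pdf 0 sigma x.
  by rewrite !normal_pdfE//= /normal_fun !subr0 sqrrN.
rewrite /normal_prob.
rewrite (_ : [set x | A (- x)] = (-%R : _ -> measurableTypeR R) @^-1` A)//.
under eq_integral do rewrite -pdfN.
transitivity (\int[pushforward lebesgue_measure (-%R : _ -> measurableTypeR R)]_(y in A)
    (normal_pdf 0 sigma y)%:E)%E.
  rewrite ge0_integral_pushforward//.
  - apply: (@measurable_funS _ _ _ _ setT) => //.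
    by apply/measurable_EFinP; exact: measurable_normal_pdf.
  - by move=> x _; rewrite lee_fin normal_pdf_ge0.
by apply: eq_measure_integral => //= B mB _; exact: lebesgue_measureN.
Qed.

End normal_symmetry.

Section reflection.
Context {R : realType}.

(** The increments change sign up to [v] and are kept afterwards. For [v] = +oo the whole path is
    reflected and [fine v] is never consulted. *)
Definition reflect_path (f : R -> R) (v : \bar R) (t : R) : R :=
  if (t%:E <= v)%E then - f t else - f (fine v) + (f t - f (fine v)).

Lemma reflect_path_le (f : R -> R) (v : \bar R) (t : R) :
  (t%:E <= v)%E -> reflect_path f v t = - f t.
Proof. by rewrite /reflect_path => ->. Qed.

Lemma reflect_path_ge (f : R -> R) (v t : R) :
  v <= t -> reflect_path f v%:E t = f t - 2 * f v.
Proof.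
rewrite /reflect_path lee_fin /= => vt; case: leP => tv; last by ring.
have -> : t = v by apply/eqP; rewrite eq_le tv vt.
by ring.
Qed.

Context {d} {T : measurableType d}.
Variable P : probability T R.

Lemma brownian_increment_sym (B : R -> T -> R) (s t : R) A : brownian_motion P B ->
  0 <= s -> s <= t -> measurable A ->
  P [set w | A (- (B t w - B s w))] = P [set w | A (B t w - B s w)].
Proof.
move=> bB s0; rewrite le_eqVlt => /orP[/eqP <-|st] mA.
  by congr (P _); apply/seteqP; split => w /=; rewrite subrr oppr0.
have sig0 : Num.sqrt (t - s) != 0 by rewrite gt_eqF// sqrtr_gt0 subr_gt0.
have mNA : measurable [set x : R | A (- x)].
  rewrite -[X in measurable X]setTI; exact: (oppr_measurable measurableT).
have := bm_gauss bB s0 st mA; rewrite /pushforward /preimage /= => ->.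
have := bm_gauss bB s0 st mNA; rewrite /pushforward /preimage /= => ->.
exact: normal_probN.
Qed.

Lemma brownian_increment_measurable (B : R -> T -> R) (s t : R) : brownian_motion P B ->
  0 <= s -> 0 <= t -> measurable_fun setT (fun w => B t w - B s w).
Proof. by move=> bB s0 t0; apply: measurable_funB; exact: (bm_meas bB). Qed.

(* Reflecting before a fixed time only changes the sign of the increments before
   that time. *)
Lemma reflect_path_law (B : R -> T -> R) (v : R) : brownian_motion P B -> 0 <= v ->
  forall E, path_sigma E ->
    [/\ measurable [set w | E (B ^~ w)],
        measurable [set w | E (reflect_path (B ^~ w) v%:E)] &
        P [set w | E (B ^~ w)] = P [set w | E (reflect_path (B ^~ w) v%:E)]].
Proof.
move=> bB v0.
pose Z t w := reflect_path (B ^~ w) v%:E t.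
apply: (@path_law_unique _ _ _ _ _ P P B Z v) => //.
- by rewrite -ge0_fin_numE// fin_num_measure.
- exact: bm_0 bB.
- by move=> w; rewrite /Z reflect_path_le ?lee_fin//= (bm_0 bB) oppr0.
- exact: (bm_meas bB).
- move=> t t0; rewrite /Z /reflect_path lee_fin /=; case: leP => _.
    by apply: measurableT_comp => //; exact: (bm_meas bB).
  apply: measurable_funD; last exact: brownian_increment_measurable.
  by apply: measurableT_comp => //; exact: (bm_meas bB).
move=> u u0 um [j uj] s A us mA.
have uge0 i : 0 <= u i by rewrite -u0; exact: um.
(* Since [u j] is the reflection time, each increment lies entirely before or after it, and the
   change of sign can be moved into the sets with index below [j]. *)
pose A' i : set R := if (i < j)%N then [set x | A i (- x)] else A i.
have mA' i : measurable (A' i).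
  rewrite /A'; case: ifP => // _; rewrite -[X in measurable X]setTI.
  exact: (oppr_measurable measurableT).
have ZE i : [set w | A i (Z (u i.+1) w - Z (u i) w)] =
            [set w | A' i (B (u i.+1) w - B (u i) w)].
  rewrite /Z /A'; apply/seteqP; suff h w :
      A i (reflect_path (B^~ w) v%:E (u i.+1) - reflect_path (B^~ w) v%:E (u i)) <->
      (if (i < j)%N then [set x | A i (- x)] else A i) (B (u i.+1) w - B (u i) w).
    by split => w /h.
  case: ifPn => [ij|]; rewrite -?leqNgt.
    rewrite !reflect_path_le ?lee_fin -?uj ?um//; last exact: ltnW.
    by rewrite /= opprB opprK addrC.
  move=> ji; rewrite !reflect_path_ge -?uj ?um//; last exact: leqW.
  by rewrite (_ : _ - _ = B (u i.+1) w - B (u i) w)//; ring.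
under [in RHS]eq_bigcapr do rewrite ZE.
have ind (C : nat -> set R) : (forall i, measurable (C i)) ->
    P (\bigcap_(i in [set` s]) [set w | C i (B (u i.+1) w - B (u i) w)]) =
    (\prod_(i <- s) P [set w | C i (B (u i.+1) w - B (u i) w)%R])%E.
  move=> mC; apply: (bm_indep bB (uge0 0%N) um) => // i _.
  by apply/sigma_rvE; exists (C i).
apply: etrans (ind A mA) _; apply: etrans _ (esym (ind A' mA')).
apply: eq_bigr => i _; rewrite /A'; case: ifP => // _.
apply/esym; exact: (brownian_increment_sym bB (uge0 i) (um _ _ (leqnSn i)) (mA i)).
Qed.

End reflection.

(** * Hitting times and the reflection principle *)

Section hitting_time.
Context {R : realType}.
Implicit Types f : R -> R.

(** By conversion [hit_time B w] is [hit_path (B ^~ w)]; this form lets a single path be studied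
    without any probability. *)
Definition hit_path f : \bar R :=
  ereal_inf [set t%:E | t in
    [set t : R | 0 <= t /\ (f t / 2 = - (pi / 2) \/ f t / 2 = pi / 2)]].

(* The times v * min(1, i / (k + 1)) are dense in [0, v]: only countably many
   are used, so that this is an event of the product sigma-algebra. *)
Definition stays_below (v : R) : set (R -> R) :=
  \bigcup_m \bigcap_k \bigcap_i
    [set f | `|f (v * Num.min 1 (i%:R / k.+1%:R))| <= pi - m.+1%:R^-1].

Lemma path_sigma_stays_below (v : R) : 0 <= v -> path_sigma (stays_below v).
Proof.
move=> v0; apply: g_sigma_bigcup => m; apply: g_sigma_bigcap => k.
apply: g_sigma_bigcap => i.
have t0 : 0 <= v * Num.min 1 (i%:R / k.+1%:R).
  by rewrite mulr_ge0// le_min ler01 divr_ge0.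
have mA : measurable [set x : R | `|x| <= pi - m.+1%:R^-1].
  rewrite (_ : [set _ | _] = `[- (pi - m.+1%:R^-1), pi - m.+1%:R^-1]%classic)//.
  by apply/seteqP; split => x /=; rewrite in_itv /= ler_norml.
exact: path_sigma_coord mA.
Qed.

Lemma ray_continuousP f : {within `[0, +oo[%classic, continuous f} ->
  forall t e : R, 0 <= t -> 0 < e -> exists2 delta : R, 0 < delta &
    forall s : R, 0 <= s -> `|s - t| < delta -> `|f s - f t| < e.
Proof.
move=> /subspace_continuousP cf t e t0 e0.
have /cf : `[0, +oo[%classic t by rewrite /= in_itv /= t0.
move=> /cvgrPdist_lt /(_ e e0); rewrite near_withinE.
move=> [dl /= dl0 h]; exists dl => // s s0 st; rewrite distrC; apply: h.
  by rewrite /= distrC.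
by rewrite /= in_itv /= s0.
Qed.

Lemma continuous_ray f :
  (forall t e : R, 0 <= t -> 0 < e -> exists2 delta : R, 0 < delta &
    forall s : R, 0 <= s -> `|s - t| < delta -> `|f s - f t| < e) ->
  {within `[0, +oo[%classic, continuous f}.
Proof.
move=> h; apply/subspace_continuousP => t /=; rewrite in_itv /= andbT => t0.
apply/cvgrPdist_lt => e e0; rewrite near_withinE.
have [dl dl0 hdl] := h t e t0 e0.
exists dl => // s /= st; rewrite in_itv /= andbT => s0; rewrite distrC.
by apply: hdl => //; rewrite distrC.
Qed.

Lemma ray_continuousW f (a b : R) : 0 <= a ->
  {within `[0, +oo[%classic, continuous f} -> {within `[a, b]%classic, continuous f}.
Proof.
move=> a0; apply: continuous_subspaceW => x /=; rewrite !in_itv /= andbT.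
by move=> /andP[ax _]; exact: le_trans ax.
Qed.

Lemma half_hit (x : R) : (x / 2 = - (pi / 2) \/ x / 2 = pi / 2) <-> `|x| = pi.
Proof.
split=> [[h|h]|].
- have -> : x = - pi by lra.
  by rewrite normrN ger0_norm// pi_ge0.
- have -> : x = pi by lra.
  by rewrite ger0_norm// pi_ge0.
- move=> h; have := ler_norm x; have := ler_norm (- x); rewrite normrN.
  have [x0|x0] := leP 0 x.
    by move: h; rewrite ger0_norm// => ->; right.
  by move: h; rewrite ltr0_norm// => h; left; rewrite -h; lra.
Qed.

Lemma le_hit_path f (t : R) : 0 <= t -> `|f t| = pi -> (hit_path f <= t%:E)%E.
Proof.
by move=> t0 /half_hit h; apply: ereal_inf_lbound; exists t.
Qed.

Section continuous_path.
Variable f : R -> R.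
Hypotheses (f0 : f 0 = 0) (cf : {within `[0, +oo[%classic, continuous f}).

Lemma path_IVT (t : R) : 0 <= t -> pi <= `|f t| ->
  exists2 s : R, 0 <= s <= t & `|f s| = pi.
Proof.
move=> t0 h; have cN : {within `[0, t]%classic, continuous (fun x => `|f x|)}.
  by move=> x; apply: cvg_norm; exact: ray_continuousW.
have [|s] := IVT t0 cN (v := pi).
  by rewrite f0 normr0 ge_min pi_ge0 le_max h orbT.
by rewrite in_itv /= => s0t <-; exists s.
Qed.

(** A path that has left (-pi, pi) has hit the boundary before, by the intermediate value theorem.
    Conversely, by continuity at [v], a path inside at time [v] stays inside a little longer, which
    makes the infimum strictly larger than [v]. *)
Lemma lt_hit_pathP (v : R) : 0 <= v ->
  (v%:E < hit_path f)%E <-> forall s : R, 0 <= s <= v -> `|f s| < pi.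
Proof.
move=> v0; split => [vh s /andP[s0 sv]|h].
  rewrite ltNge; apply/negP => /(path_IVT s0)[r /andP[r0 rs] fr].
  have := le_hit_path r0 fr; rewrite leNgt (le_lt_trans _ vh)// lee_fin.
  exact: le_trans sv.
have fv : `|f v| < pi by apply: h; rewrite v0 lexx.
have [dl dl0 hdl] := ray_continuousP cf v0 (e := pi - `|f v|) ltac:(by rewrite subr_gt0).
apply: (@lt_le_trans _ _ (v + dl)%:E); first by rewrite lte_fin ltrDl.
apply: le_ereal_inf_tmp => _ [t [t0 /half_hit ft] <-]; rewrite lee_fin leNgt.
apply/negP => tv; have [tv'|vt] := leP t v.
  by have := h t; rewrite t0 tv' ft ltxx => /(_ isT).
have := hdl t t0; rewrite gtr0_norm ?subr_gt0// ltrBlDl => /(_ tv).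
by have := lerB_dist (f t) (f v); rewrite ft => ? ?; lra.
Qed.

Lemma hit_path_gt0 : (0%:E < hit_path f)%E.
Proof.
apply/(lt_hit_pathP (lexx 0)) => s /andP[s0 s0']; have -> : s = 0 by lra.
by rewrite f0 normr0 pi_gt0.
Qed.

Lemma hit_path_attained r : hit_path f = r%:E -> 0 < r /\ `|f r| = pi.
Proof.
move=> hr; have r0 : 0 < r by have := hit_path_gt0; rewrite hr lte_fin.
split => //; have [frlt|] := ltP (`|f r|) pi.
  have : (r%:E < hit_path f)%E; last by rewrite hr ltxx.
  apply/(lt_hit_pathP (ltW r0)) => s /andP[s0].
  rewrite le_eqVlt => /orP[/eqP ->//|sr].
  have /(lt_hit_pathP s0) : (s%:E < hit_path f)%E by rewrite hr lte_fin.
  by apply; rewrite s0 lexx.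
move=> /(path_IVT (ltW r0))[s /andP[s0 sr] fs].
have := le_hit_path s0 fs; rewrite hr lee_fin => rs.
by have <- : s = r by apply/eqP; rewrite eq_le sr rs.
Qed.

(** The uniform margin 1/(m+1) carries the strict bound from the dense times over to all of [0, v].
    Conversely, the maximum of |f| on this compact interval is below pi and provides [m]. *)
Lemma stays_belowP (v : R) : 0 <= v -> stays_below v f <-> (v%:E < hit_path f)%E.
Proof.
move=> v0; split => [[m _ hm]|/(lt_hit_pathP v0) h].
  apply/(lt_hit_pathP v0) => s /andP[s0 sv].
  apply: (@le_lt_trans _ _ (pi - m.+1%:R^-1)); last by rewrite ltrBlDr ltrDl.
  rewrite leNgt; apply/negP => hs.
  have [dl dl0 hdl] := ray_continuousP cf s0
    (e := `|f s| - (pi - m.+1%:R^-1)) ltac:(by rewrite subr_gt0).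
  suff [k [i [hik st]]] : exists k i : nat,
      i%:R / k.+1%:R <= 1 :> R /\ `|v * (i%:R / k.+1%:R) - s| < dl.
    have := hm k I i I; rewrite /= (min_idPr hik) leNgt => /negP; apply.
    have q0 : 0 <= v * (i%:R / k.+1%:R) by rewrite mulr_ge0// divr_ge0.
    move: st q0; set x := v * _ => st q0.
    have h1 : `|f s| - `|f x| <= `|f x - f s| by rewrite distrC lerB_dist.
    have h2 := hdl _ q0 st.
    move: h1 h2; set c := pi - _; set A := `|f x|; set B := `|f s|; set D := `|_|.
    by clear; clearbody A B c D; move=> h1 h2; lra.
  have [v00|vN0] := eqVneq v 0.
    exists 0%N, 0%N; rewrite mul0r mulr0 sub0r normrN; split => //.
    have -> : s = 0 by lra.
    by rewrite normr0.
  have vgt0 : 0 < v by rewrite lt_neqAle eq_sym vN0.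
  (* A mesh v/(k+1) smaller than [dl]; [i] is then the last mesh point not beyond [s]. *)
  have [k hk] : exists k : nat, v / dl < k.+1%:R.
    by exists (Num.truncn (v / dl)); exact: truncnS_gt.
  pose i := Num.truncn (s / v * k.+1%:R); exists k, i.
  have q0 : 0 <= s / v * k.+1%:R by rewrite mulr_ge0// divr_ge0.
  have /andP[i1 i2] := truncn_itv q0; rewrite -/i in i1 i2.
  have kp : 0 < k.+1%:R :> R by [].
  split.
    rewrite ler_pdivrMr// mul1r; apply: le_trans i1 _.
    by rewrite ler_piMl// ler_pdivrMr// mul1r.
  have e1 : v * (i%:R / k.+1%:R) <= s.
    by rewrite mulrA ler_pdivrMr// mulrC -ler_pdivlMr// mulrAC.
  have e2 : s < v * (i%:R / k.+1%:R) + v / k.+1%:R.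
    rewrite (_ : _ + _ = v * (i.+1%:R / k.+1%:R)); last first.
      by rewrite -(natr1 i) mulrDl mul1r mulrDr.
    by rewrite mulrA ltr_pdivlMr// [v * _]mulrC -ltr_pdivrMr// mulrAC.
  have e3 : v / k.+1%:R < dl.
    by rewrite ltr_pdivrMr// -ltr_pdivrMl// mulrC.
  rewrite distrC ger0_norm ?subr_ge0// ltrBlDl; apply: lt_trans e2 _.
  by rewrite ltrD2l.
have cN : {within `[0, v]%classic, continuous (fun x => `|f x|)}.
  by move=> x; apply: cvg_norm; exact: ray_continuousW.
have [c] := EVT_max v0 cN; rewrite in_itv /= => cv hc.
have /ltr_add_invr[m hm] := h c cv; exists m => // k _ i _ /=.
apply: (@le_trans _ _ `|f c|); last by rewrite lerBrDr ltW.
have q0 : 0 <= Num.min 1 (i%:R / k.+1%:R) :> R by rewrite le_min ler01 divr_ge0.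
by apply: hc; rewrite in_itv /= mulr_ge0//= ler_piMr// ge_min lexx.
Qed.

Lemma norm_reflect_path (v : \bar R) t : (t%:E <= v)%E -> `|reflect_path f v t| = `|f t|.
Proof. by move=> tv; rewrite reflect_path_le// normrN. Qed.

End continuous_path.

(** Reflection keeps |f| up to time [v], hence also what the path reveals about its hitting time up
    to [v]. *)
Lemma stays_below_reflect f (v : \bar R) (u : R) : 0 <= u -> (u%:E <= v)%E ->
  stays_below u (reflect_path f v) <-> stays_below u f.
Proof.
move=> u0 uv; have e (i k : nat) : `|reflect_path f v (u * Num.min 1 (i%:R / k.+1%:R))| =
    `|f (u * Num.min 1 (i%:R / k.+1%:R))|.
  rewrite norm_reflect_path//; apply: le_trans uv; rewrite lee_fin.
  by rewrite ler_piMr// ge_min lexx.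
by split=> -[m _ h]; exists m => // k _ i _; have := h k I i I; rewrite /= e.
Qed.

Lemma reflect_path_continuous f (v : \bar R) : (0 <= v)%E ->
  {within `[0, +oo[%classic, continuous f} ->
  {within `[0, +oo[%classic, continuous (reflect_path f v)}.
Proof.
move=> v0 cf; apply: continuous_ray => t e t0 e0.
have [dl dl0 hdl] := ray_continuousP cf t0 e0.
have opp_dist (s : R) : `|- f s - - f t| = `|f s - f t| by rewrite -opprD normrN.
case: v v0 => [r| |//] r0; last first.
  by exists dl => // s s0 st; rewrite !reflect_path_le ?leey// opp_dist hdl.
rewrite lee_fin in r0; have [tr|rt|tr] := ltgtP t r.
- exists (Num.min dl (r - t)) => [|s s0]; first by rewrite lt_min dl0 subr_gt0.
  rewrite lt_min => /andP[st sr].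
  rewrite !reflect_path_le ?lee_fin ?(ltW tr) ?opp_dist ?hdl//.
  by move: sr; rewrite ltr_norml => /andP[? ?]; lra.
- exists (Num.min dl (t - r)) => [|s s0]; first by rewrite lt_min dl0 subr_gt0.
  rewrite lt_min => /andP[st sr].
  have rs : r <= s by move: sr; rewrite ltr_norml => /andP[? ?]; lra.
  rewrite !reflect_path_ge ?(ltW rt)//.
  by rewrite (_ : _ - _ - (_ - _) = f s - f t) ?hdl//; ring.
- exists dl => // s s0 st.
  rewrite [reflect_path f r%:E t]reflect_path_le ?lee_fin ?tr//; have [sr|rs] := leP s r.
    by rewrite reflect_path_le ?lee_fin// -tr opp_dist hdl.
  rewrite reflect_path_ge ?(ltW rs)// -tr.
  by rewrite (_ : _ - _ - - _ = f s - f t) ?hdl//; ring.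
Qed.

End hitting_time.

Section measure_limits.
Context {d} {T : measurableType d} {R : realType}.
Variable P : probability T R.

(** An event may be altered on countably many disjoint pieces, as long as its measure on each piece
    is kept. *)
Lemma measure_patch (S X : nat -> set T) (Y : set T) :
  trivIset setT S -> (forall k, measurable (S k)) -> (forall k, measurable (X k)) ->
  measurable Y -> (forall k, P (S k `&` X k) = P (S k `&` Y)) ->
  P ((\bigcup_k (S k `&` X k)) `|` (Y `\` \bigcup_k S k)) = P Y.
Proof.
move=> tS mS mX mY SXY.
have mU : measurable (\bigcup_k S k) by exact: bigcupT_measurable.
have tS' (Z : nat -> set T) : trivIset setT (fun k => S k `&` Z k).
  by move=> i j _ _ [w [[Si _] [Sj _]]]; apply: tS => //; exists w.
have mSX : measurable (\bigcup_k (S k `&` X k)).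
  by apply: bigcupT_measurable => k; exact: measurableI.
rewrite measureU//; last 2 first.
- exact: measurableD.
- by apply/seteqP; split => // w [[k _ [Sk _]] [_]]; apply; exists k.
rewrite -[in RHS](setUIDK Y (\bigcup_k S k)) measureU//; last 3 first.
- exact: measurableI.
- exact: measurableD.
- by apply/seteqP; split => // w [[_ h] [_]].
have sigma_add (Z : nat -> set T) : (forall k, measurable (Z k)) ->
    P (\bigcup_k (S k `&` Z k)) = (\sum_(0 <= k <oo) P (S k `&` Z k))%E.
  move=> mZ; apply: measure_semi_bigcup => //.
    by move=> k; exact: measurableI.
  by apply: bigcupT_measurable => k; exact: measurableI.
congr (_ + _)%E; rewrite setIC setI_bigcupl.
apply: etrans (sigma_add X mX) _; apply: etrans _ (esym (sigma_add (fun=> Y) _)) => //.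
by apply: eq_eseriesr => k _; exact: SXY.
Qed.

(** Fatou's lemma for events: the tail intersections [L N] increase to a set that contains [E], and
    each has measure at most [c]. *)
Lemma measure_liminf_le (E : set T) (F : nat -> set T) (c : \bar R) :
  measurable E -> (forall n, measurable (F n)) ->
  (forall w, E w -> exists N, forall n, (N <= n)%N -> F n w) ->
  (forall n, (P (F n) <= c)%E) -> (P E <= c)%E.
Proof.
move=> mE mF EF Fc; pose L N := \bigcap_(n in [set n | (N <= n)%N]) F n.
have mL N : measurable (L N) by apply: bigcap_measurable => //; exists N => /=.
have mU : measurable (\bigcup_N L N) by exact: bigcupT_measurable.
apply: (@le_trans _ _ (P (\bigcup_N L N))).
  by apply: le_measure; rewrite ?inE// => w /EF[N hN]; exists N.
have cv := nondecreasing_cvg_mu (mu := P) mL mU.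
have ndL : nondecreasing_seq L.
  by move=> m n mn; apply/subsetPset => w h k /= nk; apply: h => /=; exact: leq_trans nk.
have {}cv := cv ndL; rewrite -(cvg_lim _ cv)//; apply: lime_le.
  by apply/cvg_ex; eexists; exact: cv.
apply: nearW => N /=; apply: le_trans (Fc N); apply: le_measure; rewrite ?inE//.
by move=> w; apply => /=.
Qed.

(** Reverse Fatou, by passing to complements. *)
Lemma measure_limsup_ge (E : set T) (F : nat -> set T) (c : \bar R) :
  measurable E -> (forall n, measurable (F n)) ->
  (forall w, (forall N, exists2 n, (N <= n)%N & F n w) -> E w) ->
  (forall n, (c <= P (F n))%E) -> (c <= P E)%E.
Proof.
move=> mE mF FE cF.
have : (P (~` E) <= 1 - c)%E.
  apply: (@measure_liminf_le _ (fun n => ~` F n)).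
  - exact: measurableC.
  - by move=> n; exact: measurableC.
  - move=> w nE; apply: contrapT => h; apply: nE; apply: FE => N.
    apply: contrapT => h'; apply: h; exists N => n Nn Fn; apply: h'; exists n => //.
  - by move=> n; rewrite probability_setC// leeB.
rewrite probability_setC// => h.
have c1 : (c <= 1)%E by apply: le_trans (cF 0%N) _; exact: probability_le1.
have fE := fin_num_measure P E mE; rewrite -(fineK fE) in h *.
case: c c1 h {cF} => [c _|//|_ _]; last by rewrite leNye.
by rewrite -!EFinB !lee_fin lerD2l lerN2.
Qed.

End measure_limits.

Section reflect_path_measurable.
Context {R : realType}.

Lemma path_sigma_coord_fun (t : R) : 0 <= t ->
  measurable_fun setT (fun f : g_sigma_algebraType
     (\bigcup_(t in [set t : R | 0 <= t]) @coord_system R R t) => (f : R -> R) t).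
Proof. by move=> t0 _ A mA; rewrite setTI; exact: path_sigma_coord. Qed.

Lemma path_sigma_reflect (v : R) F : 0 <= v -> path_sigma F ->
  path_sigma [set f | F (reflect_path f v%:E)].
Proof.
move=> v0; pose S := @path_sigma R.
have sS : sigma_algebra setT S by exact: smallest_sigma_algebra.
move: F; suff : S `<=` image_set_system setT (fun f => reflect_path f v%:E) S.
  by move=> h F /h; rewrite /image_set_system/= setTI.
apply: smallest_sub; first exact: sigma_algebra_image.
move=> _ [t /= t0 /coord_systemE[A mA ->]]; rewrite /image_set_system/= setTI.
rewrite /preimage /= /reflect_path lee_fin; have mt := path_sigma_coord_fun t0.
have mv := path_sigma_coord_fun v0; have [tv|vt] := leP t v.
  have := measurableT_comp (@oppr_measurable R setT) mt.
  by move=> /(_ measurableT A mA); rewrite setTI.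
have := measurable_funD (measurableT_comp (@oppr_measurable R setT) mv)
  (measurable_funB mt mv).
by move=> /(_ measurableT A mA); rewrite setTI.
Qed.

Lemma path_sigma_increments (u : nat -> R) (s : seq nat) (A : nat -> set R) :
  (forall i, 0 <= u i) -> (forall i, measurable (A i)) ->
  path_sigma [set f | forall i, i \in s -> A i (f (u i.+1) - f (u i))].
Proof.
move=> u0 mA.
rewrite (_ : [set _ | _] =
  \bigcap_(i in [set` s]) [set f : R -> R | A i (f (u i.+1) - f (u i))]) //.
rewrite bigcap_seq_eqType; apply: big_ind => [||i _].
- exact: g_sigma_setT.
- exact: g_sigma_setI.
- have := measurable_funB (path_sigma_coord_fun (u0 i.+1)) (path_sigma_coord_fun (u0 i)).
  by move=> /(_ measurableT _ (mA i)); rewrite setTI.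
Qed.

End reflect_path_measurable.

Section grid_approximation.
Context {R : realType}.

Definition grid (n k : nat) : R := k%:R / n.+1%:R.

(** Cells are open on the left and closed on the right: in this sense, [stays_below] at two
    successive grid points decides whether [tau] lies between them. For r > 0 the ceiling is
    positive, so the predecessor does not truncate. *)
Definition cell (n : nat) (r : R) : nat := `|Num.ceil (r * n.+1%:R)|%N.-1.

Definition grid_up (n : nat) (x : \bar R) : \bar R :=
  if x is r%:E then (grid n (cell n r).+1)%:E else x.

Lemma grid_ge0 n k : 0 <= grid n k.
Proof. by rewrite /grid divr_ge0. Qed.

Lemma cell_itv n (r : R) k : (grid n k < r <= grid n k.+1) <->
  (k%:R < r * n.+1%:R <= k.+1%:R).
Proof. by rewrite /grid ltr_pdivrMr// ler_pdivlMr. Qed.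

Lemma cell_unique n (r : R) k : grid n k < r <= grid n k.+1 -> cell n r = k.
Proof.
move=> /cell_itv; rewrite /cell => /andP[h1 h2].
rewrite (@ceil_def _ _ k.+1%:Z)//; apply/andP; split; last exact: h2.
by rewrite (_ : k.+1%:Z - 1 = k%:Z)// -addn1 PoszD addrK.
Qed.

Lemma cellP n (r : R) : 0 < r -> grid n (cell n r) < r <= grid n (cell n r).+1.
Proof.
move=> r0; apply/cell_itv; rewrite /cell.
have q0 : 0 < r * n.+1%:R by rewrite mulr_gt0.
have /andP[h1 h2] := ceil_itv (r * n.+1%:R).
have c0 : 0 < Num.ceil (r * n.+1%:R) by rewrite ceil_gt0.
case: (Num.ceil _) c0 h1 h2 => [[|k]|k]// _ h1 h2.
apply/andP; split; last exact: h2.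
by move: h1; rewrite (_ : k.+1%:Z - 1 = k%:Z)// -addn1 PoszD addrK.
Qed.

Lemma grid_up_ge n (x : \bar R) : (0 < x)%E -> (x <= grid_up n x)%E.
Proof.
case: x => [r| |]//; rewrite lte_fin => r0; rewrite /grid_up lee_fin.
by have /andP[] := cellP n r0.
Qed.

Lemma grid_up_lt n (r : R) : 0 < r -> (grid_up n r%:E < (r + n.+1%:R^-1)%:E)%E.
Proof.
move=> r0; rewrite /grid_up lte_fin; have /andP[h _] := cellP n r0.
rewrite (_ : grid n _ = grid n (cell n r) + n.+1%:R^-1) ?ltrD2r//.
by rewrite /grid -(natr1 (cell n r)) mulrDl mul1r.
Qed.

Lemma grid_up_near (r e : R) : 0 < r -> 0 < e ->
  exists N, forall n, (N <= n)%N -> (grid_up n r%:E < (r + e)%:E)%E.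
Proof.
move=> r0 e0; have := @ltr_add_invr R 0 e e0.
move=> [N hN]; exists N => n Nn; apply: lt_trans (grid_up_lt n r0) _.
rewrite lte_fin ltrD2l; apply: le_lt_trans hN; rewrite add0r lef_pV2 ?posrE//.
by rewrite ler_nat.
Qed.

Lemma grid_up_eventually (r : R) (y : \bar R) : 0 < r -> (r%:E < y)%E ->
  exists N, forall n, (N <= n)%N -> (grid_up n r%:E < y)%E.
Proof.
move=> r0; case: y => [j| |]//; last by move=> _; exists 0%N => n _; rewrite ltey.
rewrite lte_fin -subr_gt0 => rj; have [N hN] := grid_up_near r0 rj.
by exists N => n /hN; rewrite subrKC.
Qed.

End grid_approximation.

Section stopped_reflection.
Context {d} {T : measurableType d} {R : realType}.
Variable P : probability T R.
Variables (B : R -> T -> R) (J : T -> \bar R) (G : set_system T).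
Hypothesis bB : brownian_motion P B.
Hypothesis GM : G `<=` measurable.
Hypothesis GT : G setT.
Hypothesis indG : independent2 P (sigma_process B) G.
Hypothesis GJ : forall H (v : R), G H -> 0 <= v -> G (H `&` [set w | (v%:E < J w)%E]).

Let tau w := hit_path (B ^~ w).

(** [G] is a system of events independent of [B] through which [J] is observed at fixed times. It is
    instantiated twice: by the events of (N, Y) with [J] the first incident time, and by the trivial
    system with [J] = +oo. *)
Definition reflected_before t w : R :=
  if (tau w < J w)%E then reflect_path (B ^~ w) (tau w) t else B t w.

Definition reflected_approx n t w : R :=
  if (grid_up n (tau w) < J w)%E then reflect_path (B ^~ w) (grid_up n (tau w)) t
  else B t w.

Let tau_gt0 w : (0 < tau w)%E.
Proof. by apply: hit_path_gt0; [exact: bm_0 bB w|exact: (@bm_cont _ _ _ _ _ bB w)]. Qed.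

Lemma lt_tauE (v : R) : 0 <= v ->
  [set w | (v%:E < tau w)%E] = [set w | stays_below v (B ^~ w)].
Proof.
move=> v0; apply/seteqP; split => w /=.
  by move/(stays_belowP (bm_0 bB w) (@bm_cont _ _ _ _ _ bB w) v0).
by move/(stays_belowP (bm_0 bB w) (@bm_cont _ _ _ _ _ bB w) v0).
Qed.

Let path_event_measurable F : path_sigma F -> measurable [set w | F (B ^~ w)].
Proof. by move=> pF; have [] := reflect_path_law bB (lexx 0) pF. Qed.

Let lt_J_measurable (v : R) : 0 <= v -> measurable [set w | (v%:E < J w)%E].
Proof. by move=> v0; apply: GM; have := GJ GT v0; rewrite setTI. Qed.

(** The cell of [tau] is [k] and its right end comes before [J]. The first is an event of the path,
    the second compares [J] with a fixed time, so independence can separate them, as it could not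
    for tau < J itself. *)
Let S n k : set T := [set w | stays_below (grid n k) (B ^~ w) /\
   ~ stays_below (grid n k.+1) (B ^~ w)] `&` [set w | ((grid n k.+1)%:E < J w)%E].

Let S_measurable n k : measurable (S n k).
Proof.
apply: measurableI; last by apply: lt_J_measurable; exact: grid_ge0.
rewrite (_ : [set w | _ /\ _] = [set w | stays_below (grid n k) (B ^~ w)] `\`
  [set w | stays_below (grid n k.+1) (B ^~ w)])//.
by apply: measurableD; apply: path_event_measurable;
  apply: path_sigma_stays_below; exact: grid_ge0.
Qed.

Let SP n k w : S n k w <-> [/\ ((grid n k)%:E < tau w)%E,
   (tau w <= (grid n k.+1)%:E)%E & ((grid n k.+1)%:E < J w)%E].
Proof.
have e m : stays_below (grid n m) (B ^~ w) <-> ((grid n m)%:E < tau w)%E.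
  exact: (stays_belowP (bm_0 bB w) (@bm_cont _ _ _ _ _ bB w) (grid_ge0 n m)).
rewrite /S /=; split => [[[/e h1 h2] h3]|[h1 h2 h3]].
  by split => //; rewrite leNgt; apply/negP => /e.
by split => //; split; [exact/e|move/e; rewrite ltNge h2].
Qed.

Let S_grid_up n k w : S n k w -> grid_up n (tau w) = (grid n k.+1)%:E.
Proof.
move=> /SP[h1 h2 _]; have := h2; have := h1; have := tau_gt0 w.
case: (tau w) => [r| |]//; rewrite !lte_fin !lee_fin => r0 a b.
by rewrite /grid_up (@cell_unique _ _ _ k)// a b.
Qed.

Let S_approx n k w t : S n k w ->
  reflected_approx n t w = reflect_path (B ^~ w) (grid n k.+1)%:E t.
Proof.
by move=> Sw; have /SP[_ _ h] := Sw; rewrite /reflected_approx (S_grid_up Sw) h.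
Qed.

Let notS_approx n w t : ~ (exists k, S n k w) -> reflected_approx n t w = B t w.
Proof.
move=> nS; rewrite /reflected_approx; case: ifP => // hJ; exfalso; apply: nS.
have := tau_gt0 w; move: hJ; case E : (tau w) => [r| |]//; last by case: (J w).
rewrite /grid_up lte_fin => hJ r0; exists (cell n r); apply/SP.
by rewrite E lee_fin lte_fin; have /andP[] := cellP n r0.
Qed.

Let S_trivial n : trivIset setT (S n).
Proof.
move=> i j _ _ [w [Si Sj]]; have := S_grid_up Sj; rewrite (S_grid_up Si) => -[].
rewrite /grid => /(mulIf (invr_neq0 _)) => /(_ _)/eqP; rewrite ?pnatr_eq0//.
by rewrite eqr_nat => /(_ isT)/eqP[].
Qed.

Lemma reflected_approx_event n F :
  [set w | F (reflected_approx n ^~ w)] =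
  (\bigcup_k (S n k `&` [set w | F (reflect_path (B ^~ w) (grid n k.+1)%:E)]))
  `|` ([set w | F (B ^~ w)] `\` \bigcup_k S n k).
Proof.
have e1 k w : S n k w ->
    reflected_approx n ^~ w = reflect_path (B ^~ w) (grid n k.+1)%:E.
  by move=> Sw; apply/funext => t; exact: S_approx.
have e2 w : ~ (exists k, S n k w) -> reflected_approx n ^~ w = B ^~ w.
  by move=> nS; apply/funext => t; exact: notS_approx.
apply/seteqP; split => w /=.
  have [[k Sw]|nS] := pselect (exists k, S n k w).
    by rewrite (e1 k)// => h; left; exists k.
  by rewrite e2// => h; right; split => // -[k _ Sk]; apply: nS; exists k.
move=> [[k _ [Sw]]|[h nS]]; first by rewrite (e1 k).
by rewrite e2// => -[k Sk]; apply: nS; exists k.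
Qed.

(** On [S n k] the approximation is [B] reflected at the fixed time [grid n k.+1]. The cell of [tau]
    depends on |B| up to that time and is the same for the reflected path, while the condition on
    [J] is absorbed into [H]; by independence the claim reduces to [reflect_path_law]. Off the cells
    nothing is reflected. *)
Lemma reflected_approx_law n F H : path_sigma F -> G H ->
  measurable [set w | F (reflected_approx n ^~ w)] /\
  P ([set w | F (reflected_approx n ^~ w)] `&` H) = P ([set w | F (B ^~ w)] `&` H).
Proof.
move=> pF GH; rewrite reflected_approx_event.
have mB := path_event_measurable pF.
pose X k := [set w | F (reflect_path (B ^~ w) (grid n k.+1)%:E)].
have mX k : measurable (X k).
  by have [] := reflect_path_law bB (grid_ge0 n k.+1) pF.
split.
  apply: measurableU; last by apply: measurableD => //; exact: bigcupT_measurable.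
  apply: bigcupT_measurable => k.
  by apply: measurableI; [exact: S_measurable|exact: mX].
have mH := GM GH.
rewrite setIUl setI_bigcupl setIDAC -(@measure_patch _ _ _ P (S n)
   (fun k => X k `&` H) ([set w | F (B ^~ w)] `&` H))//; last 3 first.
- by move=> k; apply: measurableI; [exact: mX|].
- exact: measurableI.
- move=> k; pose C : set (R -> R) := stays_below (grid n k) `\` stays_below (grid n k.+1).
  have pC : path_sigma C.
    rewrite /C setDE; apply: g_sigma_setI; last apply: g_sigma_setC;
      exact: path_sigma_stays_below (grid_ge0 _ _).
  have pFC : path_sigma (F `&` C) by exact: g_sigma_setI.
  pose H' := H `&` [set w | ((grid n k.+1)%:E < J w)%E].
  have GH' : G H' by exact: GJ (grid_ge0 _ _).
  have eY : S n k `&` ([set w | F (B ^~ w)] `&` H) =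
      [set w | (F `&` C) (B ^~ w)] `&` H'.
    by apply/seteqP; split => w /=; rewrite /S /H' /C /=; tauto.
  have eX : S n k `&` (X k `&` H) =
      [set w | (F `&` C) (reflect_path (B ^~ w) (grid n k.+1)%:E)] `&` H'.
    have g1 : ((grid n k)%:E <= (grid n k.+1)%:E :> \bar R)%E.
      by rewrite lee_fin /grid ler_pM2r// ler_nat.
    apply/seteqP; split => w /=; rewrite /S /H' /C /X /=.
      move=> [[[a b] c] [e f]]; refine (conj (conj e (conj _ _)) (conj f c)).
        by apply/(stays_below_reflect _ (grid_ge0 _ _) g1).
      by move/(stays_below_reflect _ (grid_ge0 _ _) (lexx _)).
    move=> [[e [a b]] [f c]]; refine (conj (conj (conj _ _) c) (conj e f)).
      by apply/(stays_below_reflect _ (grid_ge0 _ _) g1).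
    by move=> h; apply: b; apply/(stays_below_reflect _ (grid_ge0 _ _) (lexx _)).
  have pR := path_sigma_reflect (grid_ge0 n k.+1) pFC.
  have iX := indG (@path_sigma_process _ _ _ B _ pR) GH'.
  have iY := indG (@path_sigma_process _ _ _ B _ pFC) GH'.
  rewrite eX eY; apply: etrans iX _; apply: etrans _ (esym iY).
  by congr (_ * _)%E; apply/esym; have [] := reflect_path_law bB (grid_ge0 n k.+1) pFC.
congr (P (_ `|` _)); first by apply: eq_bigcupr => k _; rewrite setIA.
by rewrite setIDA.
Qed.

(** If J <= tau, rounding up preserves this and neither path is reflected. If tau < J, the rounded
    time precedes [J] for large [n]; the paths agree up to [tau], and at a later time they differ by
    twice the increment of [B] from [tau] to the rounded time. *)
Lemma reflected_approx_cvg w (t e : R) : 0 <= t -> 0 < e ->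
  exists N, forall n, (N <= n)%N ->
    `|reflected_approx n t w - reflected_before t w| < e.
Proof.
move=> t0 e0; rewrite /reflected_before; have [tJ|Jt] := ltP (tau w) (J w); last first.
  exists 0%N => n _; rewrite /reflected_approx [(_ < J w)%E]ltNge.
  by rewrite (le_trans Jt (grid_up_ge n (tau_gt0 w)))/= subrr normr0.
move: (tau_gt0 w) tJ; rewrite /reflected_approx; case E : (tau w) => [r| |]//; last first.
  by case: (J w).
rewrite lte_fin => r0 rJ.
have [N1 hN1] := grid_up_eventually r0 rJ.
have [tr|rt] := leP t r.
  exists N1 => n /hN1 ->; have h := grid_up_ge n (x := r%:E) ltac:(by rewrite lte_fin).
  have h' : (t%:E <= grid_up n r%:E)%E by apply: le_trans h; rewrite lee_fin.
  by rewrite (reflect_path_le _ h') reflect_path_le ?lee_fin// subrr normr0.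
have e20 : 0 < e / 2 by rewrite divr_gt0.
have [dl dl0 hdl] := ray_continuousP (@bm_cont _ _ _ _ _ bB w) (ltW r0) e20.
have [|N2 hN2] := @grid_up_near _ r (Num.min dl (t - r)) r0.
  by rewrite lt_min dl0 subr_gt0.
exists (maxn N1 N2) => n; rewrite geq_max => /andP[/hN1 -> /hN2].
have h := grid_up_ge n (x := r%:E) ltac:(by rewrite lte_fin).
move: h; rewrite /grid_up lee_fin lte_fin; set g := grid _ _ => rg.
rewrite -ltrBlDl lt_min => /andP[g1 g2].
rewrite !reflect_path_ge ?(ltW rt)//; last by lra.
rewrite (_ : _ - _ - (_ - _) = - 2 * (B g w - B r w)); last by ring.
have g0 : 0 <= g by lra.
have := hdl g g0; rewrite ger0_norm ?subr_ge0// => /(_ g1) hh.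
by rewrite normrM normrN (ger0_norm (ler0n _ 2)) mulrC -ltr_pdivlMr.
Qed.


Lemma reflected_before_cvg w (t : R) : 0 <= t ->
  (fun n => reflected_approx n t w) @ \oo --> reflected_before t w.
Proof.
move=> t0; apply/cvgrPdist_lt => e e0.
have [N hN] := reflected_approx_cvg w t0 e0.
by exists N => // n /= /hN; rewrite distrC.
Qed.

Lemma reflected_before_measurable (t : R) : 0 <= t ->
  measurable_fun setT (reflected_before t).
Proof.
move=> t0; apply: (@measurable_fun_cvg _ _ _ _ (fun n => reflected_approx n t)).
  move=> n _ A mA; rewrite setTI.
  by have [] := reflected_approx_law n (path_sigma_coord t0 mA) GT.
by move=> w _; exact: reflected_before_cvg.
Qed.

(** Finite intersections of open rays form a pi-system generating [path_sigma], and they are open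
    for pointwise convergence: a limit path in such a set brings the approximations into it
    eventually. *)
Let above (l : seq (R * R)) : set (R -> R) := [set f | forall p, p \in l -> p.2 < f p.1].

Let rays : set_system (R -> R) :=
  [set F | exists2 l, all (fun p : R * R => 0 <= p.1) l & F = above l].

Let raysI : setI_closed rays.
Proof.
move=> _ _ [l1 p1 ->] [l2 p2 ->]; exists (l1 ++ l2); first by rewrite all_cat p1 p2.
apply/seteqP; split => f /=.
  by move=> [h1 h2] p; rewrite mem_cat => /orP[/h1|/h2].
by move=> h; split => p pl; apply: h; rewrite mem_cat pl ?orbT.
Qed.

Let path_sigma_rays : @path_sigma R = <<s rays >>.
Proof.
apply/seteqP; split.
  apply: smallest_sub; first exact: smallest_sigma_algebra.
  move=> _ [t /= t0 /coord_systemE[A mA ->]].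
  have mt : measurable_fun setT (fun f : g_sigma_algebraType rays => (f : R -> R) t).
    apply: (measurability _ (RGenOInfty.measurableE R)) => //.
    move=> _ [_ [x ->] <-]; rewrite setTI; apply: sub_sigma_algebra.
    exists [:: (t, x)]; first by rewrite /= t0.
    apply/seteqP; split => f /=; rewrite in_itv /= andbT.
      by move=> xf p; rewrite inE => /eqP ->.
    by move=> /(_ (t, x)); rewrite mem_head; exact.
  by have := mt measurableT A mA; rewrite setTI.
apply: smallest_sub; first exact: smallest_sigma_algebra.
move=> _ [l l0 ->]; rewrite (_ : above l = \bigcap_(p in [set` l]) [set f | p.2 < f p.1])//.
rewrite bigcap_seq_eqType big_seq; apply: big_ind => [||p pl].
- exact: g_sigma_setT.
- exact: g_sigma_setI.
- have := path_sigma_coord (t := p.1) (A := `]p.2, +oo[%classic).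
  rewrite (_ : [set f | _] = [set f | p.2 < f p.1]); first by apply => //; exact: (allP l0).
  by apply/seteqP; split => f /=; rewrite in_itv /= andbT.
Qed.

Let above_eventually l w : all (fun p : R * R => 0 <= p.1) l ->
  above l (reflected_before ^~ w) ->
  exists N, forall n, (N <= n)%N -> above l (reflected_approx n ^~ w).
Proof.
elim: l => [|p l IH] /=; first by exists 0%N.
move=> /andP[p0 /IH{}IH] h.
have [|N1 hN1] := IH; first by move=> q ql; apply: h; rewrite inE ql orbT.
have hp : 0 < reflected_before p.1 w - p.2 by rewrite subr_gt0 h// mem_head.
have [N2 hN2] := reflected_approx_cvg w p0 hp.
exists (maxn N1 N2) => n; rewrite geq_max => /andP[/hN1 h1 /hN2 h2] q.
rewrite inE => /orP[/eqP ->|]; last exact: h1.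
by move: h2; rewrite ltr_norml => /andP[? ?]; lra.
Qed.

Let above_rays l : all (fun p : R * R => 0 <= p.1) l -> path_sigma (above l).
Proof. by move=> l0; rewrite path_sigma_rays; apply: sub_sigma_algebra; exists l. Qed.

Let above_law l H : all (fun p : R * R => 0 <= p.1) l -> G H ->
  measurable [set w | above l (reflected_before ^~ w)] /\
  P ([set w | above l (reflected_before ^~ w)] `&` H) =
  P ([set w | above l (B ^~ w)] `&` H).
Proof.
move=> l0 GH; have mH := GM GH.
have mE : measurable [set w | above l (reflected_before ^~ w)].
  rewrite (_ : [set w | _] = \bigcap_(p in [set` l])
      [set w | p.2 < reflected_before p.1 w])//.
  rewrite bigcap_seq_eqType big_seq; apply: big_ind => // [|p pl]; first exact: measurableI.
  have := reflected_before_measurable (allP l0 p pl) measurableT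
    (measurable_itv `]p.2, +oo[).
  rewrite setTI (_ : _ @^-1` _ = [set w | p.2 < reflected_before p.1 w])//.
  by apply/seteqP; split => w /=; rewrite in_itv /= andbT.
split => //; apply/eqP; rewrite eq_le; apply/andP; split.
  apply: (@measure_liminf_le _ _ _ P _
    (fun n => [set w | above l (reflected_approx n ^~ w)] `&` H)).
  - exact: measurableI.
  - by move=> n; apply: measurableI => //; have [] := reflected_approx_law n (above_rays l0) GH.
  - by move=> w [/(above_eventually l0)[N hN] Hw]; exists N => n /hN.
  - by move=> n; have [_ ->] := reflected_approx_law n (above_rays l0) GH.
(* For the reverse inequality the bounds are raised by [e]: paths that exceed the raised bounds
   infinitely often have a limit that exceeds the original ones strictly. Then [e] runs through
   1/(m+1). *)
pose lift (e : R) := [seq (p.1, p.2 + e) | p <- l].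
have lift0 e : all (fun p : R * R => 0 <= p.1) (lift e).
  by rewrite all_map; apply: sub_all l0.
apply: (@measure_liminf_le _ _ _ P _
  (fun m => [set w | above (lift m.+1%:R^-1) (B ^~ w)] `&` H)).
- by apply: measurableI => //; exact: path_event_measurable (above_rays l0).
- by move=> m; apply: measurableI => //; exact: path_event_measurable (above_rays (lift0 _)).
- move=> w [hl Hw]; suff [N hN] : exists N, forall n, (N <= n)%N ->
      above (lift n.+1%:R^-1) (B ^~ w) by exists N => n /hN.
  rewrite /lift; elim: l hl {l0 mE lift lift0} => [|p l IH] hl; first by exists 0%N.
  have [|N1 hN1] := IH; first by move=> q ql; apply: hl; rewrite inE ql orbT.
  have /ltr_add_invr[N2 hN2] := hl p (mem_head _ _).
  exists (maxn N1 N2) => n; rewrite geq_max => /andP[/hN1 h1 n2] q /=.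
  rewrite inE => /orP[/eqP ->/=|]; last exact: h1.
  apply: le_lt_trans hN2; rewrite lerD2l lef_pV2 ?posrE//.
  by rewrite ler_nat.
move=> m; set e := m.+1%:R^-1; have e0 : 0 < e by rewrite invr_gt0.
apply: (@measure_limsup_ge _ _ _ P _
  (fun n => [set w | above (lift e) (reflected_approx n ^~ w)] `&` H)).
- exact: measurableI.
- move=> n; apply: measurableI => //.
  by have [] := reflected_approx_law n (above_rays (lift0 e)) GH.
- move=> w h; split; last by have [n _ []] := h 0%N.
  move=> p pl; have [N hN] := reflected_approx_cvg w (allP l0 p pl) e0.
  have [n /hN + [/(_ (p.1, p.2 + e)) h2 _]] := h N.
  rewrite ltr_norml => /andP[? ?]; have /= : p.2 + e < reflected_approx n p.1 w.
    by apply: h2; apply/mapP; exists p.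
  by move=> ?; lra.
- by move=> n; have [_ ->] := reflected_approx_law n (above_rays (lift0 e)) GH.
Qed.

(* The reflection principle, by rounding [tau] up to a grid: given the cell of
   [tau], the path is reflected before a fixed time. *)
Lemma reflected_before_law F H : path_sigma F -> G H ->
  measurable [set w | F (reflected_before ^~ w)] /\
  P ([set w | F (reflected_before ^~ w)] `&` H) = P ([set w | F (B ^~ w)] `&` H).
Proof.
rewrite path_sigma_rays => pF GH; have mH := GM GH.
have rB E : rays E -> measurable [set w | E (B ^~ w)].
  by move=> [l l0 ->]; exact: path_event_measurable (above_rays l0).
have rBh E : rays E -> measurable [set w | E (reflected_before ^~ w)].
  by move=> [l l0 ->]; have [] := above_law l0 GH.
have [] := @preimage_measure_unique R _ _ T T (mrestr P mH) (mrestr P mH) _ rays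
  (fun w => reflected_before ^~ w) (fun w => B ^~ w) raysI rBh rB _ _ _ F pF => //.
- by rewrite /= /mrestr setTI -ge0_fin_numE// fin_num_measure.
- by move=> _ [l l0 ->]; have [_] := above_law l0 GH.
Qed.

End stopped_reflection.

Section law_transfer.
Context {d} {T : measurableType d} {R : realType}.
Variable P : probability T R.

Lemma sigma_rv_choose (I : eqType) d' (V : measurableType d') (X : I -> T -> V)
    (s : seq I) (A : I -> set T) :
  (forall i, i \in s -> sigma_rv (X i) (A i)) ->
  exists C : I -> set V, forall i, measurable (C i) /\ (i \in s -> A i = X i @^-1` C i).
Proof.
move=> hA; have h i : exists C : set V, measurable C /\ (i \in s -> A i = X i @^-1` C).
  have [/hA/sigma_rvE[C mC ->]|_] := boolP (i \in s); first by exists C.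
  by exists setT.
by have [C hC] := choice h; exists C.
Qed.

(** Independence and normality of increments concern events of [path_sigma] and are inherited from
    the law; measurability, the starting point and continuity of every path are properties of [Z]
    itself. *)
Lemma brownian_motion_law (B Z : R -> T -> R) : brownian_motion P B ->
  (forall t : R, 0 <= t -> measurable_fun setT (Z t)) -> (forall w, Z 0 w = 0) ->
  (forall w, {within `[0, +oo[%classic, continuous (Z ^~ w)}) ->
  (forall F, path_sigma F -> P [set w | F (Z ^~ w)] = P [set w | F (B ^~ w)]) ->
  brownian_motion P Z.
Proof.
move=> bB mZ Z0 cZ ZB; split => //.
- move=> u u0 um s A us sA.
  have uge0 i : 0 <= u i by apply: le_trans u0 _; exact: um.
  have [C hC] := sigma_rv_choose sA.
  have incr (W : R -> T -> R) i : i \in s ->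
      P [set w | C i (W (u i.+1) w - W (u i) w)] =
      P [set w | [set f : R -> R | forall j, j \in [:: i] ->
          C j (f (u j.+1) - f (u j))] (W ^~ w)].
    move=> _; congr (P _); apply/seteqP; split => w /=.
      by move=> h j; rewrite inE => /eqP ->.
    by move=> /(_ i); rewrite mem_head; exact.
  have pF (s' : seq nat) : path_sigma [set f : R -> R | forall i, i \in s' ->
      C i (f (u i.+1) - f (u i))].
    by apply: path_sigma_increments => // i; have [] := hC i.
  transitivity (P [set w | [set f : R -> R | forall i, i \in s ->
      C i (f (u i.+1) - f (u i))] (Z ^~ w)]).
    congr (P _); apply/seteqP; split => w /= h i si.
      by have := h i si; rewrite (hC i).2.
    by rewrite (hC i).2//; exact: h.
  rewrite ZB//; have iB := bm_indep bB u0 um.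
  have := iB s (fun i => [set w | C i (B (u i.+1) w - B (u i) w)]) us.
  rewrite (_ : \bigcap_(i in _) _ = [set w | [set f : R -> R | forall i, i \in s ->
      C i (f (u i.+1) - f (u i))] (B ^~ w)])// => ->; last first.
    by move=> i _; apply/sigma_rvE; exists (C i) => //; have [] := hC i.
  rewrite big_seq [RHS]big_seq; apply: eq_bigr => i si.
  have e := incr Z i si; rewrite (ZB _ (pF [:: i])) in e.
  by rewrite (hC i).2//; exact: etrans (incr B i si) (esym e).
- move=> s t s0 st A mA; have t0 : 0 <= t by apply: le_trans s0 _; exact: ltW.
  have := bm_gauss bB s0 st mA; rewrite /pushforward => <-.
  pose F : set (R -> R) := [set f | A (f t - f s)].
  have pF : path_sigma F.
    have := measurable_funB (path_sigma_coord_fun t0) (path_sigma_coord_fun s0).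
    by move=> /(_ measurableT _ mA); rewrite setTI.
  exact: (ZB F pF).
Qed.

End law_transfer.

Section meet_system.
Context {T : Type}.

(** For two sigma-algebras, a pi-system that generates their join. *)
Definition meet_system (F G : set_system T) : set_system T :=
  [set E | exists A B, [/\ F A, G B & E = A `&` B]].

Lemma meet_systemI F G : setI_closed F -> setI_closed G -> setI_closed (meet_system F G).
Proof.
move=> FI GI _ _ [A [B [FA GB ->]]] [A' [B' [FA' GB' ->]]].
by exists (A `&` A'), (B `&` B'); split; [exact: FI|exact: GI|rewrite setIACA].
Qed.

Lemma meet_systeml F G : G setT -> F `<=` meet_system F G.
Proof. by move=> GT A FA; exists A, setT; rewrite setIT. Qed.

Lemma meet_systemr F G : F setT -> G `<=` meet_system F G.
Proof. by move=> FT B GB; exists setT, B; rewrite setTI. Qed.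

End meet_system.

Section independence3.
Context {d} {T : measurableType d} {R : realType}.
Variable P : probability T R.

Lemma independent3_pair F G H : H setT -> independent3 P F G H -> independent2 P F G.
Proof.
move=> HT h A B FA GB; have := h A B setT FA GB HT.
by rewrite setIT probability_setT mule1.
Qed.

Lemma independent3_meet F G H : H setT -> independent3 P F G H ->
  independent2 P (meet_system F G) H.
Proof.
move=> HT h _ C [A [B [FA GB ->]]] HC; rewrite h//.
by rewrite (independent3_pair HT h FA GB).
Qed.

Lemma independent3_meetr F G H : F setT -> independent3 P F G H ->
  independent2 P F (meet_system G H).
Proof.
move=> FT h A _ FA [B [C [GB HC ->]]]; rewrite setIA h//.
have := h setT B C FT GB HC; rewrite setTI probability_setT mul1e => ->.
by rewrite muleA.
Qed.


End independence3.

Section incident.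
Context {d} {T : measurableType d} {R : realType}.
Variable P : probability T R.

(** If no point has arrived by time [v], right-continuity keeps the count at 0 for a while, which
    makes the infimum strictly larger than [v]. *)
Lemma lt_incident_time0 rate (N : R -> T -> nat) (v : R) w :
  poisson_process P rate N -> 0 <= v ->
  (v%:E < incident_time N 0 w)%E <-> N v w = 0%N.
Proof.
move=> pN v0; split => [h|Nv].
  apply/eqP; rewrite -leqn0 leqNgt; apply/negP => Nv.
  suff : (incident_time N 0 w <= v%:E)%E by rewrite leNgt h.
  by apply: ereal_inf_lbound; exists v.
have [dl /= dl0 hdl] := pp_rcont pN w v0.
apply: (@lt_le_trans _ _ (v + dl)%:E); first by rewrite lte_fin ltrDl.
apply: le_ereal_inf_tmp => _ [t [t0 Nt] <-]; rewrite lee_fin leNgt.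
apply/negP => tv; have [tv'|vt] := leP t v.
  by have := pp_mono pN w t0 tv'; rewrite Nv leqNgt Nt.
have := hdl t; rewrite /= ltr0_norm ?subr_lt0// opprB ltrBlDl tv => /(_ isT vt).
by rewrite Nv => Nt0; rewrite Nt0 in Nt.
Qed.

End incident.

(** * Invariance of the joint law *)

Section coupled_data.
Context {d} {T : measurableType d} {R : realType}.
Variable P : probability T R.
Variables (lam : R) (B : R -> T -> R) (N : R -> T -> nat) (Y : nat -> T -> bool).
Hypothesis cd : construction_data P lam B N Y.

Let J := incident_time N 0.
Let Bh := constructed_Bh B N.
Let Yh := constructed_Yh B N Y.
Let sB := sigma_process B.
Let sN := sigma_process N.
Let sY := sigma_family setT Y.
Let NY := meet_system sN sY.

Let bB : brownian_motion P B := cd_bm cd.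
Let pN : poisson_process P (2 * lam) N := cd_poisson cd.


Let sBM : sB `<=` measurable.
Proof. by apply: sigma_family_measurable => t t0; exact: (bm_meas bB). Qed.

Let sNM : sN `<=` measurable.
Proof. by apply: sigma_family_measurable => t t0; exact: (pp_meas pN). Qed.

Let sYM : sY `<=` measurable.
Proof. by apply: sigma_family_measurable => k _; exact: cd_mark_meas cd k. Qed.

Lemma lt_incident_time0_sigma (v : R) : 0 <= v -> sN [set w | (v%:E < J w)%E].
Proof.
move=> v0; rewrite (_ : [set w | _] = N v @^-1` [set 0%N]).
  by apply: sub_sigma_algebra; exists v => //; exact: sigma_rv_preimage.
by apply/seteqP; split => w /=; move/(lt_incident_time0 w pN v0).
Qed.

Let NYM : NY `<=` measurable.
Proof. by move=> _ [A [C [/sNM mA /sYM mC ->]]]; exact: measurableI. Qed.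

Let NYT : NY setT.
Proof. by exists setT, setT; split; [exact: g_sigma_setT..|rewrite setTI]. Qed.

Let indNY : independent2 P sB NY.
Proof. by apply: independent3_meetr (cd_indep cd); exact: g_sigma_setT. Qed.

Let NYJ H (v : R) : NY H -> 0 <= v -> NY (H `&` [set w | (v%:E < J w)%E]).
Proof.
move=> [A [C [sA sC ->]]] v0; exists (A `&` [set w | (v%:E < J w)%E]), C.
by split => //; [exact: g_sigma_setI (lt_incident_time0_sigma v0)|rewrite setIAC].
Qed.

Let Rlt := [set w | (hit_time B w < J w)%E].

Let BN := <<s meet_system sB sN >>.

Let BN_sB : sB `<=` BN.
Proof.
move=> E sE; apply: sub_sigma_algebra; apply: meet_systeml => //.
exact: g_sigma_setT.
Qed.

Let BN_sN : sN `<=` BN.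
Proof.
move=> E sE; apply: sub_sigma_algebra; apply: meet_systemr => //.
exact: g_sigma_setT.
Qed.

(** The hitting time precedes [J] exactly if some grid point [g] satisfies tau <= g < J, a countable
    union of events of [B] intersected with events of [N]. *)
Lemma lt_hit_incident_sigma : BN Rlt.
Proof.
rewrite (_ : Rlt = \bigcup_n \bigcup_k
   (~` [set w | stays_below (grid n k) (B ^~ w)] `&`
    [set w | ((grid n k : R)%:E < J w)%E])).
  apply: g_sigma_bigcup => n; apply: g_sigma_bigcup => k; apply: g_sigma_setI.
    apply: g_sigma_setC; apply: BN_sB; apply: path_sigma_process.
    exact: path_sigma_stays_below (grid_ge0 _ _).
  exact: BN_sN (lt_incident_time0_sigma (grid_ge0 _ _)).
apply/seteqP; split => w /=.
  rewrite /Rlt /= -/(hit_path (B ^~ w)) => tJ.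
  have tau0 := hit_path_gt0 (bm_0 bB w) (@bm_cont _ _ _ _ _ bB w).
  change (hit_time B w) with (hit_path (B ^~ w)) in tJ.
  move: tau0 tJ; case E : (hit_path (B ^~ w)) => [r| |]//; last by case: (J w).
  rewrite lte_fin => r0 rJ; have [M hM] := grid_up_eventually r0 rJ.
  exists M => //; exists (cell M r).+1 => //; split; last exact: hM (leqnn _).
  move=> /= /(stays_belowP (bm_0 bB w) (@bm_cont _ _ _ _ _ bB w) (grid_ge0 _ _)).
  by rewrite E lte_fin ltNge; have /andP[_ ->] := cellP M r0.
move=> [n _ [k _ [nst kJ]]]; apply: le_lt_trans kJ.
rewrite leNgt; apply/negP => h; apply: nst.
by apply/(stays_belowP (bm_0 bB w) (@bm_cont _ _ _ _ _ bB w) (grid_ge0 _ _)).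
Qed.

Let BN_Y : independent2 P BN sY.
Proof.
rewrite -(sigma_algebra_g_sigma (C := sY)); last exact: smallest_sigma_algebra.
apply: independent2_g_sigma.
- by apply: meet_systemI => A C; exact: g_sigma_setI.
- by move=> A C; exact: g_sigma_setI.
- by move=> _ [A [C [/sBM mA /sNM mC ->]]]; exact: measurableI.
- exact: sYM.
- by apply: independent3_meet (cd_indep cd); exact: g_sigma_setT.
Qed.

Let BNM : BN `<=` measurable.
Proof.
apply: g_sigma_measurable => _ [A [C [/sBM mA /sNM mC ->]]].
exact: measurableI.
Qed.

Let Rlt_measurable : measurable Rlt := BNM lt_hit_incident_sigma.

Let marks (Z : nat -> T -> bool) (l : seq nat) (K : nat -> set bool) : set T :=
  \bigcap_(k in [set` l]) (Z k @^-1` K k).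

Let marks_sY l K : sY (marks Y l K).
Proof.
rewrite /marks bigcap_seq_eqType; apply: big_ind => [||k _].
- exact: g_sigma_setT.
- exact: g_sigma_setI.
- by apply: sub_sigma_algebra; exists k => //; exact: sigma_rv_preimage.
Qed.

Let flip0 (K : nat -> set bool) k : set bool :=
  if k == 0%N then [set b | K k (~~ b)] else K k.

Let mark_fair k (A : set bool) : P (Y k @^-1` [set b | A (~~ b)]) = P (Y k @^-1` A).
Proof.
have e := cd_mark_law cd k; rewrite /pushforward in e.
have h01 : 0 <= (2^-1 : R) <= 1 by rewrite invr_ge0 ler0n invf_le1// ler1n.
have half : unstable.onem (2^-1 : R) = 2^-1 by rewrite /unstable.onem; lra.
rewrite !e !bernoulli_probE// half addeC; congr (_ + _)%E; congr (_ * _)%E;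
  by rewrite !diracE; congr (_%:R%:E); congr nat_of_bool; apply/idP/idP; rewrite !inE.
Qed.

Let marks_flip l K : uniq l -> P (marks Y l (flip0 K)) = P (marks Y l K).
Proof.
move=> ul; have h (K' : nat -> set bool) :
    P (marks Y l K') = (\prod_(k <- l) P (Y k @^-1` K' k))%E.
  by apply: (cd_mark_indep cd) => // k _; exact: sigma_rv_preimage.
by rewrite !h; apply: eq_bigr => k _; rewrite /flip0; case: eqP.
Qed.

Let marks_Yh l K :
  marks Yh l K = (marks Y l K `&` Rlt) `|` (marks Y l (flip0 K) `\` Rlt).
Proof.
have e1 w k : Rlt w -> Yh k w = Y k w.
  by rewrite /Rlt /Yh /constructed_Yh /= => ->; rewrite andbF.
have e2 w k : ~ Rlt w -> Yh k w = if k == 0%N then ~~ Y k w else Y k w.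
  by rewrite /Rlt /Yh /constructed_Yh /= => /negP/negbTE ->; rewrite andbT.
apply/seteqP; split => w /=.
  have [Rw|nR] := pselect (Rlt w).
    by move=> h; left; split => // k kl; have := h k kl; rewrite /= e1.
  move=> h; right; split => // k kl; have := h k kl.
  by rewrite /= e2// /flip0; case: ifP.
move=> [[h Rw] k kl|[h nR] k kl]; have := h k kl; first by rewrite /= e1.
by rewrite /= e2// /flip0; case: ifP.
Qed.

Let Bh_law F H : path_sigma F -> NY H ->
  measurable [set w | F (Bh ^~ w)] /\
  P ([set w | F (Bh ^~ w)] `&` H) = P ([set w | F (B ^~ w)] `&` H).
Proof. by move=> pF NH; exact: reflected_before_law bB NYM NYT indNY NYJ F H pF NH. Qed.

Let mIDE (A C : set T) : measurable A -> measurable C ->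
  P A = (P (A `&` C) + P (A `\` C))%E.
Proof. by move=> mA mC; rewrite addeC; exact: measureDI. Qed.

(* On the event that [tau] comes before [J] the path [B] is reflected, and off it
   the first mark is flipped; either preserves the joint law restricted to the
   event concerned. *)
Lemma coupled_joint_law F H l K : path_sigma F -> sN H -> uniq l ->
  measurable (marks Yh l K) /\
  P ([set w | F (Bh ^~ w)] `&` H `&` marks Yh l K) =
  P ([set w | F (B ^~ w)] `&` H `&` marks Y l K).
Proof.
move=> pF sH ul; set FBh := [set w | F (Bh ^~ w)]; set FB := [set w | F (B ^~ w)].
have mY K' : measurable (marks Y l K') by exact: sYM (marks_sY l K').
have mYh : measurable (marks Yh l K).
  rewrite marks_Yh; apply: measurableU; first exact: measurableI.
  exact: measurableD.
have NH : NY (H `&` marks Y l K) by exists H, (marks Y l K); split.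
have [mFBh e1] := Bh_law pF NH; rewrite -/FBh -/FB in mFBh e1.
have sFB : sB FB by exact: path_sigma_process pF.
have mFB := sBM sFB; have mH := sNM sH.
have FBR : FBh `\` Rlt = FB `\` Rlt.
  apply/seteqP; split => w [h nR]; split => //; move: h; rewrite /FBh /FB /=;
  rewrite (_ : Bh ^~ w = B ^~ w)//; apply/funext => t; rewrite /Bh /constructed_Bh;
  by move: nR; rewrite /Rlt /= => /negP/negbTE ->.
split => //; have mFH : measurable (FBh `&` H) by exact: measurableI.
have mFH' : measurable (FB `&` H) by exact: measurableI.
rewrite (mIDE (C := Rlt))//; last exact: measurableI.
rewrite [RHS](mIDE (C := Rlt))//; last exact: measurableI.
congr (_ + _)%E.
  rewrite (_ : FBh `&` H `&` marks Yh l K `&` Rlt = FBh `&` (H `&` marks Y l K) `&` Rlt);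
    last first.
    by rewrite marks_Yh; apply/seteqP; split => w /=; tauto.
  (* The reflection result concerns the whole space. Off [Rlt] the paths of [Bh] and [B] coincide,
     so subtracting that part leaves the equality on [Rlt]. *)
  have := e1; rewrite (mIDE (C := Rlt))//; last by do 2 apply: measurableI => //.
  rewrite [X in _ = X](mIDE (C := Rlt))//; last by do 2 apply: measurableI => //.
  have -> : FBh `&` (H `&` marks Y l K) `\` Rlt = FB `&` (H `&` marks Y l K) `\` Rlt.
    by rewrite -setIDA -setIDAC FBR setIDAC setIDA.
  rewrite -[in X in _ = X -> _]setIA => e2.
  have fin : P (FB `&` (H `&` marks Y l K) `\` Rlt) \is a fin_num.
    by apply: fin_num_measure; apply: measurableD => //; do 2 apply: measurableI => //.
  have := congr1 (fun x => x - P (FB `&` (H `&` marks Y l K) `\` Rlt))%E e2.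
  by rewrite !addeK// => ->; rewrite !setIA.
(* Off [Rlt] the path is unchanged and the restricting event belongs to (B, N); it is independent of
   the marks, so the first one can be flipped by symmetry. *)
have sD : BN (FB `&` H `\` Rlt).
  rewrite setDE; apply: g_sigma_setI; last exact: g_sigma_setC lt_hit_incident_sigma.
  by apply: g_sigma_setI; [exact: BN_sB|exact: BN_sN].
transitivity (P ((FB `&` H `\` Rlt) `&` marks Y l (flip0 K))).
  rewrite marks_Yh; congr (P _).
  have -> : FBh `&` H `&` (marks Y l K `&` Rlt `|` marks Y l (flip0 K) `\` Rlt) `\` Rlt
     = (FBh `\` Rlt) `&` H `&` marks Y l (flip0 K).
    by apply/seteqP; split => w /=; tauto.
  by rewrite FBR; apply/seteqP; split => w /=; tauto.
transitivity (P ((FB `&` H `\` Rlt) `&` marks Y l K)).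
  have h K' : P ((FB `&` H `\` Rlt) `&` marks Y l K') =
      (P (FB `&` H `\` Rlt) * P (marks Y l K'))%E.
    exact: BN_Y sD (marks_sY l K').
  by rewrite !h marks_flip.
by congr (P _); rewrite setIDAC setIDA.
Qed.

Let Bh_measurable (t : R) : 0 <= t -> measurable_fun setT (Bh t).
Proof.
move=> t0 _ A mA; rewrite setTI.
by have [] := Bh_law (path_sigma_coord t0 mA) NYT.
Qed.

Let marks1 Z k A : marks Z [:: k] (fun=> A) = Z k @^-1` A.
Proof. by rewrite /marks bigcap_seq_eqType big_seq1. Qed.

Let path_sigmaT : @path_sigma R setT := g_sigma_setT.

Let sNT : sN setT := g_sigma_setT.

Let marks_law l K : uniq l -> P (marks Yh l K) = P (marks Y l K).
Proof.
move=> ul; have [_] := coupled_joint_law K path_sigmaT sNT ul.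
by rewrite (_ : [set w | [set: R -> R] (Bh ^~ w)] = setT)// !setTI.
Qed.

Let Yh_measurable k : measurable_fun setT (Yh k).
Proof.
move=> _ A _; rewrite setTI -marks1.
by have [] := @coupled_joint_law setT setT [:: k] (fun=> A) path_sigmaT sNT isT.
Qed.

Lemma coupled_brownian_motion : brownian_motion P Bh.
Proof.
apply: (brownian_motion_law bB) => //.
- move=> w; rewrite /Bh /constructed_Bh /= (bm_0 bB) oppr0; case: ifP => // _.
  by rewrite (ltW (hit_path_gt0 (bm_0 bB w) (@bm_cont _ _ _ _ _ bB w))).
- move=> w; have cB := @bm_cont _ _ _ _ _ bB w.
  have tau0 : (0 <= hit_path (B ^~ w))%E by exact: ltW (hit_path_gt0 (bm_0 bB w) cB).
  have [tJ|Jt] := boolP (hit_time B w < J w)%E.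
    rewrite (_ : Bh ^~ w = reflect_path (B ^~ w) (hit_time B w)); last first.
      by apply/funext => t; rewrite /Bh /constructed_Bh tJ.
    exact: reflect_path_continuous.
  rewrite (_ : Bh ^~ w = B ^~ w)//; apply/funext => t.
  by rewrite /Bh /constructed_Bh (negbTE Jt).
- by move=> F pF; have [_] := Bh_law pF NYT; rewrite !setIT.
Qed.

(** [Xh] is obtained from [(Bh, N, Yh)] as [X] is from [(B, N, Y)], up to the starting point, so
    that a single argument serves both marginals. The independence follows from the joint law on
    rectangles. *)
Lemma coupled_construction_data : construction_data P lam Bh N Yh.
Proof.
split.
- exact: coupled_brownian_motion.
- exact: pN.
- exact: Yh_measurable.
- move=> k A; rewrite -(cd_mark_law cd k A) /pushforward.
  by have := @marks_law [:: k] (fun=> A) isT; rewrite !marks1.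
- move=> s A us sA; have [C hC] := sigma_rv_choose sA.
  have e : \bigcap_(i in [set` s]) A i = marks Yh s C.
    by apply/seteqP; split => w /= h i si; have := h i si; rewrite (hC i).2.
  rewrite e marks_law// /marks (cd_mark_indep cd)//; last first.
    by move=> i _; apply: sigma_rv_preimage; have [] := hC i.
  rewrite big_seq [RHS]big_seq; apply: eq_bigr => i si; rewrite (hC i).2//.
  by have := @marks_law [:: i] (fun=> C i) isT; rewrite !marks1.
- move=> EB EN EY sEB sEN; have [F pF ->] := sigma_process_path sEB.

  have mF : measurable [set w | F (Bh ^~ w)] by have [] := Bh_law pF NYT.
  have mEN := sNM sEN.
  have Bh_B : P [set w | F (Bh ^~ w)] = P [set w | F (B ^~ w)].
    by have [_] := Bh_law pF NYT; rewrite !setIT.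
  have BhN : P ([set w | F (Bh ^~ w)] `&` EN) = (P [set w | F (Bh ^~ w)] * P EN)%E.
    have NH : NY EN by exists EN, setT; split => //; [exact: g_sigma_setT|rewrite setIT].
    have [_ ->] := Bh_law pF NH; rewrite Bh_B.
    exact: indNY (path_sigma_process pF) NH.
  rewrite -BhN sigma_family_fin_rect setIC muleC; move: EY.
  apply: product_rule_g_sigma.
  + by apply: fin_rectI => i; exact: sigma_rvI.
  + move=> _ [s [A [sA _ _ ->]]]; rewrite bigcap_seq_eqType.
    apply: big_ind => // [|i _]; first exact: measurableI.
    exact: sigma_rv_measurable (Yh_measurable i) _ (sA i).
  + exact: measurableI.
  + move=> _ [s [A [sA _ _ ->]]].
    have [C hC] := sigma_rv_choose (s := undup s) (fun i _ => sA i).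
    have -> : \bigcap_(i in [set` s]) A i = marks Yh (undup s) C.
      apply/seteqP; split => w /= h i; rewrite /= ?mem_undup => si.
        by have := h i si; rewrite (hC i).2 ?mem_undup.
      by rewrite (hC i).2 ?mem_undup//; apply: h; rewrite /= mem_undup.
    have [_ e] := coupled_joint_law C pF sEN (undup_uniq s).
    rewrite setIC e (cd_indep cd)//; last 2 first.
    * exact: path_sigma_process pF.
    * exact: marks_sY.
    by rewrite marks_law ?undup_uniq// BhN Bh_B muleC.
Qed.

End coupled_data.

(** * Thinning *)

Section countable_laws.
Context {R : realType}.

Lemma nat_law_unique d d' (T : measurableType d) (T' : measurableType d')
    (m : {measure set T -> \bar R}) (m' : {measure set T' -> \bar R})
    (X : T -> nat) (X' : T' -> nat) :
  (forall n, measurable [set w | X w = n]) -> (forall n, measurable [set w | X' w = n]) ->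
  m setT = m' setT -> (m setT < +oo)%E ->
  (forall n, m [set w | X w = n] = m' [set w | X' w = n]) ->
  forall A, m (X @^-1` A) = m' (X' @^-1` A).
Proof.
move=> mX mX' mT moo mm A.
pose C : set_system nat := [set E | E = set0 \/ exists n, E = [set n]].
have sA : <<s C >> A.
  rewrite (_ : A = \bigcup_n (if n \in A then [set n] else set0)); last first.
    apply/seteqP; split => [n An|n [k _]]; first by exists n => //; rewrite mem_set.
    by case: ifPn => // /set_mem Ak ->.
  by apply: g_sigma_bigcup => n; apply: sub_sigma_algebra; case: ifP => _; [right; exists n|left].
have [] := @preimage_measure_unique R _ _ T T' m m' nat C X X' _ _ _ mT moo _ A sA => //.
- move=> E1 E2 [->|[n ->]]; first by rewrite set0I; left.
  move=> [->|[k ->]]; first by rewrite setI0; left.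
  have [->|nk] := eqVneq n k; first by rewrite setIid; right; exists k.
  by left; apply/seteqP; split => // i [/= -> nk']; rewrite nk' eqxx in nk.
- by move=> E [->|[n ->]]; [rewrite preimage_set0|exact: mX].
- by move=> E [->|[n ->]]; [rewrite preimage_set0|exact: mX'].
- by move=> E [->|[n ->]]; [rewrite !preimage_set0 !measure0|exact: mm].
Qed.

Lemma nneseries_shift (f : nat -> \bar R) m : (forall n, (0 <= f n)%E) ->
  (forall n, (n < m)%N -> f n = 0%E) ->
  (\sum_(0 <= n <oo) f n = \sum_(0 <= n <oo) f (n + m)%N)%E.
Proof.
move=> f0 fm; rewrite (@nneseries_split _ f 0 m)//.
rewrite [X in (X + _)%E]big_nat_cond big1 ?add0e; last by move=> i /andP[/andP[_ /fm]].
apply: cvg_lim => //; rewrite -(cvg_shiftn m).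
have -> : (fun n => (\sum_(m <= i < n + m) f i)%E) = (fun n => (\sum_(0 <= i < n) f (i + m)%N)%E).
  by apply/funext => n; rewrite -{1}[m]add0n big_addn addnK.
exact: is_cvg_nneseries.
Qed.

Lemma poisson_probE (mu : R) n : 0 < mu -> poisson_prob mu 0%N [set n] = (poisson_pmf mu n)%:E.
Proof. by move=> mu0; rewrite /poisson_prob mu0 esum_set1// lee_fin poisson_pmf_ge0. Qed.

Lemma poisson_pmf_sum (mu : R) : 0 < mu -> (\sum_(0 <= n <oo) (poisson_pmf mu n)%:E = 1)%E.
Proof.
move=> mu0; rewrite nneseries_esumT; last by move=> n; rewrite lee_fin poisson_pmf_ge0.
by have := probability_setT (poisson_prob mu 0%N); rewrite /= /poisson_prob mu0.
Qed.

(** With p = n + m, the binomial coefficient and the power of 2 split each term into the Poisson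
    weights of [m] and of [n], both with parameter [mu]; the latter sum to 1. *)
Lemma poisson_thinning_series (mu : R) m : 0 <= mu ->
  (\sum_(0 <= p <oo) (poisson_prob (2 * mu) 0%N [set p] * ('C(p, m)%:R / 2 ^+ p)%:E)
   = poisson_prob mu 0%N [set m])%E.
Proof.
rewrite le_eqVlt => /orP[/eqP <-|mu0].
  rewrite mulr0 (@nneseries_split _ _ 0 1); last by move=> k _; rewrite mule_ge0// lee_fin divr_ge0.
  rewrite big_nat1 eseries0 ?adde0; last first.
    by move=> i i1 _; rewrite /poisson_prob ltxx diracE memNset ?mul0e//= => i0; rewrite -i0 in i1.
  rewrite /poisson_prob ltxx !diracE mem_set// mul1e expr0 divr1.
  by case: m => [|m]; [rewrite mem_set|rewrite memNset].
have mu20 : 0 < 2 * mu by rewrite mulr_gt0.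
rewrite (@nneseries_shift _ m); last 2 first.
- by move=> n; rewrite mule_ge0// lee_fin divr_ge0.
- by move=> n nm; rewrite bin_small// mul0r mule0.
rewrite poisson_probE// -[RHS]mule1 -(poisson_pmf_sum mu0) -nneseriesZl; last first.
  by move=> n _; rewrite lee_fin poisson_pmf_ge0.
apply: eq_eseriesr => n _; rewrite poisson_probE// -!EFinM; congr (_%:E).
rewrite /poisson_pmf mu20 mu0.
have fact_neq0 k : k`!%:R != 0 :> R by rewrite pnatr_eq0 -lt0n fact_gt0.
have := bin_fact (leq_addl n m); rewrite addnK => /(congr1 (fun k => k%:R : R)).
rewrite !natrM => e.
have -> : 'C(n + m, m)%:R = (n + m)`!%:R / (m`!%:R * n`!%:R) :> R.
  by rewrite -e mulfK// mulf_neq0.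
rewrite (_ : - (2 * mu) = - mu + - mu); last by ring.
rewrite expRD exprMn (exprD mu).
have p2 : (2 : R) ^+ (n + m) != 0 by rewrite expf_neq0.
by field; rewrite !fact_neq0 p2.
Qed.

End countable_laws.

Section thinning.
Context {d} {T : measurableType d} {R : realType}.
Variable P : probability T R.
Variables (lam : R) (N : R -> T -> nat) (Y : nat -> T -> bool).
Hypothesis pN : poisson_process P (2 * lam) N.
Hypothesis mY : forall k, measurable_fun setT (Y k).
Hypothesis lawY : forall k (A : set bool),
  pushforward P (Y k) A = bernoulli_prob (2^-1 : R) A.
Hypothesis indY : mutually_independent P (fun k => sigma_rv (Y k)).
Hypothesis indNY : independent2 P (sigma_process N) (sigma_family setT Y).

(** The increment of the thinned count over [s, t] is such a block, with [r] the number [N s] of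
    marks already used and [p] the number of new points. *)
Let blk (r p : nat) (w : T) : nat := (\sum_(r <= k < r + p) Y k w)%N.

Let M := marked_count N Y.

Let ME t w : M t w = blk 0 (N t w) w.
Proof. by rewrite /M /marked_count /blk big_mkord. Qed.

Let blkD r p q w : blk r (p + q) w = (blk r p w + blk (r + p) q w)%N.
Proof. by rewrite /blk addnA -big_cat_nat ?leq_addr. Qed.

Let blkS r p w : blk r p.+1 w = (blk r p w + Y (r + p) w)%N.
Proof. by rewrite -addn1 blkD /blk addn1 big_nat1. Qed.

Let blk0 r w : blk r 0 w = 0%N.
Proof. by rewrite /blk addn0 big_geq. Qed.

Let sYM D : sigma_family D Y `<=` measurable.
Proof. by apply: sigma_family_measurable => k _. Qed.

Let sNM : sigma_process N `<=` measurable.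
Proof. by apply: sigma_family_measurable => t t0; exact: (pp_meas pN). Qed.

Let blk_sigma (D : set nat) r p (A : set nat) : (forall k, (r <= k < r + p)%N -> D k) ->
  sigma_family D Y [set w | A (blk r p w)].
Proof.
elim: p A => [|p IH] A Dk.
  have [A0|nA0] := pselect (A 0%N).
    rewrite (_ : [set w | _] = setT); first exact: g_sigma_setT.
    by apply/seteqP; split => // w _ /=; rewrite blk0.
  rewrite (_ : [set w | _] = ~` setT); first exact: g_sigma_setC g_sigma_setT.
  by apply/seteqP; split => w /=; rewrite blk0.
have Dk' k : (r <= k < r + p)%N -> D k by move=> /andP[rk kp]; apply: Dk; lia.
have sYb b : sigma_family D Y (Y (r + p) @^-1` [set b]).
  apply: sub_sigma_algebra; exists (r + p)%N; first by apply: Dk; lia.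
  exact: sigma_rv_preimage.
rewrite (_ : [set w | _] =
  ~` (~` (Y (r + p) @^-1` [set true] `&` [set w | [set m | A m.+1] (blk r p w)]) `&`
      ~` (Y (r + p) @^-1` [set false] `&` [set w | A (blk r p w)]))).
  apply: g_sigma_setC; apply: g_sigma_setI; apply: g_sigma_setC; apply: g_sigma_setI.
  - exact: sYb.
  - exact: (IH [set m | A m.+1] Dk').
  - exact: sYb.
  - exact: (IH A Dk').
apply/seteqP; split => w /=; rewrite blkS; case: (Y (r + p) w); rewrite /= ?addn1 ?addn0.
- by move=> h [/not_andP[]].
- by move=> h [_ /not_andP[]].
- by rewrite not_andE => -[/contrapT[]|/contrapT[]].
- by rewrite not_andE => -[/contrapT[]|/contrapT[]].
Qed.

Let blk_measurable r p A : measurable [set w | A (blk r p w)].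
Proof. by apply: (sYM (D := setT)); exact: blk_sigma. Qed.

Let half_law k b : P (Y k @^-1` [set b]) = (2^-1)%:E.
Proof.
have e := lawY k [set b]; rewrite /pushforward in e; rewrite e.
have h01 : 0 <= (2^-1 : R) <= 1 by rewrite invr_ge0 ler0n invf_le1// ler1n.
have half : unstable.onem (2^-1 : R) = 2^-1 by rewrite /unstable.onem; lra.
rewrite bernoulli_probE// half !diracE; case: b {e}.
  by rewrite mem_set// memNset// mule1 mule0 adde0.
by rewrite memNset// mem_set// mule0 add0e mule1.
Qed.

Let disjoint_lt_eq (n : nat) : [set k | (k < n)%N] `&` [set n] `<=` set0.
Proof. by move=> k [/= kn nk]; rewrite nk ltnn in kn. Qed.

Let indY_blocks D D' : D `&` D' `<=` set0 ->
  independent2 P (sigma_family D Y) (sigma_family D' Y).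
Proof.
apply: mutually_independent_blocks => //.
- by move=> i; exact: sigma_rvT.
- by move=> i; exact: sigma_rvI.
- by move=> i; exact: sigma_rv_measurable.
Qed.

Let blkS_law r p m : P [set w | blk r p.+1 w = m.+1] =
  (2^-1%:E * P [set w | blk r p w = m] + 2^-1%:E * P [set w | blk r p w = m.+1])%E.
Proof.
have ind b A : P ([set w | A (blk r p w)] `&` (Y (r + p) @^-1` [set b])) =
    (2^-1%:E * P [set w | A (blk r p w)])%E.
  rewrite -(half_law (r + p) b) muleC.
  apply: (indY_blocks (disjoint_lt_eq (n := (r + p)%N))).
    by apply: blk_sigma => k /andP[].
  by apply: sub_sigma_algebra; exists (r + p)%N => //; exact: sigma_rv_preimage.
rewrite -(ind true [set m]) -(ind false [set m.+1]) -measureU.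
- congr (P _); apply/seteqP; split => w /=; rewrite blkS.
    by case: (Y (r + p) w); rewrite /= ?addn1 ?addn0 => h; [left|right]; split => //; case: h.
  by move=> [[-> ->]|[-> ->]]; rewrite /= ?addn1 ?addn0.
- apply: measurableI; [exact: (blk_measurable r p [set m])|].
  by rewrite -[X in measurable X]setTI; exact: mY.
- apply: measurableI; [exact: (blk_measurable r p [set m.+1])|].
  by rewrite -[X in measurable X]setTI; exact: mY.
- by apply/seteqP; split => // w [[/= _ ->] [_]].
Qed.

Let blkS_law0 r p : P [set w | blk r p.+1 w = 0%N] =
  (2^-1%:E * P [set w | blk r p w = 0%N])%E.
Proof.
rewrite -(half_law (r + p) false) muleC.
have := indY_blocks (disjoint_lt_eq (n := (r + p)%N)) (A := [set w | [set 0%N] (blk r p w)])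
  (B := Y (r + p) @^-1` [set false]).
move=> <-.
- congr (P _); apply/seteqP; split => w /=; rewrite blkS.
    by case: (Y (r + p) w); rewrite /= ?addn1 ?addn0.
  by move=> [-> ->].
- by apply: blk_sigma => k /andP[].
- by apply: sub_sigma_algebra; exists (r + p)%N => //; exact: sigma_rv_preimage.
Qed.

(** Pascal's rule, splitting according to the last mark of the block. *)
Lemma mark_block_law r p m : P [set w | blk r p w = m] = ('C(p, m)%:R / 2 ^+ p)%:E.
Proof.
elim: p m => [|p IH] m.
  rewrite expr0 divr1; case: m => [|m].
    rewrite (_ : [set w | _] = setT) ?probability_setT//.
    by apply/seteqP; split => // w _ /=; rewrite blk0.
  rewrite (_ : [set w | _] = set0) ?measure0//.
  by apply/seteqP; split => // w /=; rewrite blk0.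
case: m => [|m].
  by rewrite blkS_law0 IH !bin0 -EFinM exprS invfM; congr (_%:E); rewrite mulrCA.
rewrite blkS_law !IH -!EFinM -EFinD binS natrD exprS invfM; congr (_%:E); ring.
Qed.

Let dN (u : nat -> R) j w := (N (u j.+1) w - N (u j) w)%N.

Let dN_rv u i p : sigma_rv (dN u i) [set w | [set p] (dN u i w)].
Proof. by apply/sigma_rvE; exists [set p]. Qed.

Let count_sigma (t : R) A : 0 <= t -> sigma_process N [set w | A (N t w)].
Proof.
by move=> t0; apply: sub_sigma_algebra; exists t => //; exact: sigma_rv_preimage.
Qed.

Let count_incr_sigma (s t : R) (A : set nat) : 0 <= s -> 0 <= t ->
  sigma_process N [set w | A (N t w - N s w)%N].
Proof.
move=> s0 t0.
rewrite (_ : [set w | _] = \bigcup_p ([set w | [set p] (N s w)] `&`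
    [set w | [set q | A (q - p)%N] (N t w)])).
  by apply: g_sigma_bigcup => p; apply: g_sigma_setI; exact: count_sigma.
apply/seteqP; split => w /=; first by exists (N s w).
by move=> [p _ [/= ->]].
Qed.

Let thin_event (s t : R) r A : [set w | A (blk r (N t w - N s w) w)] =
  \bigcup_p ([set w | [set p] (N t w - N s w)%N] `&` [set w | A (blk r p w)]).
Proof.
apply/seteqP; split => w /=; first by exists (N t w - N s w)%N.
by move=> [p _ [/= ->]].
Qed.

Let thin_trivIset (s t : R) (X : nat -> set T) :
  trivIset setT (fun p => [set w | [set p] (N t w - N s w)%N] `&` X p).
Proof. by move=> i j _ _ [w [[/= <- _] [/= <- _]]]. Qed.

Let thin_event_measurable (s t : R) r A : 0 <= s -> 0 <= t ->
  measurable [set w | A (blk r (N t w - N s w) w)].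
Proof.
move=> s0 t0; rewrite thin_event; apply: bigcupT_measurable => p.
by apply: measurableI => //; apply: sNM; exact: count_incr_sigma.
Qed.

Hypothesis lam_ge0 : 0 <= lam.

(** Here [r] is a fixed number and not [N s]: the law of a block of marks does not depend on where
    it starts. Summing over the number of points in the interval gives [poisson_thinning_series]. *)
Let thin_law (s t : R) r A : 0 <= s -> s <= t ->
  P [set w | A (blk r (N t w - N s w) w)] = poisson_prob (lam * (t - s)) 0%N A.
Proof.
move=> s0 st; have t0 : 0 <= t by exact: le_trans st.
apply: (@nat_law_unique _ _ _ _ _ P (poisson_prob (lam * (t - s)) 0%N)
  (fun w => blk r (N t w - N s w) w) idfun).
- by move=> n; exact: (thin_event_measurable r [set n]).
- by [].
- exact: etrans (probability_setT P) (esym (probability_setT (poisson_prob _ _))).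
- by rewrite -ge0_fin_numE// fin_num_measure.
move=> m; rewrite -[RHS]poisson_thinning_series; last by rewrite mulr_ge0// subr_ge0.
transitivity (P (\bigcup_p ([set w | [set p] (N t w - N s w)%N] `&`
    [set w | [set m] (blk r p w)]))); first by rewrite -thin_event.
transitivity (\sum_(0 <= p <oo) P ([set w | [set p] (N t w - N s w)%N] `&`
    [set w | [set m] (blk r p w)]))%E.
  apply: measure_semi_bigcup.
  - by move=> p; apply: measurableI => //; apply: sNM; exact: count_incr_sigma.
  - exact: thin_trivIset.
  - apply: bigcupT_measurable => p.
    by apply: measurableI => //; apply: sNM; exact: count_incr_sigma.
apply: eq_eseriesr => p _; rewrite -(mark_block_law r p m).
have -> : poisson_prob (2 * (lam * (t - s))) 0%N [set p] =
    P [set w | [set p] (N t w - N s w)%N].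
  by have := pp_law pN s0 st [set p]; rewrite /pushforward mulrA => <-.
apply: indNY; first exact: count_incr_sigma.
exact: (@blk_sigma setT r p [set m]).
Qed.

Let sN_incr (u : nat -> R) D : (forall i, 0 <= u i) ->
  sigma_family D (dN u) `<=` sigma_process N.
Proof.
move=> u0; apply: smallest_sub; first exact: smallest_sigma_algebra.
by move=> _ [j _ /sigma_rvE[A _ ->]]; exact: (count_incr_sigma A (u0 j) (u0 j.+1)).
Qed.

Let sY_sub D : sigma_family D Y `<=` sigma_family setT Y.
Proof. by apply: g_sigmaS => E [k _ sE]; exists k. Qed.

(* The event that the thinned increments over the intervals [i, ..., i + n - 1]
   of the grid lie in [A], when [r] marks have been used before time [u i]. *)
Fixpoint thin (A : nat -> set nat) (u : nat -> R) (n i r : nat) : set T :=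
  if n is n'.+1 then \bigcup_p ([set w | [set p] (dN u i w)] `&`
    ([set w | A i (blk r p w)] `&` thin A u n' i.+1 (r + p)))
  else setT.

(** From step [i] on, only increments of index at least [i] and marks of index at least [r] are
    used; this provides the independence from the past. *)
Let thin_sigma A (u : nat -> R) n i r : (forall i, 0 <= u i) ->
  <<s meet_system (sigma_family [set j | (i <= j)%N] (dN u))
                  (sigma_family [set k | (r <= k)%N] Y) >> (thin A u n i r).
Proof.
move=> u0; elim: n i r => [|n IH] i r /=; first exact: g_sigma_setT.
apply: g_sigma_bigcup => p; apply: g_sigma_setI; [|apply: g_sigma_setI].
- apply: sub_sigma_algebra; apply: meet_systeml; first exact: g_sigma_setT.
  by apply: sub_sigma_algebra; exists i; [exact: leqnn|exact: dN_rv].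
- apply: sub_sigma_algebra; apply: meet_systemr; first exact: g_sigma_setT.
  by apply: blk_sigma => k /andP[].
- apply: g_sigmaS (IH i.+1 (r + p)%N).
  move=> _ [E1 [E2 [s1 s2 ->]]]; exists E1, E2; split => //.
    by apply: g_sigmaS s1 => E [j /= ij sE]; exists j => //=; exact: ltnW.
  apply: g_sigmaS s2 => E [j /= ij sE]; exists j => //=.
  by apply: leq_trans ij; exact: leq_addr.
Qed.

Let thin_measurable A (u : nat -> R) n i r : (forall i, 0 <= u i) -> measurable (thin A u n i r).
Proof.
move=> u0; have := @thin_sigma A u n i r u0; apply: g_sigma_measurable.
by move=> _ [E1 [E2 [/(sN_incr u0)/sNM m1 /sYM m2 ->]]]; exact: measurableI.
Qed.

Let dN_blocks (u : nat -> R) D D' : (forall i, 0 <= u i) ->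
  {homo u : i j / (i <= j)%N >-> i <= j} ->
  D `&` D' `<=` set0 -> independent2 P (sigma_family D (dN u)) (sigma_family D' (dN u)).
Proof.
move=> u0 um; apply: mutually_independent_blocks.
- exact: (pp_indep pN (u0 0%N) um).
- by move=> i; exact: sigma_rvT.
- by move=> i; exact: sigma_rvI.
- move=> i _ /sigma_rvE[A _ ->]; apply: sNM.
  exact: (count_incr_sigma A (u0 i) (u0 i.+1)).
Qed.

(** The head uses the increment [i] and marks below [r + p], the tail later increments and marks
    from [r + p] on. With [p] fixed, the border between the two blocks of marks is deterministic. *)
Let thin_step A (u : nat -> R) n i r p : (forall i, 0 <= u i) ->
  {homo u : i j / (i <= j)%N >-> i <= j} ->
  P ([set w | [set p] (dN u i w)] `&` ([set w | A i (blk r p w)] `&` thin A u n i.+1 (r + p)))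
  = (P ([set w | [set p] (dN u i w)] `&` [set w | A i (blk r p w)])
     * P (thin A u n i.+1 (r + p)))%E.
Proof.
move=> u0 um; rewrite setIA setIC muleC.
set U := [set w | [set p] (dN u i w)]; set V := [set w | A i (blk r p w)].
have sU : sigma_family [set i] (dN u) U.
  by apply: sub_sigma_algebra; exists i => //; exact: dN_rv.
have sV : sigma_family [set k | (k < r + p)%N] Y V.
  by apply: blk_sigma => k /andP[].
have UN := sN_incr u0 sU; have VY := sY_sub sV.
apply: product_rule_g_sigma (@thin_sigma A u n i.+1 (r + p) u0).
- by apply: meet_systemI => E F; exact: g_sigma_setI.
- by move=> _ [E1 [E2 [/(sN_incr u0)/sNM m1 /sYM m2 ->]]]; exact: measurableI.
- by apply: measurableI; [exact: sNM|exact: sYM VY].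
move=> _ [H [K [sH sK ->]]]; have HN := sN_incr u0 sH; have KY := sY_sub sK.
rewrite setIACA (indNY (g_sigma_setI HN UN) (g_sigma_setI KY VY)).
rewrite (indNY HN KY) (indNY UN VY).
have -> : P (H `&` U) = (P H * P U)%E.
  rewrite setIC muleC; apply: dN_blocks sU sH => // j [/= -> ].
  by rewrite ltnn.
have -> : P (K `&` V) = (P K * P V)%E.
  by rewrite setIC muleC; apply: indY_blocks sV sK => k [/= kr rk]; lia.
by rewrite muleACA.
Qed.

(** The probability of the tail does not depend on how many marks have been used, so it factors out
    of the sum over [p]. *)
Let thin_prob A (u : nat -> R) n i r : (forall i, 0 <= u i) ->
  {homo u : i j / (i <= j)%N >-> i <= j} ->
  P (thin A u n i r) =
  (\prod_(i <= j < i + n) poisson_prob (lam * (u j.+1 - u j)) 0%N (A j))%E.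
Proof.
move=> u0 um; elim: n i r => [|n IH] i r.
  by rewrite /= addn0 big_geq// probability_setT.
rewrite big_ltn ?addnS ?ltnS ?leq_addr// -addSn.
rewrite -(thin_law r (A i) (u0 i) (um _ _ (leqnSn i))) thin_event.
have mU p : measurable ([set w | [set p] (dN u i w)] `&` [set w | A i (blk r p w)]).
  by apply: measurableI => //; apply: sNM; exact: (count_incr_sigma [set p] (u0 i) (u0 i.+1)).
transitivity (\sum_(0 <= p <oo) P ([set w | [set p] (dN u i w)] `&`
    ([set w | A i (blk r p w)] `&` thin A u n i.+1 (r + p))))%E.
  apply: measure_semi_bigcup.
  - by move=> p; rewrite setIA; apply: measurableI => //; exact: thin_measurable.
  - exact: thin_trivIset.
  - apply: bigcupT_measurable => p.
    by rewrite setIA; apply: measurableI => //; exact: thin_measurable.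
rewrite (_ : P (\bigcup_p _) = \sum_(0 <= p <oo) P ([set w | [set p] (dN u i w)] `&`
    [set w | A i (blk r p w)]))%E; last first.
  by apply: measure_semi_bigcup; [exact: mU|exact: thin_trivIset|exact: bigcupT_measurable].
rewrite muleC; set c := (\prod_(_ <= _ < _) _)%E.
have cE r' : P (thin A u n i.+1 r') = c by exact: IH.
have fc : c \is a fin_num by rewrite -(cE r) fin_num_measure//; exact: thin_measurable.
rewrite -(fineK fc) -nneseriesZl//.
apply: eq_eseriesr => p _; rewrite thin_step// muleC; congr (_ * _)%E.
by rewrite fineK.
Qed.

Let count_mono (s t : R) w : 0 <= s -> s <= t -> (N s w <= N t w)%N.
Proof. by move=> s0 st; exact: (pp_mono pN). Qed.

Let M_incr (s t : R) w : 0 <= s -> s <= t ->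
  (M t w - M s w)%N = blk (N s w) (N t w - N s w) w.
Proof.
move=> s0 st; rewrite !ME -{1}(subnKC (count_mono w s0 st)) blkD add0n.
by rewrite addKn.
Qed.

Let thinP A (u : nat -> R) n i w : (forall i, 0 <= u i) ->
  {homo u : i j / (i <= j)%N >-> i <= j} ->
  thin A u n i (N (u i) w) w <->
  forall j, (i <= j < i + n)%N -> A j (M (u j.+1) w - M (u j) w)%N.
Proof.
move=> u0 um; elim: n i => [|n IH] i /=.
  by split => // _ j; rewrite addn0 => /andP[h1 h2]; lia.
have ui := um _ _ (leqnSn i).
have step : (\bigcup_p ([set w | [set p] (dN u i w)] `&`
    ([set w | A i (blk (N (u i) w) p w)] `&` thin A u n i.+1 (N (u i) w + p)))) w <->
   A i (M (u i.+1) w - M (u i) w)%N /\ thin A u n i.+1 (N (u i.+1) w) w.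
  rewrite M_incr//; split => [[p _ [/= <- []]]|[h1 h2]].
    by rewrite /dN subnKC// count_mono.
  exists (dN u i w) => //; split => //; split; first exact: h1.
  by rewrite /dN subnKC// count_mono.
split=> [/step[h1 /IH h2] j /andP[ij jn]|h].
  move: ij; rewrite leq_eqVlt => /orP[/eqP <-//|ij]; apply: h2; lia.
apply/step; split; first by apply: h; lia.
by apply/IH => j ij; apply: h; lia.
Qed.

Let thinned_joint A (u : nat -> R) n : 0 <= u 0%N ->
  {homo u : i j / (i <= j)%N >-> i <= j} ->
  P [set w | forall j, (j < n)%N -> A j (M (u j.+1) w - M (u j) w)%N] =
  (\prod_(0 <= j < n) poisson_prob (lam * (u j.+1 - u j)) 0%N (A j))%E.
Proof.
(* Time 0 is put in front, with no condition on the first increment, so that the recursion starts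
   with no mark used. *)
move=> u00 um; pose u' j : R := if j is j'.+1 then u j' else 0.
pose A' j : set nat := if j is j'.+1 then A j' else setT.
have u'0 i : 0 <= u' i.
  by case: i => [|i] //=; apply: le_trans u00 _; exact: um.
have um' : {homo u' : i j / (i <= j)%N >-> i <= j}.
  by move=> [|i] [|j] //= ij; [exact: (u'0 j.+1)|exact: um].
rewrite (_ : [set w | _] = thin A' u' n.+1 0 0); last first.
  apply/seteqP; split => w.
    move=> /= h; have := thinP A' n.+1 0 w u'0 um'; rewrite (pp_0 pN) => -[_]; apply.
    by move=> [|j] //= jn; apply: h.
  move=> h j jn; have := thinP A' n.+1 0 w u'0 um'; rewrite (pp_0 pN) => -[/(_ h) + _].
  by move=> /(_ j.+1); rewrite /= add0n ltnS; apply.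
rewrite thin_prob// add0n big_ltn//.
rewrite [X in (X * _)%E](probability_setT (poisson_prob _ _)) mul1e big_add1.
by [].
Qed.

Let M_law (s t : R) A : 0 <= s -> s <= t ->
  P [set w | A (M t w - M s w)%N] = poisson_prob (lam * (t - s)) 0%N A.
Proof.
move=> s0 st; pose u (j : nat) : R := if j == 0%N then s else t.
have um : {homo u : i j / (i <= j)%N >-> i <= j}.
  by move=> [|i] [|j].
have := @thinned_joint (fun=> A) u 1 s0 um; rewrite big_nat1 /u /= => <-.
congr (P _); apply/seteqP; split => w /=; first by move=> h [|j].
by move=> /(_ 0%N); exact.
Qed.

Let M_sigma (t : R) A : 0 <= t ->
  <<s meet_system (sigma_process N) (sigma_family setT Y) >> [set w | A (M t w)].
Proof.
move=> t0.
rewrite (_ : [set w | _] = \bigcup_p ([set w | [set p] (N t w)] `&` [set w | A (blk 0 p w)])).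
  apply: g_sigma_bigcup => p; apply: sub_sigma_algebra.
  exists [set w | [set p] (N t w)], [set w | A (blk 0 p w)]; split => //.
    exact: count_sigma.
  by apply: blk_sigma.
apply/seteqP; split => w /=; first by rewrite ME; exists (N t w).
by move=> [p _ [/= <-]]; rewrite ME.
Qed.

Lemma marked_count_sigma :
  sigma_process M `<=` <<s meet_system (sigma_process N) (sigma_family setT Y) >>.
Proof.
apply: smallest_sub; first exact: smallest_sigma_algebra.
by move=> _ [t t0 /sigma_rvE[A _ ->]]; exact: (M_sigma A t0).
Qed.

Lemma thinned_poisson_process : poisson_process P lam M.
Proof.
split.
- move=> t t0 _ A _; rewrite setTI.
  have := M_sigma A t0; apply: g_sigma_measurable.
  by move=> _ [E1 [E2 [/sNM m1 /sYM m2 ->]]]; exact: measurableI.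
- by move=> w; rewrite ME (pp_0 pN) blk0.
- move=> w s t s0 st; rewrite !ME -(subnKC (count_mono w s0 st)) blkD.
  exact: leq_addr.
- move=> w t t0; have [dl dl0 h] := pp_rcont pN w t0.
  by exists dl => // s st ts; rewrite !ME (h s st ts).
- move=> u u0 um s A us sA; have [C hC] := sigma_rv_choose sA.
  (* The missing indices get the full set, which turns an arbitrary finite family of increments into
     an initial segment. *)
  pose A' j := if j \in s then C j else setT.
  pose n := (\max_(j <- s) j).+1.
  have ns j : j \in s -> (j < n)%N by move=> js; rewrite ltnS; exact: leq_bigmax_seq.
  rewrite (_ : \bigcap_(i in _) _ =
      [set w | forall j, (j < n)%N -> A' j (M (u j.+1) w - M (u j) w)%N]).
    rewrite thinned_joint// (bigID (mem s))/= [X in (_ * X)%E]big1 ?mule1; last first.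
      by move=> j js; rewrite /A' (negbTE js); exact: (probability_setT (poisson_prob _ _)).
    rewrite -big_filter (perm_big s); last first.
      apply: uniq_perm => //; first by rewrite filter_uniq// iota_uniq.
      move=> j; rewrite mem_filter mem_index_iota /=.
      by apply/andP/idP => [[]//|js]; split => //; exact: ns.
    rewrite big_seq [RHS]big_seq; apply: eq_bigr => j js.
    rewrite /A' js (hC j).2// -M_law//; last exact: um.
    by apply: le_trans u0 _; exact: um.
  apply/seteqP; split => w /= h j.
    by rewrite /A'; case: ifPn => // js _; have := h j js; rewrite (hC j).2.
  by move=> js; rewrite (hC j).2//=; have := h j (ns j js); rewrite /A' js.
- by move=> s t s0 st A; exact: M_law.
Qed.

End thinning.

(** * The coupling and its coupling time *)

Section wrap_theory.
Context {R : realType}.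
Implicit Types x y : R.

Let twopi_gt0 : 0 < 2 * pi :> R. Proof. by rewrite mulr_gt0// pi_gt0. Qed.

Lemma wrap_itv x : - pi < Defs.wrap x <= pi.
Proof.
rewrite /Defs.wrap; set q := (x - pi) / (2 * pi).
have /andP[h1 h2] := ceil_itv q; have xq : x - pi = q * (2 * pi).
  by rewrite /q divfK// gt_eqF.
rewrite rmorphB/= in h1; rewrite -(ler_pM2r twopi_gt0) in h2.
rewrite -(ltr_pM2r twopi_gt0) in h1; rewrite -xq in h1 h2.
by apply/andP; split; lra.
Qed.

Lemma wrapP x : exists z : int, Defs.wrap x = x - 2 * pi * z%:~R.
Proof. by exists (Num.ceil ((x - pi) / (2 * pi))). Qed.

Lemma odd_int_norm_ge1 (z : int) : 1 <= `|(2 * z + 1)%:~R| :> R.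
Proof. by rewrite -intr_norm (ler_int _ 1); lia. Qed.

Lemma int_small (z : int) : `|2 * pi * z%:~R| < 2 * pi :> R -> z = 0.
Proof.
rewrite normrM gtr0_norm// -[X in _ < X]mulr1 ltr_pM2l// -intr_norm (ltr_int _ _ 1).
by lia.
Qed.

Lemma wrap_eqP x y : Defs.wrap x = Defs.wrap y <-> exists z : int, x - y = 2 * pi * z%:~R.
Proof.
have [a ea] := wrapP x; have [b eb] := wrapP y; split => [|[z e]].
  by rewrite ea eb => e; exists (a - b); rewrite rmorphB/=; lra.
have /andP[x1 x2] := wrap_itv x; have /andP[y1 y2] := wrap_itv y.
have : z - a + b = 0.
  apply: int_small; rewrite (_ : 2 * pi * _ = Defs.wrap x - Defs.wrap y); last first.
    by rewrite ea eb rmorphD rmorphB/=; lra.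
  by rewrite ltr_norml; apply/andP; split; lra.
by move/(congr1 (fun i : int => i%:~R : R)); rewrite rmorphD rmorphB/= => h; rewrite ea eb; nra.
Qed.

Lemma wrap_id x : - pi < x <= pi -> Defs.wrap x = x.
Proof.
move=> /andP[h1 h2]; have [a ea] := wrapP x; have /andP[x1 x2] := wrap_itv x.
suff a0 : a = 0 by rewrite ea a0 mulr0 subr0.
apply: int_small; rewrite (_ : 2 * pi * _ = x - Defs.wrap x); last by rewrite ea; lra.
by rewrite ltr_norml; apply/andP; split; lra.
Qed.

Lemma measurable_wrap : measurable_fun setT (@Defs.wrap R).
Proof.
move=> _ A mA; rewrite setTI.
pose S (z : int) := [set x : R | - pi < x - 2 * pi * z%:~R <= pi] `&`
  [set x | A (x - 2 * pi * z%:~R)].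
have mS z : measurable (S z).
  have mz : measurable_fun setT (fun x : R => x - 2 * pi * z%:~R).
    exact: measurable_funB.
  apply: measurableI; last by have := mz measurableT A mA; rewrite setTI.
  have := mz measurableT _ (measurable_itv `]- pi, pi]); rewrite setTI.
  by rewrite (_ : _ @^-1` _ = [set x : R | - pi < x - 2 * pi * z%:~R <= pi])//;
    apply/seteqP; split => x /=; rewrite in_itv.
rewrite (_ : _ @^-1` _ = (\bigcup_n S n%:Z) `|` (\bigcup_n S (Negz n))).
  by apply: measurableU; apply: bigcupT_measurable => n.
apply/seteqP; split => x /=.
  move=> Ax; have [z ez] := wrapP x; have := wrap_itv x; rewrite ez => xz.
  by rewrite ez in Ax; case: z {ez} xz Ax => n xz Ax; [left|right]; exists n.
suff h z : S z x -> A (Defs.wrap x) by move=> [[n _ /h]|[n _ /h]].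
move=> [/= /wrap_id e Ae]; suff -> : Defs.wrap x = Defs.wrap (x - 2 * pi * z%:~R).
  by rewrite e.
by apply/wrap_eqP; exists z; lra.
Qed.

End wrap_theory.

Section constructed_coupling.
Context {d} {T : measurableType d} {R : realType}.
Variable P : probability T R.
Variables (lam : R).
Hypothesis lam_ge0 : 0 <= lam.

Lemma construction_thinned B N Y : construction_data P lam B N Y ->
  poisson_process P lam (marked_count N Y) /\
  independent2 P (sigma_process B) (sigma_process (marked_count N Y)).
Proof.
move=> cd; have pN := cd_poisson cd; have bB := cd_bm cd.
have mY := cd_mark_meas cd.
have sBM : sigma_process B `<=` measurable.
  by apply: sigma_family_measurable => t t0; exact: (bm_meas bB).
have sNM : sigma_process N `<=` measurable.
  by apply: sigma_family_measurable => t t0; exact: (pp_meas pN).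
have sYM : sigma_family setT Y `<=` measurable.
  by apply: sigma_family_measurable => k _; exact: mY.
have iNY : independent2 P (sigma_process N) (sigma_family setT Y).
  have sBT : sigma_process B setT by exact: g_sigma_setT.
  move=> A C sA sC; have := cd_indep cd sBT sA sC.
  by rewrite setTI probability_setT mul1e.
split.
  exact: thinned_poisson_process pN mY (cd_mark_law cd) (cd_mark_indep cd) iNY lam_ge0.
suff h : independent2 P (sigma_process B)
    <<s meet_system (sigma_process N) (sigma_family setT Y) >>.
  by move=> A C sA /marked_count_sigma sC; exact: h.
rewrite -(sigma_algebra_g_sigma (C := sigma_process B)); last exact: smallest_sigma_algebra.
apply: independent2_g_sigma => //.
- by move=> A C; exact: g_sigma_setI.
- by apply: meet_systemI => A C; exact: g_sigma_setI.
- by move=> _ [A [C [/sNM mA /sYM mC ->]]]; exact: measurableI.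
- by apply: independent3_meetr (cd_indep cd); exact: g_sigma_setT.
Qed.

Lemma jumpy_path_0 (x : R) (B : R -> T -> R) N (Y : nat -> T -> bool) w :
  - pi < x <= pi -> B 0 w = 0 -> N 0 w = 0%N ->
  jumpy_path (fun=> x) B (marked_count N Y) 0 w = x.
Proof.
move=> xpi B0 N0; rewrite /jumpy_path /marked_count B0 N0 big_ord0.
by rewrite mul0r mulr0 !addr0 wrap_id.
Qed.

Lemma constructed_jumpy (x : R) B N Y : - pi < x <= pi ->
  construction_data P lam B N Y ->
  jumpy_brownian_motion P lam (jumpy_path (fun=> x) B (marked_count N Y)).
Proof.
move=> xpi cd; have bB := cd_bm cd; have pN := cd_poisson cd.
have [pM iBM] := construction_thinned cd.
set X := jumpy_path _ _ _; have X0 : X 0 = fun=> x.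
  apply/funext => w; apply: jumpy_path_0 => //; first exact: (bm_0 bB).
  exact: (pp_0 pN).
split; rewrite ?X0//; exists B, (marked_count N Y); split => //.
move=> A EB EM /sigma_rvE[C _ ->] sB sM.
have [Cx|nCx] := pselect (C x).
  rewrite (_ : _ @^-1` C = setT); last by apply/seteqP; split.
  by rewrite setTI probability_setT mul1e iBM.
rewrite (_ : _ @^-1` C = set0); last by apply/seteqP; split.
by rewrite !set0I measure0 !mul0e.
Qed.

Variables (B : R -> T -> R) (N : R -> T -> nat) (Y : nat -> T -> bool).
Hypothesis cd : construction_data P lam B N Y.

Let X := constructed_X B N Y.
Let Xh := constructed_Xh B N Y.
Let tau := hit_time B.
Let J := incident_time N 0.
Let bB : brownian_motion P B := cd_bm cd.
Let pN : poisson_process P (2 * lam) N := cd_poisson cd.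

Let pi_itv : - pi < (pi : R) <= pi.
Proof. by rewrite lexx andbT; have := @pi_gt0 R; lra. Qed.

Let zero_itv : - pi < (0 : R) <= pi.
Proof. by have := @pi_gt0 R; lra. Qed.

Lemma constructed_is_coupling : is_coupling P lam X Xh.
Proof.
split; first exact: constructed_jumpy.
by apply: constructed_jumpy => //; exact: coupled_construction_data cd.
Qed.

Lemma constructed_X0 w : X 0 w = 0.
Proof. by apply: jumpy_path_0; [exact: zero_itv|exact: (bm_0 bB)|exact: (pp_0 pN)]. Qed.

Lemma constructed_Xh0 w : Xh 0 w = pi.
Proof.
apply: jumpy_path_0; [exact: pi_itv| |exact: (pp_0 pN)].
exact: (bm_0 (coupled_brownian_motion cd)).
Qed.

Let cB w : {within `[0, +oo[%classic, continuous (B ^~ w)} :=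
  @bm_cont _ _ _ _ _ bB w.

Lemma incident_time_ge0 k w : (0 <= incident_time N k w)%E.
Proof. by apply: le_ereal_inf_tmp => _ [t [t0 _] <-]; rewrite lee_fin. Qed.

Lemma hit_time_gt0 w : (0 < tau w)%E.
Proof. exact: hit_path_gt0 (bm_0 bB w) (@cB w). Qed.

(** If tau < J_1, then after [tau] the path [Bh] is [B] minus twice its value at [tau], which is pi
    or -pi; halved, this makes up for the initial distance pi modulo 2 pi. Otherwise exactly one of
    the two processes jumps at J_1, with the same effect, and all later marks agree. *)
Lemma constructed_meet (s : R) w : 0 <= s ->
  (Order.min (J w) (tau w) <= s%:E)%E -> X s w = Xh s w.
Proof.
move=> s0; rewrite /X /Xh /constructed_X /constructed_Xh /jumpy_path => Ts.
apply/wrap_eqP; have [tJ|Jt] := boolP (tau w < J w)%E.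
  move: Ts; rewrite (min_idPr (ltW tJ)) => ts.
  have hb : marked_count N (constructed_Yh B N Y) s w = marked_count N Y s w.
    by apply: eq_bigr => k _; rewrite /constructed_Yh tJ andbF.
  rewrite hb /constructed_Bh tJ; case E : (tau w) ts => [r| |]; rewrite ?leye_eq//; last first.
    by have := hit_time_gt0 w; rewrite E.
  rewrite lee_fin => rs; have [r0 Br] := hit_path_attained (bm_0 bB w) (@cB w) E.
  rewrite (_ : hit_time B w = r%:E)//.
  rewrite -[if _ then _ else _]/(reflect_path (B ^~ w) r%:E s) reflect_path_ge//.
  have [Bp|Bn] : B r w = pi \/ B r w = - pi.
    by move: Br => /half_hit[h|h]; [right|left]; lra.
    by exists 0; rewrite Bp; field.
  by exists (-1); rewrite Bn; field.
have Jt' : (J w <= tau w)%E by rewrite leNgt.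
move: Ts; rewrite (min_idPl Jt') => Js.
have Ns : N s w != 0%N.
  by apply/eqP => /(lt_incident_time0 w pN s0); rewrite ltNge Js.
rewrite /constructed_Bh (negbTE Jt) /marked_count.
case: (N s w) Ns => // n _; rewrite !big_ord_recl.
have -> : (\sum_(i < n) constructed_Yh B N Y (lift ord0 i) w = \sum_(i < n) Y (lift ord0 i) w)%N.
  by apply: eq_bigr => k _; rewrite /constructed_Yh /=.
rewrite /constructed_Yh /= Jt; case: (Y 0%N w) => /=.
  by exists 0; rewrite !natrD; ring.
by exists (-1); rewrite !natrD; ring.
Qed.

(** Neither process has jumped yet. In the first branch a meeting would make [B s w] an odd multiple
    of pi, impossible since |B| < pi; in the second the distance is still pi. *)
Lemma constructed_apart (s : R) w : 0 <= s ->
  (s%:E < Order.min (J w) (tau w))%E -> X s w <> Xh s w.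
Proof.
move=> s0; rewrite lt_min => /andP[sJ st].
have Ns : N s w = 0%N by exact/(lt_incident_time0 w pN s0).
have Bs : `|B s w| < pi.
  by have /(lt_hit_pathP (bm_0 bB w) (@cB w) s0) := st; apply; rewrite s0 lexx.
rewrite /X /Xh /constructed_X /constructed_Xh /jumpy_path /marked_count Ns !big_ord0.
move=> /wrap_eqP[z]; rewrite mulr0 !addr0 add0r /constructed_Bh.
have hpi := @pi_gt0 R.
have hz := @odd_int_norm_ge1 R z; rewrite rmorphD rmorphM/= in hz.
rewrite rmorph1 in hz.
case: ifP => _.
  rewrite (ltW st) => e; have e' : B s w = pi * (2 * z%:~R + 1) by lra.
  by move: Bs; rewrite e' normrM gtr0_norm// -[X in _ < X]mulr1 ltr_pM2l// ltNge hz.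
move=> e; have /eqP : pi * (2 * z%:~R + 1) = 0 :> R by lra.
by rewrite mulf_eq0 gt_eqF//= => /eqP h; rewrite h normr0 ler10 in hz.
Qed.

Lemma constructed_coupling_time w :
  coupling_time X Xh w = Order.min (J w) (tau w).
Proof.
set Ts := Order.min _ _; have Ts0 : (0 <= Ts)%E.
  by rewrite le_min incident_time_ge0 (ltW (hit_time_gt0 w)).
apply/eqP; rewrite eq_le; apply/andP; split; last first.
  apply: le_ereal_inf_tmp => _ [t [t0 ht] <-]; rewrite leNgt; apply/negP => tT.
  exact: (constructed_apart t0 tT) (ht t (lexx t)).
case E : Ts Ts0 => [r| |]; rewrite ?leey//.
rewrite lee_fin => r0; apply: ereal_inf_lbound; exists r => //; split => // s rs.
apply: constructed_meet; first exact: (le_trans r0 rs).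
by rewrite -/Ts E lee_fin.
Qed.

Lemma constructed_survival (t : R) : 0 <= t ->
  P [set w | (t%:E < coupling_time X Xh w)%E] =
  (P [set w | N t w = 0%N] * P [set w | (t%:E < tau w)%E])%E.
Proof.
move=> t0; rewrite muleC.
rewrite (_ : [set w | _] = [set w | (t%:E < tau w)%E] `&` [set w | N t w = 0%N]).
  have sYT : sigma_family setT Y setT by exact: g_sigma_setT.
  apply: (independent3_pair sYT (cd_indep cd)).
    rewrite (lt_tauE bB t0); apply: path_sigma_process.
    exact: path_sigma_stays_below.
  apply: sub_sigma_algebra; exists t => //.
  exact: (@sigma_rv_preimage _ _ _ _ (N t) [set 0%N]).
apply/seteqP; split => w /=; rewrite constructed_coupling_time lt_min.
  by move=> /andP[/(lt_incident_time0 w pN t0)].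
by move=> [-> /(lt_incident_time0 w pN t0) ->].
Qed.

End constructed_coupling.

(** * Total variation distance *)

Section parity.
Context {R : realType}.

(** The difference is the alternating sum of the Poisson weights, that is, exp(-mu) times the
    exponential series at -mu. *)
Lemma poisson_parity (mu : R) : 0 <= mu ->
  fine (poisson_prob mu 0%N [set n | ~~ odd n]) - fine (poisson_prob mu 0%N [set n | odd n])
  = expR (- (2 * mu)).
Proof.
rewrite le_eqVlt => /orP[/eqP <-|mu0].
  rewrite /poisson_prob ltxx !diracE mem_set//= memNset//=.
  by rewrite subr0 mulr0 oppr0 expR0.
have part (p : pred nat) :
    [sequence \sum_(0 <= k < n | p k) poisson_pmf mu k]_n @ \oo -->
    fine (poisson_prob mu 0%N [set n | p n]).
  rewrite (_ : [sequence _]_n =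
      fine \o (fun n => (\sum_(0 <= k < n | p k) (poisson_pmf mu k)%:E)%E)); last first.
    by apply/funext => n /=; rewrite sumEFin.
  apply: fine_cvg; rewrite fineK; last by rewrite fin_num_measure.
  rewrite /poisson_prob mu0 -nneseries_esum; last first.
    by move=> n _; rewrite lee_fin poisson_pmf_ge0.
  by apply: is_cvg_nneseries_cond => n _ _; rewrite lee_fin poisson_pmf_ge0.
have h : (fun n => \sum_(0 <= k < n | ~~ odd k) poisson_pmf mu k -
   \sum_(0 <= k < n | odd k) poisson_pmf mu k) @ \oo -->
   fine (poisson_prob mu 0%N [set n | ~~ odd n]) - fine (poisson_prob mu 0%N [set n | odd n]).
  by apply: cvgB; [exact: (part (fun n => ~~ odd n))|exact: (part odd)].
have e : (fun n => \sum_(0 <= k < n | ~~ odd k) poisson_pmf mu k -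
   \sum_(0 <= k < n | odd k) poisson_pmf mu k) =
   (fun n => expR (- mu) * series (exp_coeff (- mu)) n).
  apply/funext => n; rewrite /series /= mulr_sumr [RHS](bigID odd)/= addrC -sumrN.
  congr (_ + _); apply: eq_bigr => k; rewrite /poisson_pmf mu0 /exp_coeff/= => ok.
    by rewrite exprNn -signr_odd (negbTE ok) expr0; ring.
  by rewrite exprNn -signr_odd ok expr1; ring.
have h' : (fun n => expR (- mu) * series (exp_coeff (- mu)) n) @ \oo -->
    expR (- mu) * expR (- mu).
  apply: cvgMr; exact: is_cvg_series_exp_coeff.
have -> : expR (- (2 * mu)) = expR (- mu) * expR (- mu).
  by rewrite -expRD; congr expR; ring.
rewrite -(cvg_lim _ h')// -e; apply/esym; exact: (cvg_lim _ h).
Qed.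

End parity.

Section exponential_law.
Context {d} {T : measurableType d} {R : realType}.
Variable P : probability T R.

(** The law of [J] is prescribed on finite values only, so the tail is the complement of J <= t,
    which up to a null set means that [J] lies in [0, t]; possible mass at +oo is thereby
    counted. *)
Lemma exponential_rv_tail (rate : R) (J : T -> \bar R) (t : R) :
  exponential_rv P rate J -> 0 <= t ->
  P [set w | (t%:E < J w)%E] = (expR (- (rate * t)))%:E.
Proof.
move=> [mJ [Z [mZ PZ JZ]] lawJ] t0.
have mle : measurable [set w | (J w <= t%:E)%E].
  rewrite (_ : [set w | _] = J @^-1` `]-oo, t%:E]%classic).
    by rewrite -[X in measurable X]setTI; apply: mJ => //; exact: emeasurable_itv.
  by apply/seteqP; split => w /=; rewrite in_itv.
have mitv : measurable (J @^-1` (EFin @` `[0, t]%classic)).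
  rewrite -[X in measurable X]setTI; apply: mJ => //.
  by apply: measurable_image_EFin; exact: measurable_itv.
have Ple : P [set w | (J w <= t%:E)%E] = exponential_prob rate `[0, t]%classic.
  rewrite -lawJ// /pushforward; apply/eqP; rewrite eq_le; apply/andP; split; last first.
    apply: le_measure; rewrite ?inE//.
    by move=> w /= [x]; rewrite in_itv /= => /andP[_ xt] <-; rewrite lee_fin.
  rewrite -(measureU0 mitv mZ PZ); apply: le_measure; rewrite ?inE//.
    exact: measurableU.
  move=> w /= Jt; have [J0|nJ0] := pselect (0 <= J w)%E; last first.
    by right; apply: JZ.
  left; move: J0 Jt; case: (J w) => [r| |]// J0 Jt; exists r => //.
  by rewrite in_itv /= -!lee_fin J0.
have Pexp : exponential_prob rate `[0, t]%classic = (1 - (expR (- (rate * t)))%:E)%E.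
  move: t0; rewrite le_eqVlt => /orP[/eqP <-|t0].
    rewrite set_itv1 /exponential_prob integral_set1 mulr0 oppr0 expR0.
    by rewrite -EFinB subrr.
  by rewrite exponential_prob_itv0c// mulNr.
rewrite (_ : [set w | _] = ~` [set w | (J w <= t%:E)%E]); last first.
  by apply/seteqP; split => w /=; rewrite ltNge => /negP.
rewrite probability_setC// Ple Pexp -!EFinB; congr (_%:E); ring.
Qed.

End exponential_law.

Section marginals.
Context {R : realType}.

(** Brings processes on different spaces back to one Brownian motion. Time 0 is treated apart
    because [bm_gauss] is about s < t. *)
Lemma brownian_marginal d d' (T : measurableType d) (T' : measurableType d')
    (P : probability T R) (P' : probability T' R) (B : R -> T -> R) (B' : R -> T' -> R)
    (t : R) A :
  brownian_motion P B -> brownian_motion P' B' -> 0 <= t -> measurable A ->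
  P [set w | A (B t w)] = P' [set w | A (B' t w)].
Proof.
move=> bB bB'; rewrite le_eqVlt => /orP[/eqP <-|t0] mA.
  have e d0 (T0 : measurableType d0) (B0 : R -> T0 -> R) : (forall w, B0 0 w = 0) ->
      [set w | A (B0 0 w)] = [set w | A 0].
    by move=> h; apply/seteqP; split => w /=; rewrite h.
  rewrite (e _ _ B) ?(e _ _ B'); [|exact: (bm_0 bB')|exact: (bm_0 bB)].
  have [A0|nA0] := pselect (A 0).
    have h (V : Type) : [set _ : V | A 0] = setT by apply/seteqP; split.
    by rewrite !h !probability_setT.
  have h (V : Type) : [set _ : V | A 0] = set0 by apply/seteqP; split.
  by rewrite !h !measure0.
have e d0 (T0 : measurableType d0) (P0 : probability T0 R) (B0 : R -> T0 -> R) :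
    brownian_motion P0 B0 -> P0 [set w | A (B0 t w)] = normal_prob 0 (Num.sqrt t) A.
  move=> b0; have := bm_gauss b0 (lexx 0) t0 mA; rewrite subr0 /pushforward => <-.
  by congr (P0 _); apply/seteqP; split => w /=; rewrite (bm_0 b0) subr0.
by rewrite (e _ _ P)// (e _ _ P').
Qed.

(** The position on the circle, jumps apart, of a process started at [c] when its Brownian motion is
    at [x]. *)
Definition half_wrap (c x : R) : R := Defs.wrap (c + x / 2).

Lemma measurable_half_wrap (c : R) : measurable_fun setT (half_wrap c).
Proof.
apply: (measurableT_comp measurable_wrap).
by apply: measurable_funD => //; exact: measurable_funM.
Qed.

Lemma measurable_half_wrap_set (c : R) A : measurable A ->
  measurable [set x | A (half_wrap c x)].
Proof. by move=> mA; have := measurable_half_wrap c measurableT mA; rewrite setTI. Qed.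

End marginals.

Section reflection_coupling.
Context {d} {T : measurableType d} {R : realType}.
Variable P : probability T R.
Variable B : R -> T -> R.
Hypothesis bB : brownian_motion P B.

Let cB w : {within `[0, +oo[%classic, continuous (B ^~ w)} :=
  @bm_cont _ _ _ _ _ bB w.

Lemma hit_event_measurable (t : R) : 0 <= t -> measurable [set w | (t%:E < hit_time B w)%E].
Proof.
move=> t0; rewrite (lt_tauE bB t0).
by have [] := reflect_path_law bB (lexx 0) (path_sigma_stays_below t0).
Qed.

Lemma brownian_event_measurable (t : R) A : 0 <= t -> measurable A ->
  measurable [set w | A (B t w)].
Proof. by move=> t0 mA; have := bm_meas bB t0 measurableT mA; rewrite setTI. Qed.

Let triv : set_system T := [set E | E = set0 \/ E = setT].

Let Bh := reflected_before B (fun=> +oo%E).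

Let Bh_law F : path_sigma F ->
  measurable [set w | F (Bh ^~ w)] /\ P [set w | F (Bh ^~ w)] = P [set w | F (B ^~ w)].
Proof.
move=> pF; have tM : triv `<=` measurable by move=> E [->|->].
have tT : triv setT by right.
have tI : independent2 P (sigma_process B) triv.
  move=> E H sE [->|->]; first by rewrite setI0 measure0 mule0.
  by rewrite setIT probability_setT mule1.
have tJ H (v : R) : triv H -> 0 <= v -> triv (H `&` [set w | (v%:E < +oo)%E]).
  move=> [->|->] _; first by rewrite set0I; left.
  by right; apply/seteqP; split => // w _; split => //=; rewrite ltry.
by have := reflected_before_law bB tM tT tI tJ pF tT; rewrite !setIT.
Qed.

Definition central_arc : set R := `]- (pi / 2), pi / 2]%classic.

Lemma half_wrap_central (x : R) : `|x| < pi -> central_arc (half_wrap 0 x).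
Proof.
rewrite ltr_norml => /andP[h1 h2]; have hp := @pi_gt0 R.
rewrite /half_wrap add0r wrap_id; last by apply/andP; split; lra.
by rewrite /central_arc /= in_itv /=; apply/andP; split; lra.
Qed.

Lemma half_wrap_opposite (x : R) : `|x| < pi -> ~ central_arc (half_wrap pi x).
Proof.
rewrite ltr_norml => /andP[h1 h2]; have hp := @pi_gt0 R.
rewrite /half_wrap /central_arc /= in_itv /=.
have [x0|x0] := leP x 0.
  by rewrite wrap_id => [/andP[? ?]|]; [lra|apply/andP; split; lra].
have -> : Defs.wrap (pi + x / 2) = Defs.wrap (x / 2 - pi).
  by apply/wrap_eqP; exists 1; rewrite mulr1; ring.
by rewrite wrap_id => [/andP[? ?]|]; [lra|apply/andP; split; lra].
Qed.

(** [B] may be replaced by its reflection at the hitting time. From that time on, the reflected path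
    halved and shifted by pi occupies the same point as [B] halved, because |B| = pi there at the
    moment of reflection. *)
Lemma half_wrap_pi_event (t : R) A : 0 <= t -> measurable A ->
  P [set w | A (half_wrap pi (B t w))] =
  (P ([set w | A (half_wrap 0 (B t w))] `\` [set w | (t%:E < hit_time B w)%E]) +
   P ([set w | A (half_wrap pi (Bh t w))] `&` [set w | (t%:E < hit_time B w)%E]))%E.
Proof.
move=> t0 mA; pose F : set (R -> R) := [set f | A (half_wrap pi (f t))].
have pF : path_sigma F.
  exact: (path_sigma_coord t0 (measurable_half_wrap_set pi mA)).
have [mBh <-] := Bh_law pF; have mS := hit_event_measurable t0.
rewrite {1}(_ : P [set w | F (Bh ^~ w)] =
  (P ([set w | F (Bh ^~ w)] `\` [set w | (t%:E < hit_time B w)%E]) +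
   P ([set w | F (Bh ^~ w)] `&` [set w | (t%:E < hit_time B w)%E]))%E); last exact: measureDI.
congr (P _ + _)%E.
have e w : ~ (t%:E < hit_time B w)%E -> half_wrap pi (Bh t w) = half_wrap 0 (B t w).
  move=> /negP; rewrite -leNgt /Bh /reflected_before => ht.
  rewrite (le_lt_trans (y := t%:E) ht (ltry _)).
  have := hit_path_gt0 (bm_0 bB w) (@cB w).
  move: ht; rewrite -[hit_time B w]/(hit_path (B ^~ w)).
  case E : (hit_path _) => [r| |]//; rewrite lee_fin => rt _.
  have [r0 Br] := hit_path_attained (bm_0 bB w) (@cB w) E.
  rewrite reflect_path_ge// /half_wrap; apply/wrap_eqP.
  have [Bp|Bn] : B r w = pi \/ B r w = - pi.
    by move: Br => /half_hit[h|h]; [right|left]; lra.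
    by exists 0; rewrite Bp; field.
  by exists 1; rewrite Bn; field.
by apply/seteqP; split => w [h nt]; split => //; move: h; rewrite /F /= e.
Qed.

Lemma half_wrap_split (t : R) A : 0 <= t -> measurable A ->
  P [set w | A (half_wrap 0 (B t w))] =
  (P ([set w | A (half_wrap 0 (B t w))] `\` [set w | (t%:E < hit_time B w)%E]) +
   P ([set w | A (half_wrap 0 (B t w))] `&` [set w | (t%:E < hit_time B w)%E]))%E.
Proof.
move=> t0 mA; apply: measureDI; last exact: hit_event_measurable.
exact: (brownian_event_measurable t0 (measurable_half_wrap_set 0 mA)).
Qed.

Lemma half_wrap_diff_le (t : R) A : 0 <= t -> measurable A ->
  fine (P [set w | A (half_wrap 0 (B t w))]) - fine (P [set w | A (half_wrap pi (B t w))])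
  <= fine (P [set w | (t%:E < hit_time B w)%E]).
Proof.
move=> t0 mA; have mS := hit_event_measurable t0.
have mF c := brownian_event_measurable t0 (measurable_half_wrap_set c mA).
have pF : path_sigma [set f : R -> R | A (half_wrap pi (f t))].
  exact: (path_sigma_coord t0 (measurable_half_wrap_set pi mA)).
have [mBh _] := Bh_law pF.
have mD := measurableD (mF 0) mS; have mI := measurableI _ _ (mF 0) mS.
have mIh := measurableI _ _ mBh mS.
rewrite half_wrap_split// half_wrap_pi_event// !fineD ?fin_num_measure//.
have bS : fine (P ([set w | A (half_wrap 0 (B t w))] `&` [set w | (t%:E < hit_time B w)%E]))
    <= fine (P [set w | (t%:E < hit_time B w)%E]).
  by rewrite fine_le ?fin_num_measure//; apply: measureIr => //; exact: mF.
have c0 : 0 <= fine (P ([set w | A (half_wrap pi (Bh t w))] `&`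
    [set w | (t%:E < hit_time B w)%E])) by exact: fine_ge0.
by lra.
Qed.

Lemma half_wrap_diff_central (t : R) : 0 <= t ->
  fine (P [set w | central_arc (half_wrap 0 (B t w))]) -
  fine (P [set w | central_arc (half_wrap pi (B t w))])
  = fine (P [set w | (t%:E < hit_time B w)%E]).
Proof.
move=> t0; have mS := hit_event_measurable t0.
have mA : measurable central_arc by exact: measurable_itv.
have mF c := brownian_event_measurable t0 (measurable_half_wrap_set c mA).
have Bt w : (t%:E < hit_time B w)%E -> `|B t w| < pi.
  by move/(lt_hit_pathP (bm_0 bB w) (@cB w) t0); apply; rewrite t0 lexx.
rewrite half_wrap_split// half_wrap_pi_event//.
rewrite [X in (_ + P X)%E](_ : _ = [set w | (t%:E < hit_time B w)%E]); last first.
  apply/seteqP; split => w /=; first by case.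
  by move=> h; split => //; apply: half_wrap_central; exact: Bt.
rewrite [X in _ - fine (_ + P X)%E](_ : _ = set0) ?measure0 ?adde0; last first.
  apply/seteqP; split => // w [/= h tw]; move: h; apply: half_wrap_opposite.
  rewrite /Bh /reflected_before; case: ifP => _; last exact: Bt.
  rewrite norm_reflect_path; first exact: Bt.
  exact: ltW tw.
have mD := measurableD (mF 0) mS.
by rewrite fineD ?fin_num_measure//; ring.
Qed.

End reflection_coupling.

Section jumpy_total_variation.
Context {R : realType}.

Lemma half_wrap_jumps (c x : R) (n : nat) :
  Defs.wrap (c + x / 2 + pi * n%:R) =
  if odd n then half_wrap (c + pi) x else half_wrap c x.
Proof.
have e : n%:R = (odd n)%:R + 2 * n./2%:R :> R.
  by rewrite -{1}(odd_double_half n) natrD -muln2 natrM mulrC.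
rewrite e /half_wrap; case: (odd n); apply/wrap_eqP; exists (n./2%:Z) => /=; ring.
Qed.

Lemma jumpy_marginal d (T : measurableType d) (P : probability T R) (lam : R)
    (X : R -> T -> R) (c : R) : jumpy_brownian_motion P lam X -> (forall w, X 0 w = c) ->
  exists2 B, brownian_motion P B & forall (t : R) A, 0 <= t -> measurable A ->
    P [set w | A (X t w)] =
    (poisson_prob (lam * t) 0%N [set n | ~~ odd n] * P [set w | A (half_wrap c (B t w))] +
     poisson_prob (lam * t) 0%N [set n | odd n] * P [set w | A (half_wrap (c + pi) (B t w))])%E.
Proof.
move=> [_ _ [B [N [bB pN ind XE]]]] X0; exists B => // t A t0 mA.
have sBt c' : sigma_process B [set w | A (half_wrap c' (B t w))].
  apply: sub_sigma_algebra; exists t => //; apply/sigma_rvE.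
  by exists [set x | A (half_wrap c' x)] => //; exact: measurable_half_wrap_set.
have sNt (D : set nat) : sigma_process N [set w | D (N t w)].
  by apply: sub_sigma_algebra; exists t => //; apply/sigma_rvE; exists D.
have mB c' : measurable [set w | A (half_wrap c' (B t w))].
  exact: (brownian_event_measurable bB t0 (measurable_half_wrap_set c' mA)).
have mN (D : set nat) : measurable [set w | D (N t w)].
  by rewrite -[X in measurable X]setTI; apply: (pp_meas pN t0).
have indBN c' (D : set nat) :
    P ([set w | A (half_wrap c' (B t w))] `&` [set w | D (N t w)]) =
    (poisson_prob (lam * t) 0%N D * P [set w | A (half_wrap c' (B t w))])%E.
  have := ind setT _ _ (sigma_rvT _) (sBt c') (sNt D).
  rewrite setTI probability_setT mul1e => ->; rewrite muleC; congr (_ * _)%E.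
  have := pp_law pN (lexx 0) t0 D; rewrite subr0 /pushforward => <-.
  by congr (P _); apply/seteqP; split => w /=; rewrite (pp_0 pN) subn0.
have -> : [set w | A (X t w)] =
    ([set w | A (half_wrap c (B t w))] `&` [set w | [set n | ~~ odd n] (N t w)]) `|`
    ([set w | A (half_wrap (c + pi) (B t w))] `&` [set w | [set n | odd n] (N t w)]).
  apply/seteqP; split => w /=; rewrite XE// /jumpy_path X0 half_wrap_jumps.
    by case: ifP => o h; [right|left].
  by move=> [[h /negbTE ->]|[h ->]].
have m1 := measurableI _ _ (mB c) (mN [set n | ~~ odd n]).
have m2 := measurableI _ _ (mB (c + pi)) (mN [set n | odd n]).
apply: etrans (measureU P m1 m2 _) _; last by congr (_ + _)%E; exact: indBN.
by apply/seteqP; split => // w [[_ /= /negbTE e] [_ /=]]; rewrite e.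
Qed.

Lemma jumpy_tv_dist d1 d2 d3 (T1 : measurableType d1) (P1 : probability T1 R)
    (T2 : measurableType d2) (P2 : probability T2 R)
    (T3 : measurableType d3) (P3 : probability T3 R)
    (lam : R) (X : R -> T1 -> R) (Xh : R -> T2 -> R) (B : R -> T3 -> R) (t : R) :
  0 <= lam -> jumpy_brownian_motion P1 lam X -> (forall w, X 0 w = 0) ->
  jumpy_brownian_motion P2 lam Xh -> (forall w, Xh 0 w = pi) ->
  brownian_motion P3 B -> 0 <= t ->
  tv_dist (pushforward P1 (X t)) (pushforward P2 (Xh t)) =
  ((expR (- (2 * lam * t)))%:E * P3 [set w | (t%:E < hit_time B w)%E])%E.
Proof.
move=> lam0 jX X0 jXh Xh0 bB t0.
have [B1 bB1 lawX] := jumpy_marginal jX X0.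
have [B2 bB2 lawXh] := jumpy_marginal jXh Xh0.
pose e : R := fine (poisson_prob (lam * t) 0%N [set n | ~~ odd n]).
pose o : R := fine (poisson_prob (lam * t) 0%N [set n | odd n]).
pose F c A : R := fine (P3 [set w | A (half_wrap c (B t w))]).
have FE c A : measurable A -> P3 [set w | A (half_wrap c (B t w))] = (F c A)%:E.
  move=> mA; rewrite /F fineK// fin_num_measure//.
  exact: (brownian_event_measurable bB t0 (measurable_half_wrap_set c mA)).
have eE : poisson_prob (lam * t) 0%N [set n | ~~ odd n] = e%:E.
  by rewrite /e fineK// fin_num_measure.
have oE : poisson_prob (lam * t) 0%N [set n | odd n] = o%:E.
  by rewrite /o fineK// fin_num_measure.
have wrap2pi A : measurable A -> F (pi + pi) A = F 0 A.
  move=> _; congr (fine (P3 _)); suff h x : half_wrap (pi + pi) x = half_wrap 0 x :> R.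
    by apply/seteqP; split => w /=; rewrite h.
  by apply/wrap_eqP; exists 1; rewrite mulr1; ring.
have marg d' (T' : measurableType d') (P' : probability T' R) (B' : R -> T' -> R) c A :
    brownian_motion P' B' -> measurable A ->
    P' [set w | A (half_wrap c (B' t w))] = (F c A)%:E.
  move=> bB' mA; rewrite -FE//.
  exact: (brownian_marginal bB' bB t0 (measurable_half_wrap_set c mA)).
(* With [e] and [o] the probabilities of an even and an odd number of jumps, the two laws are e F_0
   + o F_pi and e F_pi + o F_0, as a shift by 2 pi is no shift; their difference is (e - o)(F_0 -
   F_pi). *)
have diff A : measurable A ->
    (pushforward P1 (X t) A - pushforward P2 (Xh t) A)%E =
    (expR (- (2 * lam * t)) * (F 0 A - F pi A))%:E.
  move=> mA; rewrite /pushforward; have := lawX t A t0 mA; have := lawXh t A t0 mA.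
  rewrite /preimage /= => -> ->; rewrite eE oE.
  rewrite !(marg _ _ _ _ _ _ bB1 mA) !(marg _ _ _ _ _ _ bB2 mA) add0r wrap2pi//.
  rewrite -!EFinM -!EFinD -?EFinB; congr (_%:E) => /=.
  have := poisson_parity (mulr_ge0 lam0 t0); rewrite -/e -/o mulrA => <-; ring.
have mS := hit_event_measurable bB t0.
rewrite -[P3 _]fineK ?fin_num_measure// -EFinM.
apply/eqP; rewrite eq_le; apply/andP; split.
  apply: ge_ereal_sup => _ [A [mA _] <-]; rewrite diff// lee_fin.
  by rewrite ler_wpM2l ?expR_ge0//; exact: half_wrap_diff_le.
have mA : measurable (central_arc : set R) by exact: measurable_itv.
apply: ereal_sup_ubound; exists central_arc; last first.
  by rewrite diff// /F half_wrap_diff_central.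
split => // x; rewrite /central_arc /= !in_itv /=; have := @pi_gt0 R.
by move=> hp /andP[h1 h2]; apply/andP; split; lra.
Qed.

End jumpy_total_variation.

(** * Small-time estimates *)

Section gaussian_tail.
Context {R : realType}.

(* The Gaussian density of variance [t] is dominated on [a <= |x|] by
   [2 exp (- a^2 / 4t)] times the density of variance [2t]. *)
Lemma normal_prob_tail (a t : R) : 1 <= a -> 0 < t ->
  (normal_prob 0 (Num.sqrt t) [set x : R | (a <= `|x|)%R] <= (128 * t ^+ 2)%:E)%E.
Proof.
move=> a1 t0; have t20 : 0 < 2 * t by rewrite mulr_gt0.
have s0 : Num.sqrt t != 0 by rewrite gt_eqF// sqrtr_gt0.
have s20 : Num.sqrt (2 * t) != 0 by rewrite gt_eqF// sqrtr_gt0.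
pose c : R := 2 * expR (- (a ^+ 2 / (4 * t))).
have c0 : 0 <= c by rewrite mulr_ge0// expR_ge0.
have hpi := @pi_gt0 R.
have peak : normal_peak (Num.sqrt t) <= 2 * normal_peak (Num.sqrt (2 * t)).
  rewrite /normal_peak (sqr_sqrtr (ltW t0)) (sqr_sqrtr (ltW t20)).
  have p1 : 0 < Num.sqrt (t * pi *+ 2) by rewrite sqrtr_gt0 pmulrn_lgt0// mulr_gt0.
  have p2 : 0 < Num.sqrt (2 * t * pi *+ 2) by rewrite sqrtr_gt0 pmulrn_lgt0// !mulr_gt0.
  rewrite ler_pdivlMr// mulrC ler_pdivrMr//.
  have sqrt4 (x : R) : 2 * Num.sqrt x = Num.sqrt (4 * x).
    by rewrite sqrtrM// (_ : 4 = 2 ^+ 2 :> R) ?sqrtr_sqr ?ger0_norm//; ring.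
  rewrite sqrt4 ler_sqrt; last by rewrite mulr_ge0// ltW// pmulrn_lgt0// mulr_gt0.
  rewrite -subr_ge0 (_ : _ - _ = 4 * (t * pi)); last by ring.
  by rewrite !mulr_ge0// ltW.
have dom (x : R) : a <= `|x| ->
    normal_pdf 0 (Num.sqrt t) x <= c * normal_pdf 0 (Num.sqrt (2 * t)) x.
  move=> ax; rewrite !normal_pdfE// /normal_fun !subr0 (sqr_sqrtr (ltW t0)) (sqr_sqrtr (ltW t20)).
  have a2 : a ^+ 2 <= x ^+ 2.
    by rewrite -[x ^+ 2]real_normK ?num_real// ler_pXn2r ?nnegrE//; lra.
  have e1 : expR (- x ^+ 2 / (t *+ 2)) <=
      expR (- (a ^+ 2 / (4 * t))) * expR (- x ^+ 2 / (2 * t *+ 2)).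
    rewrite -expRD ler_expR -subr_ge0.
    rewrite (_ : _ - _ = (x ^+ 2 - a ^+ 2) / (4 * t)); last by field; lra.
    by rewrite divr_ge0 ?subr_ge0// mulr_ge0// ltW.
  rewrite /c mulrACA; apply: ler_pM => //; exact: normal_peak_ge0.
have mA : measurable [set x : R | a <= `|x|].
  rewrite (_ : [set _ | _] = ~` `]- a, a[%classic); first exact: measurableC.
  apply/seteqP; split => x /=; rewrite in_itv /= -ltr_norml leNgt; first by move=> /negP.
  by move/negP.
have tail : (normal_prob 0 (Num.sqrt t) [set x : R | (a <= `|x|)%R] <= c%:E)%E.
  rewrite /normal_prob.
  apply: (@le_trans _ _ (\int[lebesgue_measure]_(x in [set x : R | (a <= `|x|)%R])
     (c%:E * (normal_pdf 0 (Num.sqrt (2 * t)) x)%:E))%E).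
    apply: ge0_le_integral => //.
    - by move=> x _; rewrite lee_fin normal_pdf_ge0.
    - by apply: measurable_funTS; apply/measurable_EFinP; exact: measurable_normal_pdf.
    - by apply: measurable_funTS; apply/measurable_EFinP; apply: measurable_funM => //;
        exact: measurable_normal_pdf.

  rewrite ge0_integralZl//; [|by apply: measurable_funTS; apply/measurable_EFinP;
    exact: measurable_normal_pdf|by move=> x _; rewrite lee_fin normal_pdf_ge0].
  apply: (@le_trans _ _ (c%:E * normal_prob 0 (Num.sqrt (2 * t)) setT)%E).
    rewrite lee_wpmul2l// ?lee_fin//.
    by apply: (@le_measure _ _ _ (normal_prob 0 (Num.sqrt (2 * t)))); rewrite ?inE.
  by rewrite [X in (_ * X)%E](probability_setT (normal_prob _ _)) mule1.
apply: le_trans tail _; rewrite lee_fin /c expRN.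
have a0 : 0 < a by lra.
(* A bound quadratic in [t] suffices: expR y >= (y/2)^2, and 2 times the inverse of y^2/4 equals 128
   t^2 / a^4. *)
set y := a ^+ 2 / (4 * t); have y0 : 0 < y by rewrite divr_gt0 ?mulr_gt0 ?exprn_gt0.
have ey : y ^+ 2 / 4 <= expR y.
  have -> : y = y / 2 + y / 2 by field.
  rewrite expRD -[y / 2 + _](_ : y = _); last by field.
  have := expR_ge1Dx (y / 2); set z := expR _ => hz.
  rewrite (_ : y ^+ 2 / 4 = (y / 2) * (y / 2)); last by field.
  by apply: ler_pM; lra.
have q0 : 0 < y ^+ 2 / 4 by rewrite divr_gt0// exprn_gt0.
have h1 : (expR y)^-1 <= (y ^+ 2 / 4)^-1 by rewrite lef_pV2 ?posrE ?expR_gt0.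
apply: (@le_trans _ _ (2 * (y ^+ 2 / 4)^-1)); first by rewrite ler_pM2l.
have a4 : 1 <= a ^+ 4 by rewrite exprn_ege1.
have -> : 2 * (y ^+ 2 / 4)^-1 = 128 * t ^+ 2 / a ^+ 4.
  by rewrite /y; field; rewrite !gt_eqF//; lra.
by rewrite ler_pdivrMr ?ler_peMr ?mulr_ge0 ?sqr_ge0//; lra.
Qed.

End gaussian_tail.

Section brownian_estimates.
Context {d} {T : measurableType d} {R : realType}.
Variable P : probability T R.

Lemma fine_probability_le (E F : set T) : measurable E -> measurable F -> E `<=` F ->
  fine (P E) <= fine (P F).
Proof.
by move=> mE mF EF; rewrite fine_le ?fin_num_measure// le_measure ?inE.
Qed.

Lemma fine_probability_setC (E : set T) : measurable E -> fine (P (~` E)) = 1 - fine (P E).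
Proof. by move=> mE; rewrite probability_setC// fineB// fin_num_measure. Qed.

Lemma fine_probability_setU (E F : set T) : measurable E -> measurable F ->
  fine (P (E `|` F)) <= fine (P E) + fine (P F).
Proof.
move=> mE mF; rewrite -fineD ?fin_num_measure// fine_le ?fin_num_measure//.
- exact: measurableU.
- by rewrite fin_numD !fin_num_measure.
- exact: measureU2.
Qed.

Variable B : R -> T -> R.
Hypothesis bB : brownian_motion P B.

Lemma norm_ge_measurable (a : R) : measurable [set x : R | a <= `|x|].
Proof.
rewrite (_ : [set _ | _] = ~` `]- a, a[%classic); first exact: measurableC.
by apply/seteqP; split => x /=; rewrite in_itv /= -ltr_norml leNgt => /negP.
Qed.

Lemma brownian_increment_tail (a s t : R) : 1 <= a -> 0 <= s -> s < t ->
  fine (P [set w | a <= `|B t w - B s w|]) <= 128 * (t - s) ^+ 2.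
Proof.
move=> a1 s0 st; rewrite -lee_fin fineK; last first.
  rewrite fin_num_measure//; have t0 : 0 <= t by exact: ltW (le_lt_trans s0 st).
  have := brownian_increment_measurable bB s0 t0 measurableT (norm_ge_measurable a).
  by rewrite setTI.
have := bm_gauss bB s0 st (norm_ge_measurable a); rewrite /pushforward /preimage /= => ->.
by apply: normal_prob_tail => //; rewrite subr_gt0.
Qed.

Lemma brownian_tail (a t : R) : 1 <= a -> 0 < t ->
  fine (P [set w | a <= `|B t w|]) <= 128 * t ^+ 2.
Proof.
move=> a1 t0; have := brownian_increment_tail a1 (lexx 0) t0; rewrite subr0.
by under eq_set do rewrite (bm_0 bB) subr0.
Qed.

Lemma brownian_set_prob0 (t x : R) : 0 < t -> P [set w | B t w = x] = 0%E.
Proof.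
move=> t0; have := bm_gauss bB (lexx 0) t0 (measurable_set1 x).
rewrite /pushforward /preimage /= /normal_prob integral_set1 => <-.
by congr (P _); apply/seteqP; split => w /=; rewrite (bm_0 bB) subr0.
Qed.

Let cB w : {within `[0, +oo[%classic, continuous (B ^~ w)} :=
  @bm_cont _ _ _ _ _ bB w.

Let mnorm (a t : R) : 0 <= t -> measurable [set w | a <= `|B t w|].
Proof.
move=> t0; exact: (brownian_event_measurable bB t0 (norm_ge_measurable a)).
Qed.

(** No maximal inequality is involved: P(t < tau) is the difference of the probabilities of the
    central arc under the two starting points. Each of them is off its extreme value, 1 or 0, by at
    most P(|B_t| >= pi), hence the constant 2 times 128. *)
Lemma hit_time_tail (t : R) : 0 < t ->
  1 - fine (P [set w | (t%:E < hit_time B w)%E]) <= 256 * t ^+ 2.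
Proof.
move=> t0; have t0' := ltW t0; rewrite -half_wrap_diff_central//.
have mA : measurable (central_arc : set R) by exact: measurable_itv.
have mF c := brownian_event_measurable bB t0' (measurable_half_wrap_set c mA).
have mN := mnorm pi t0'.
have pi1 : 1 <= pi :> R by apply: le_trans (@pi_ge2 R); lra.
have tl := brownian_tail pi1 t0.
have h1 : 1 - fine (P [set w | pi <= `|B t w|]) <=
    fine (P [set w | central_arc (half_wrap 0 (B t w))]).
  rewrite -fine_probability_setC//; apply: fine_probability_le.
  - exact: measurableC.
  - exact: mF.
  - by move=> w /= /negP; rewrite -ltNge; exact: half_wrap_central.
have h2 : fine (P [set w | central_arc (half_wrap pi (B t w))]) <=
    fine (P [set w | pi <= `|B t w|]).
  apply: fine_probability_le => //; first exact: mF.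
  by move=> w /= h; rewrite leNgt; apply/negP => /half_wrap_opposite; exact.
by lra.
Qed.

Lemma hit_time_reached : exists2 v : R, 0 < v &
  fine (P [set w | (v%:E < hit_time B w)%E]) < 1.
Proof.
(* At time 4 pi the Gaussian density is at most 1 / (2 pi sqrt 2), so the interval (-pi, pi), of
   length 2 pi, has probability at most 1 / sqrt 2. *)
have hpi := @pi_gt0 R; pose v : R := 4 * pi; have v0 : 0 < v by rewrite mulr_gt0.
exists v => //; have v0' := ltW v0.
have s0 : Num.sqrt v != 0 by rewrite gt_eqF// sqrtr_gt0.
apply: (@le_lt_trans _ _ (fine (P [set w | `]-pi, pi[%classic (B v w)]))).
  apply: fine_probability_le; first exact: (hit_event_measurable bB v0').
    exact: (brownian_event_measurable bB v0' (measurable_itv `]-pi, pi[)).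
  move=> w /= /(lt_hit_pathP (bm_0 bB w) (@cB w) v0') h.
  by rewrite in_itv /= -ltr_norml; apply: h; rewrite v0' lexx.
have -> : P [set w | `]-pi, pi[%classic (B v w)] =
    normal_prob 0 (Num.sqrt v) `]-pi, pi[%classic.
  have := bm_gauss bB (lexx 0) v0 (measurable_itv `]-pi, pi[); rewrite subr0 => <-.
  by congr (P _); apply/seteqP; split => w /=; rewrite (bm_0 bB) subr0.
have peak : 2 * pi * normal_peak (Num.sqrt v) < 1.
  rewrite /normal_peak sqr_sqrtr// /v.
  have -> : 4 * pi * pi *+ 2 = (2 * pi) ^+ 2 * 2 :> R by ring.
  rewrite sqrtrM ?sqr_ge0// sqrtr_sqr gtr0_norm ?mulr_gt0// invfM mulrA divff ?mul1r; last first.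
    by rewrite gt_eqF// mulr_gt0.
  by rewrite invf_lt1 ?sqrtr_gt0// -[X in X < _]sqrtr1 ltr_sqrt//; lra.
pose I : set R := `]-pi, pi[%classic.
have mI : measurable I by exact: measurable_itv.
have ub : (normal_prob 0 (Num.sqrt v) I
    <= (2 * pi * normal_peak (Num.sqrt v))%:E)%E.
  rewrite /normal_prob; apply: (@le_trans _ _ (\int[lebesgue_measure]_(x in I)
     (normal_peak (Num.sqrt v))%:E)%E).
    apply: ge0_le_integral => //.
    - by move=> x _; rewrite lee_fin normal_pdf_ge0.
    - by apply: measurable_funTS; apply/measurable_EFinP; exact: measurable_normal_pdf.
    - by move=> x _; rewrite lee_fin normal_pdf_ub.
  rewrite integral_cst//= /I lebesgue_measure_itv/= lte_fin ifT; last by lra.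
  by rewrite -EFinB -EFinM lee_fin mulrC opprK (_ : pi + pi = 2 * pi)//; ring.
apply: le_lt_trans peak; rewrite -lee_fin fineK//.
by rewrite fin_num_measure.
Qed.

End brownian_estimates.

(** * Failure of co-adaptedness *)

Section conditional_laws.
Context {d} {T : measurableType d} {R : realType}.
Variable P : probability T R.

(* The factor 1/2 makes the exceptional set [{Z2 <= beta / 2}] null without a
   limit. *)
Lemma cond_law_lower_bound (X : T -> R) (G H : set_system T) (A : set R) (K : set T)
    (beta : R) :
  measurable_fun setT X -> measurable A ->
  G `<=` measurable -> H `<=` measurable -> setI_closed H -> H K -> 0 < beta ->
  cond_law_eq P X G H ->
  (forall D, H D -> D `<=` K -> (beta%:E * P D <= P ((X @^-1` A) `&` D))%E) ->
  forall D, G D -> D `<=` K -> ((beta / 2)%:E * P D <= P ((X @^-1` A) `&` D))%E.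
Proof.
move=> mX mA GM HM HI HK b0 /(_ A mA)[Z1 [Z2 [[_ iZ1 vZ1] [sZ2 iZ2 vZ2] Z12]]] hH D GD DK.
have [N1 [mN1 PN1 hN1]] := Z12.
pose N2 := K `&` [set w | Z2 w <= beta / 2].
have HN2 : H N2.
  apply: HI => //; apply: sZ2; apply/sigma_rvE.
  exists `]-oo, beta / 2]%classic; first exact: measurable_itv.
  by apply/seteqP; split => w /=; rewrite in_itv.
have mN2 := HM _ HN2; have mD := GM _ GD.
have icst (D' : set T) c : measurable D' -> P.-integrable D' (cst c%:E).
  by move=> mD'; apply: finite_measure_integrable_cst.
(* Integrating [Z2] over [N2] gives beta P(N2) <= (beta / 2) P(N2). *)
have PN2 : P N2 = 0%E.
  have h1 := hH N2 HN2 (fun w h => h.1).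
  have h2 : (P ((X @^-1` A) `&` N2) <= (beta / 2)%:E * P N2)%E.
    rewrite -vZ2// -(integral_cst P mN2); apply: le_integral => //.
    - exact: (integrableS measurableT).
    - exact: icst.
    - by move=> w /set_mem[_ /= h]; rewrite lee_fin.
  have := le_trans h1 h2; have fN := fin_num_measure P N2 mN2.
  rewrite -(fineK fN) -!EFinM !lee_fin => h; congr (_%:E).
  have := fine_ge0 (measure_ge0 P N2); nra.
pose N := N1 `|` N2; have mN : measurable N by exact: measurableU.
have PN : P N = 0%E by apply: null_set_setU.
(* The bound passes to the larger family of events here: off the null set, [Z1] equals [Z2] and
   hence exceeds beta / 2 on [D]. *)
rewrite -vZ1// (negligible_integral mN)//; last exact: (integrableS measurableT).
have mDN : measurable (D `\` N) by exact: measurableD.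
have -> : P D = P (D `\` N).
  have PDN : P (D `&` N) = 0%E.
    by apply: (subset_measure0 (measurableI _ _ mD mN) mN _ PN); exact: subIsetr.
  by apply: etrans (measureDI P mD mN) _; apply: etrans (congr1 _ PDN) (adde0 _).
rewrite -(integral_cst P mDN); apply: le_integral => //.
- exact: icst.
- exact: (integrableS measurableT).
- move=> w /set_mem[Dw nN]; rewrite lee_fin.
  have e : Z1 w = Z2 w by apply: contrapT => h; apply: nN; left; apply: hN1.
  by rewrite e leNgt; apply/negP => h; apply: nN; right; split; [exact: DK|exact: ltW].
Qed.

End conditional_laws.

Section increments.
Context {d} {T : measurableType d} {R : realType}.
Variable P : probability T R.

(** The times 0, s, t, t, ...; as the processes vanish at 0, the first increment is the value at
    [s]. *)
Let three_times (s t : R) (j : nat) : R :=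
  if j is j'.+1 then (if j' is _.+1 then t else s) else 0.

Let three_times_mono (s t : R) : 0 <= s -> s <= t ->
  {homo three_times s t : i j / (i <= j)%N >-> i <= j}.
Proof. by move=> s0 st [|[|i]] [|[|j]] //= _; exact: le_trans st. Qed.

Lemma brownian_increment_independent (B : R -> T -> R) (s t : R) C V :
  brownian_motion P B -> 0 <= s -> s <= t -> measurable C -> measurable V ->
  P ([set w | C (B s w)] `&` [set w | V (B t w - B s w)]) =
  (P [set w | C (B s w)] * P [set w | V (B t w - B s w)%R])%E.
Proof.
move=> bB s0 st mC mV.
pose A (j : nat) := if j == 0%N then [set w | C (B s w)] else [set w | V (B t w - B s w)].
have := bm_indep bB (u := three_times s t) (lexx 0) (three_times_mono s0 st).
move=> /(_ [:: 0%N; 1%N] A isT); rewrite bigcap_seq_eqType !big_cons !big_nil setIT mule1; apply.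
move=> j; rewrite !inE => /orP[/eqP ->|/eqP ->]; apply/sigma_rvE.
  by exists C => //; apply/seteqP; split => w /=; rewrite (bm_0 bB) subr0.
by exists V.
Qed.

Lemma poisson_increment_independent rate (N : R -> T -> nat) (s t : R) C V :
  poisson_process P rate N -> 0 <= s -> s <= t ->
  P ([set w | C (N s w)] `&` [set w | V (N t w - N s w)%N]) =
  (P [set w | C (N s w)] * P [set w | V (N t w - N s w)%N])%E.
Proof.
move=> pN s0 st.
pose A (j : nat) := if j == 0%N then [set w | C (N s w)] else [set w | V (N t w - N s w)%N].
have := pp_indep pN (u := three_times s t) (lexx 0) (three_times_mono s0 st).
move=> /(_ [:: 0%N; 1%N] A isT); rewrite bigcap_seq_eqType !big_cons !big_nil setIT mule1; apply.
move=> j; rewrite !inE => /orP[/eqP ->|/eqP ->]; apply/sigma_rvE.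
  by exists C => //; apply/seteqP; split => w /=; rewrite (pp_0 pN) subn0.
by exists V.
Qed.

End increments.

Section one_jump.
Context {d} {T : measurableType d} {R : realType}.
Variable P : probability T R.
Variables (lam : R) (B : R -> T -> R) (M : R -> T -> nat).
Hypothesis bB : brownian_motion P B.
Hypothesis pM : poisson_process P lam M.
Hypothesis indBM : independent2 P (sigma_process B) (sigma_process M).

Let X := jumpy_path (fun=> 0) B M.

Let XE t w : X t w = if odd (M t w) then half_wrap pi (B t w) else half_wrap 0 (B t w).
Proof. by rewrite /X /jumpy_path half_wrap_jumps add0r. Qed.

Let sBt (t : R) C : 0 <= t -> measurable C -> sigma_process B [set w | C (B t w)].
Proof.
by move=> t0 mC; apply: sub_sigma_algebra; exists t => //; apply/sigma_rvE; exists C.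
Qed.

Let sMt (t : R) (C : set nat) : 0 <= t -> sigma_process M [set w | C (M t w)].
Proof. by move=> t0; apply: sub_sigma_algebra; exists t => //; apply/sigma_rvE; exists C. Qed.

Lemma jumpy_path_measurable (t : R) : 0 <= t -> measurable_fun setT (X t).
Proof.
move=> t0 _ A mA; rewrite setTI.
have mB c : measurable [set w | A (half_wrap c (B t w))].
  exact: (brownian_event_measurable bB t0 (measurable_half_wrap_set c mA)).
have mM (D : set nat) : measurable [set w | D (M t w)].
  by rewrite -[X in measurable X]setTI; apply: (pp_meas pM t0).
rewrite (_ : _ @^-1` _ = ([set w | A (half_wrap pi (B t w))] `&` [set w | [set n | odd n] (M t w)])
  `|` ([set w | A (half_wrap 0 (B t w))] `&` [set w | [set n | ~~ odd n] (M t w)])).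
  by apply: measurableU; apply: measurableI.
apply/seteqP; split => w /=; rewrite XE; first by case: ifP => o h; [left|right].
by move=> [[h ->]|[h /negbTE ->]].
Qed.

Lemma one_jump_sigma (s t : R) : 0 <= s -> s <= t ->
  sigma_process M [set w | (M t w - M s w)%N = 1%N].
Proof.
move=> s0 st; have t0 : 0 <= t by exact: le_trans st.
rewrite (_ : [set w | _] =
  \bigcup_p ([set w | [set p] (M s w)] `&` [set w | [set (p + 1)%N] (M t w)])).
  by apply: g_sigma_bigcup => p; apply: g_sigma_setI; exact: sMt.
apply/seteqP; split => w; rewrite /=.
  move=> h; exists (M s w) => //; split => //=.
  by rewrite -h subnKC// (pp_mono pM).
by move=> [p _ [/= -> ->]]; rewrite addKn.
Qed.

Definition one_jump_prob (s t : R) : \bar R :=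
  (P [set w | (M t w - M s w = 1)%N] * P [set w | (`|B t w - B s w| < pi / 2)%R])%E.

(** After exactly one jump, X_t is the antipode of X_s moved by half the Brownian increment. The two
    displacements are at most pi/4 and less than pi/4, so X_t is off the central arc. Splitting
    according to the value of M_s separates the past from the increments. *)
Lemma one_jump_lower_bound (s t : R) (C : set R) : 0 <= s -> s <= t -> measurable C ->
  C `<=` [set x | `|x| <= pi / 4] ->
  (one_jump_prob s t * P [set w | C (X s w)] <=
   P (X t @^-1` (~` central_arc) `&` [set w | C (X s w)]))%E.
Proof.
move=> s0 st mC Cpi; have t0 : 0 <= t by exact: le_trans st.
have hpi := @pi_gt0 R.
pose U := [set w | [set 1%N] (M t w - M s w)%N].
pose V := [set w | [set x : R | `|x| < pi / 2] (B t w - B s w)].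
have mV0 : measurable [set x : R | `|x| < pi / 2].
  rewrite (_ : [set _ | _] = `]- (pi / 2), pi / 2[%classic)//.
  by apply/seteqP; split => x /=; rewrite in_itv /= ltr_norml.
pose Cn n : set R := [set x | C (half_wrap (if odd n then pi else 0) x)].
have mCn n : measurable (Cn n) by exact: measurable_half_wrap_set.
pose D n := [set w | Cn n (B s w)] `&` [set w | [set n] (M s w)].
have DE : [set w | C (X s w)] = \bigcup_n D n.
  apply/seteqP; split => w /=; rewrite XE.
    by move=> h; exists (M s w) => //; split => //; rewrite /Cn /=; case: (odd _) h.
  by move=> [n _ [+ /= e]]; rewrite /Cn /= -e; case: (odd _).
have tD : trivIset setT D by move=> i j _ _ [w [[_ /= <-] [_ /= <-]]].
have mBs n : measurable [set w | Cn n (B s w)] by exact: (brownian_event_measurable bB s0 (mCn n)).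
have mMs n : measurable [set w | [set n] (M s w)].
  by rewrite -[X in measurable X]setTI; apply: (pp_meas pM s0).
have mD n : measurable (D n) by exact: measurableI.
have sV : sigma_process B V.
  have mB r : 0 <= r -> measurable_fun setT (B r : g_sigma_algebraType
      (\bigcup_(t in [set t : R | 0 <= t]) sigma_rv (B t)) -> R).
    by move=> r0 _ A mA; rewrite setTI; exact: sBt.
  have := measurable_funB (mB t t0) (mB s s0) measurableT mV0.
  by rewrite setTI.
have sU : sigma_process M U := one_jump_sigma s0 st.
have sBM : sigma_process B `<=` measurable.
  by apply: sigma_family_measurable => r r0; exact: (bm_meas bB).
have sMM : sigma_process M `<=` measurable.
  by apply: sigma_family_measurable => r r0; exact: (pp_meas pM).
have mU := sMM _ sU; have mV := sBM _ sV.
have PD n : P (D n `&` (U `&` V)) = (P (D n) * (P U * P V))%E.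
  rewrite /D [U `&` V]setIC setIACA.
  have h1 : sigma_process B ([set w | Cn n (B s w)] `&` V).
    by apply: g_sigma_setI => //; exact: sBt.
  have h2 : sigma_process M ([set w | [set n] (M s w)] `&` U).
    by apply: g_sigma_setI => //; exact: sMt.
  rewrite (indBM h1 h2) (indBM (sBt s0 (mCn n)) (sMt [set n] s0)).
  rewrite (brownian_increment_independent bB s0 st (mCn n) mV0).
  rewrite (poisson_increment_independent [set n] [set 1%N] pM s0 st).
  by rewrite muleACA [(P V * P U)%E]muleC.
have mDU : measurable [set w | C (X s w)] by rewrite DE; exact: bigcupT_measurable.
have eq : P ([set w | C (X s w)] `&` (U `&` V)) = (one_jump_prob s t * P [set w | C (X s w)])%E.
  rewrite DE setI_bigcupl.
  have f : P (\bigcup_n (D n `&` (U `&` V))) = (\sum_(0 <= n <oo) P (D n `&` (U `&` V)))%E.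
    apply: measure_semi_bigcup.
    - by move=> n; apply: measurableI => //; exact: measurableI.
    - by move=> i j _ _ [w [[Di _] [Dj _]]]; apply: tD => //; exists w.
    - by apply: bigcupT_measurable => n; apply: measurableI => //; exact: measurableI.
  have g : P (\bigcup_n D n) = (\sum_(0 <= n <oo) P (D n))%E.
    by apply: measure_semi_bigcup => //; exact: bigcupT_measurable.
  rewrite f g; have fUV : (P U * P V)%E \is a fin_num by rewrite fin_numM ?fin_num_measure.
  rewrite -[one_jump_prob s t]/(P U * P V)%E -(fineK fUV) -nneseriesZl//.
  by apply: eq_eseriesr => n _; rewrite PD fineK// muleC.
rewrite -eq; apply: le_measure; rewrite ?inE.
- by apply: measurableI => //; exact: measurableI.
- apply: measurableI => //; have := jumpy_path_measurable t0 measurableT.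
  move=> /(_ (~` central_arc)); rewrite setTI; apply; apply: measurableC; exact: measurable_itv.
move=> w [/= h [Uw Vw]]; split => //.
have := Cpi _ h; rewrite /= => Xs; rewrite /U /= in Uw; rewrite /V /= in Vw.
rewrite /preimage /=; have -> : X t w = half_wrap pi (2 * X s w + (B t w - B s w)).
  rewrite /X /jumpy_path !add0r.
  have -> : M t w = (M s w + 1)%N by rewrite -Uw subnKC// (pp_mono pM).
  have [z ez] := wrapP (B s w / 2 + pi * (M s w)%:R).
  by rewrite ez /half_wrap; apply/wrap_eqP; exists z; rewrite natrD; field.
apply: half_wrap_opposite; apply: le_lt_trans (ler_normD _ _) _.
by rewrite normrM (ger0_norm (ler0n _ 2)); lra.
Qed.

End one_jump.

Section poisson_small_time.
Context {d} {T : measurableType d} {R : realType}.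
Variable P : probability T R.

Lemma poisson_no_jump (rate : R) (N : R -> T -> nat) (t : R) :
  0 <= rate -> 0 <= t -> poisson_process P rate N ->
  P [set w | N t w = 0%N] = (expR (- (rate * t)))%:E.
Proof.
move=> r0 t0 pN; have := pp_law pN (lexx 0) t0 [set 0%N].
rewrite subr0 (_ : pushforward _ _ _ = P [set w | N t w = 0%N]); last first.
  by congr (P _); apply/seteqP; split => w /=; rewrite (pp_0 pN) subn0.
move=> ->; have : 0 <= rate * t by exact: mulr_ge0.
rewrite le_eqVlt => /orP[/eqP <-|mu0].
  by rewrite /poisson_prob ltxx diracE mem_set// oppr0 expR0.
by rewrite poisson_probE// /poisson_pmf mu0 expr0 fact0 invr1 !mul1r.
Qed.

Lemma poisson_one_jump (rate : R) (N : R -> T -> nat) (s t : R) :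
  0 < rate -> 0 <= s -> s < t -> poisson_process P rate N -> rate * (t - s) <= 2^-1 ->
  rate * (t - s) / 2 <= fine (P [set w | (N t w - N s w)%N = 1%N]).
Proof.
move=> r0 s0 st pN small; have mu0 : 0 < rate * (t - s) by rewrite mulr_gt0// subr_gt0.
have := pp_law pN s0 (ltW st) [set 1%N]; rewrite /pushforward /preimage /= => ->.
rewrite poisson_probE//= /poisson_pmf mu0 expr1 (_ : 1`! = 1%N)// invr1 mulr1.
rewrite ler_pM2l//; have := expR_ge1Dx (- (rate * (t - s))); lra.
Qed.

End poisson_small_time.

Section not_co_adapted.
Context {d} {T : measurableType d} {R : realType}.
Variable P : probability T R.
Variables (lam : R) (B : R -> T -> R) (N : R -> T -> nat) (Y : nat -> T -> bool).
Hypothesis lam_gt0 : 0 < lam.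
Hypothesis cd : construction_data P lam B N Y.

Let lam_ge0 : 0 <= lam := ltW lam_gt0.
Let X := constructed_X B N Y.
Let Xh := constructed_Xh B N Y.
Let tau := hit_time B.
Let J := incident_time N 0.
Let bB : brownian_motion P B := cd_bm cd.
Let pN : poisson_process P (2 * lam) N := cd_poisson cd.
Let cB w : {within `[0, +oo[%classic, continuous (B ^~ w)} :=
  @bm_cont _ _ _ _ _ bB w.

Let hits_first := [set w | (tau w < J w)%E].

Let hits_first_measurable : measurable hits_first.
Proof.
apply: (g_sigma_measurable _ (lt_hit_incident_sigma cd)) => _ [A [C [sA sC ->]]].
apply: measurableI.
  by apply: (sigma_family_measurable _ sA) => t t0; exact: (bm_meas bB).
by apply: (sigma_family_measurable _ sC) => t t0; exact: (pp_meas pN).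
Qed.

Lemma hits_first_gt0 : 0 < fine (P hits_first).
Proof.
have [v v0 hv] := hit_time_reached bB; have v0' := ltW v0.
have mh := hit_event_measurable bB v0'.
have sYT : sigma_family setT Y setT by exact: g_sigma_setT.
have sh : sigma_process B (~` [set w | (v%:E < tau w)%E]).
  apply: g_sigma_setC; rewrite /tau (lt_tauE bB v0').
  by apply: path_sigma_process; exact: path_sigma_stays_below.
have sN : sigma_process N [set w | N v w = 0%N].
  apply: sub_sigma_algebra; exists v => //.
  exact: (@sigma_rv_preimage _ _ _ _ (N v) [set 0%N]).
have mN : measurable [set w | N v w = 0%N].
  by apply: (sigma_family_measurable _ sN) => r r0; exact: (pp_meas pN).
have e := independent3_pair sYT (cd_indep cd) sh sN.
apply: (@lt_le_trans _ _ (fine (P (~` [set w | (v%:E < tau w)%E] `&` [set w | N v w = 0%N])))).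
  have l20 : 0 <= 2 * lam by rewrite mulr_ge0.
  rewrite e fineM ?fin_num_measure//; last exact: measurableC.
  rewrite (poisson_no_jump l20 v0' pN) fine_probability_setC// mulr_gt0 ?expR_gt0//.
  by rewrite subr_gt0.
apply: fine_probability_le => //; first by apply: measurableI => //; exact: measurableC.
move=> w [/= /negP h /(lt_incident_time0 w pN v0')]; apply: le_lt_trans.
by rewrite leNgt.
Qed.

(* The filtration sees the positions of both processes, hence, off a null set,
   whether they are mirror images of each other, that is, whether tau < J_1. *)
Definition mirrored (s : R) : set T :=
  [set w | [/\ `|X s w| <= pi / 4, X s w != 0 & Xh s w = Defs.wrap (pi - X s w)]].

(** The two conditions on X_s exclude the ambiguous positions. Processes that have met are mirror
    images only at the fixed points pi/2 and -pi/2 of the reflection, excluded by |X_s| <= pi/4.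
    Antipodal processes with |X_s| < pi/2 are mirror images only for X_s = 0. *)
Lemma mirrored_hits_first (s : R) w : 0 <= s -> mirrored s w ->
  (s%:E < tau w)%E /\ (tau w < J w)%E.
Proof.
move=> s0 [Xs Xs0 Xhs]; have hp := @pi_gt0 R.
have Xw : Defs.wrap (X s w) = X s w by apply: wrap_id; exact: wrap_itv.
have sT : (s%:E < Order.min (J w) (tau w))%E.
  rewrite ltNge; apply/negP => /(constructed_meet cd s0) e.
  have /wrap_eqP[z ez] : Defs.wrap (X s w) = Defs.wrap (pi - X s w).
    by rewrite Xw -Xhs; exact: e.
  have hz := @odd_int_norm_ge1 R z; rewrite rmorphD rmorphM/= rmorph1 in hz.
  have {}ez : 2 * X s w = pi * (2 * z%:~R + 1) by lra.
  have : `|2 * X s w| <= pi / 2.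
    rewrite normrM (ger0_norm (ler0n _ 2)) mulrC -ler_pdivlMr//.
    by apply: le_trans Xs _; lra.
  rewrite ez normrM gtr0_norm// => h.
  by move: hz; rewrite -(ler_pM2l hp) mulr1 => h'; lra.
move: sT; rewrite lt_min => /andP[sJ st]; split => //.
rewrite ltNge; apply/negP => Jt; have nJt : (tau w < J w)%E = false by rewrite ltNge Jt.
have Ns : N s w = 0%N by exact/(lt_incident_time0 w pN s0).
have Bs : `|B s w| < pi.
  by have /(lt_hit_pathP (bm_0 bB w) (@cB w) s0) := st; apply; rewrite s0 lexx.
move: Xhs Xs0; have -> : X s w = B s w / 2.
  rewrite /X /constructed_X /jumpy_path /marked_count Ns big_ord0 mulr0 addr0 add0r wrap_id//.
  by move: Bs; rewrite ltr_norml => /andP[? ?]; apply/andP; split; lra.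
rewrite /Xh /constructed_Xh /jumpy_path /marked_count Ns big_ord0 mulr0 addr0.
rewrite /constructed_Bh /= nJt => /wrap_eqP[z ez].
have {}ez : B s w = 2 * pi * z%:~R by lra.
have z0 : z = 0 by apply: (@int_small R); rewrite -ez; lra.
by rewrite ez z0 mulr0 mul0r eqxx.
Qed.

Lemma mirrored_escape (s t : R) : 0 <= s -> s <= t ->
  mirrored s `&` X t @^-1` (~` central_arc) `<=` ~` [set w | (t%:E < tau w)%E].
Proof.
move=> s0 st w [/(mirrored_hits_first s0)[_ tJ] Xt] /= tt; apply: Xt.
have t0 : 0 <= t by exact: le_trans st.
have Nt : N t w = 0%N by apply/(lt_incident_time0 w pN t0); exact: lt_trans tJ.
have Bt : `|B t w| < pi.
  by have /(lt_hit_pathP (bm_0 bB w) (@cB w) t0) := tt; apply; rewrite t0 lexx.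
rewrite /X /constructed_X /jumpy_path /marked_count Nt big_ord0 mulr0 addr0.
exact: half_wrap_central.
Qed.

(** Conversely, [mirrored s] exhausts tau < J_1 up to events of probability O(s^2) and a null set,
    so its probability stays bounded below as [s] tends to 0. *)
Lemma sub_mirrored (s : R) : 0 <= s ->
  hits_first `&` [set w | (s%:E < tau w)%E] `\` [set w | pi / 2 <= `|B s w|] `\`
    [set w | B s w = 0] `<=` mirrored s.
Proof.
move=> s0 w [[[/= tJ st] /negP]]; rewrite -ltNge => Bs /eqP Bs0.
have hp := @pi_gt0 R.
have Ns : N s w = 0%N by apply/(lt_incident_time0 w pN s0); exact: lt_trans tJ.
have eX : X s w = B s w / 2.
  rewrite /X /constructed_X /jumpy_path /marked_count Ns big_ord0 mulr0 addr0 add0r wrap_id//.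
  by move: Bs; rewrite ltr_norml => /andP[? ?]; apply/andP; split; lra.
split.
- by rewrite eX normrM (@ger0_norm _ 2^-1)// ; lra.
- by rewrite eX mulf_neq0// invr_eq0.
rewrite eX /Xh /constructed_Xh /jumpy_path /marked_count Ns big_ord0 mulr0 addr0.
by rewrite /constructed_Bh tJ (ltW st) mulNr.
Qed.

Let sX (t : R) : 0 <= t -> measurable_fun setT (X t).
Proof.
move=> t0; have [pM _] := construction_thinned lam_ge0 cd.
exact: (jumpy_path_measurable bB pM t0).
Qed.

Lemma mirrored_filtration (F : R -> set_system T) (s : R) : 0 <= s ->
  filtration F -> adapted F X -> adapted F Xh -> F s (mirrored s).
Proof.
move=> s0 [Fs _ _] FX FXh; have sF := Fs s s0.
pose U := g_sigma_algebraType (F s).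
have mX : measurable_fun setT (X s : U -> R).
  move=> _ A mA; rewrite setTI; apply: sub_sigma_algebra; apply: (FX _ s0).
  exact: sigma_rv_preimage.
have mXh : measurable_fun setT (Xh s : U -> R).
  move=> _ A mA; rewrite setTI; apply: sub_sigma_algebra; apply: (FXh _ s0).
  exact: sigma_rv_preimage.
have mD : measurable_fun setT ((fun w => Xh s w - Defs.wrap (pi - X s w)) : U -> R).
  apply: measurable_funB => //; apply: (measurableT_comp measurable_wrap).
  exact: measurable_funB.
have mC : measurable [set x : R | `|x| <= pi / 4].
  rewrite (_ : [set _ | _] = `[- (pi / 4), pi / 4]%classic)//.
  by apply/seteqP; split => x /=; rewrite in_itv /= ler_norml.
suff : measurable (mirrored s : set U) by rewrite -[in X in _ -> X](sigma_algebra_g_sigma sF).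
rewrite (_ : mirrored s = X s @^-1` [set x : R | `|x| <= pi / 4] `&` X s @^-1` (~` [set 0])
  `&` (fun w => Xh s w - Defs.wrap (pi - X s w)) @^-1` [set 0]).
  apply: measurableI; first apply: measurableI.
  - by rewrite -[X in measurable X]setTI; exact: mX.
  - by rewrite -[X in measurable X]setTI; apply: mX => //; apply: measurableC.
  - by rewrite -[X in measurable X]setTI; exact: mD.
apply/seteqP; split => w /=.
  by move=> [-> /eqP ? ->]; rewrite subrr.
by move=> [[? /eqP ?] /eqP]; rewrite subr_eq0 => /eqP ?; split.
Qed.

Lemma constructed_not_co_adapted : ~ co_adapted P X Xh.
Proof.
move=> [F [filF FX FXh cl]].
pose c := fine (P hits_first); have c0 : 0 < c := hits_first_gt0.
(* The four bounds serve in turn to get 128 s^2 <= 1/2, to get lam s <= 1/2 for [poisson_one_jump],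
   to keep the probability of [mirrored s] at least c/2, and to contradict the final inequality lam
   c <= 64 * 256 s. *)
pose s := Num.min (Num.min 16^-1 (2 * lam)^-1) (Num.min (c / (3 * 256)) (lam * c / (128 * 256))).
have s0 : 0 < s by rewrite !lt_min !invr_gt0 ltr0n !divr_gt0 ?mulr_gt0.
have [s1 s2 s3 s4] :
    [/\ s <= 16^-1, s <= (2 * lam)^-1, s <= c / (3 * 256) & s <= lam * c / (128 * 256)].
  by have := lexx s; rewrite {2}/s !le_min => /andP[/andP[-> ->] /andP[-> ->]].
have {}s2 : lam * s <= 2^-1.
  have : s * (2 * lam) <= 1 by rewrite -ler_pdivlMr ?mulr_gt0// div1r.
  by move=> ?; lra.
pose t := 2 * s; have st : s < t by rewrite /t; lra.
have t0 : 0 < t by rewrite /t; lra.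
have s0' := ltW s0; have t0' := ltW t0; have st' := ltW st.
have ts : t - s = s by rewrite /t; lra.
have [_ mF _] := filF.
have FG := mirrored_filtration s0' filF FX FXh.
have mG := mF _ s0' _ FG.
have [pM iBM] := construction_thinned lam_ge0 cd.
have pi2 := pihalf_ge1 R.
have mV : measurable [set w | pi / 2 <= `|B t w - B s w|].
  have := brownian_increment_measurable bB s0' t0' measurableT (norm_ge_measurable (pi / 2)).
  by rewrite setTI.
have mU : measurable [set w | (marked_count N Y t w - marked_count N Y s w)%N = 1%N].
  apply: (sigma_family_measurable _ (one_jump_sigma pM s0' st')) => r r0; exact: (pp_meas pM).
have mV' : ~` [set w | pi / 2 <= `|B t w - B s w|] = [set w | `|B t w - B s w| < pi / 2].
  by apply/seteqP; split => w /=; rewrite leNgt; [move/negP/negPn|move=> h; apply/negP/negPn].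
pose beta := fine (one_jump_prob P B (marked_count N Y) s t).
have fb : one_jump_prob P B (marked_count N Y) s t = beta%:E.
  by rewrite fineK// /one_jump_prob -mV' fin_numM// fin_num_measure//; exact: measurableC.
have b_ge : lam * s / 4 <= beta.
  have j1 := poisson_one_jump lam_gt0 s0' st pM; rewrite ts in j1; have {}j1 := j1 s2.
  have j2 := brownian_increment_tail bB pi2 s0' st; rewrite ts in j2.
  have j3 : 1 - 128 * s ^+ 2 <= fine (P (~` [set w | pi / 2 <= `|B t w - B s w|])).
    by rewrite fine_probability_setC//; lra.
  rewrite /beta /one_jump_prob -mV' fineM ?fin_num_measure//; last exact: measurableC.
  have h : 2^-1 <= 1 - 128 * s ^+ 2 by nra.
  rewrite (_ : lam * s / 4 = lam * s / 2 * 2^-1); last by field.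
  apply: ler_pM => //; [|exact: le_trans j3].
  by rewrite divr_ge0// mulr_ge0.
have mC : measurable [set x : R | `|x| <= pi / 4].
  rewrite (_ : [set _ | _] = `[- (pi / 4), pi / 4]%classic)//.
  by apply/seteqP; split => x /=; rewrite in_itv /= ler_norml.
have b0 : 0 < beta by apply: lt_le_trans b_ge; rewrite divr_gt0// mulr_gt0.
have mA : measurable (~` central_arc : set R) by apply: measurableC; exact: measurable_itv.
(* Co-adaptedness enters here: the lower bound valid given X_s alone is imposed, up to a factor 1/2,
   on [mirrored s], an event of [F s]. *)
have lower : ((beta / 2)%:E * P (mirrored s) <= P (X t @^-1` (~` central_arc) `&` mirrored s))%E.
  apply: (@cond_law_lower_bound _ _ _ P (X t) (F s) (sigma_rv (X s)) (~` central_arc)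
    (X s @^-1` [set x : R | `|x| <= pi / 4]) beta (sX t0') mA (mF _ s0')) => //.
  - exact: sigma_rv_measurable (sX s0').
  - exact: sigma_rvI.
  - exact: sigma_rv_preimage.
  - by have [] := cl s t s0' st'.
  - move=> D /sigma_rvE[C mCC ->] CK; rewrite -fb.
    have -> : X s @^-1` C = [set w | (C `&` [set x : R | `|x| <= pi / 4]) (X s w)].
      by apply/seteqP; split => w /= => [h|[]//]; split => //; exact: CK.
    apply: (one_jump_lower_bound bB pM iBM s0' st'); first exact: measurableI.
    by move=> x [].
  - by move=> w [].
have upper : fine (P (X t @^-1` (~` central_arc) `&` mirrored s)) <= 256 * t ^+ 2.
  apply: le_trans (hit_time_tail bB t0).
  have mh := hit_event_measurable bB t0'.
  rewrite -fine_probability_setC//; apply: fine_probability_le.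
  - by apply: measurableI => //; rewrite -[X in measurable X]setTI; exact: sX.
  - exact: measurableC.
  - by rewrite setIC; exact: mirrored_escape.
have large : c <= fine (P (mirrored s)) + 256 * s ^+ 2 + 128 * s ^+ 2.
  have mh := hit_event_measurable bB s0'.
  have mn : measurable [set w | pi / 2 <= `|B s w|].
    exact: (brownian_event_measurable bB s0' (norm_ge_measurable (pi / 2))).
  have mz : measurable [set w | B s w = 0].
    exact: (brownian_event_measurable bB s0' (measurable_set1 0)).
  have k1 := hit_time_tail bB s0; have k2 := brownian_tail bB pi2 s0.
  have k3 := brownian_set_prob0 bB 0 s0.
  rewrite -fine_probability_setC// in k1.
  pose E1 := mirrored s `|` ~` [set w | (s%:E < hit_time B w)%E].
  pose E2 := E1 `|` [set w | pi / 2 <= `|B s w|].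
  have m1 : measurable E1 by apply: measurableU => //; exact: measurableC.
  have m2 : measurable E2 by exact: measurableU.
  have l1 := fine_probability_setU P mG (measurableC mh).
  have l2 := fine_probability_setU P m1 mn.
  have l3 := fine_probability_setU P m2 mz.
  rewrite k3 in l3.
  have : c <= fine (P (E2 `|` [set w | B s w = 0])).
    apply: fine_probability_le => //; first exact: measurableU.
    move=> w hw; apply: contrapT => /not_orP[/not_orP[/not_orP[nG hit] nn] nz]; apply: nG.
    by apply: (sub_mirrored s0'); split => //; split => //; split => //; exact: contrapT.
  by move: l1 l2 l3; rewrite -/E1 -/E2 /= => *; lra.
have mXG : measurable (X t @^-1` (~` central_arc) `&` mirrored s).
  by apply: measurableI => //; rewrite -[X in measurable X]setTI; exact: sX.
have {}lower : beta / 2 * fine (P (mirrored s)) <= 256 * t ^+ 2.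
  apply: le_trans upper; rewrite -lee_fin EFinM !fineK//; exact: fin_num_measure.
have G_ge : c / 2 <= fine (P (mirrored s)) by nra.
have : lam * s / 8 * (c / 2) <= (4 * 256) * s ^+ 2.
  apply: (@le_trans _ _ (beta / 2 * fine (P (mirrored s)))).
    by apply: ler_pM => //; try lra; rewrite divr_ge0// mulr_ge0// ltW.
  by apply: le_trans lower _; rewrite /t; lra.
have : lam * c <= (64 * 256) * s -> False by nra.
move=> h1 h2; apply: h1; rewrite -(ler_pM2l s0); lra.
Qed.

End not_co_adapted.

Theorem mainTheorem3 (R : realType) (lam : R) (lam_ge0 : 0 <= lam) :
  (forall (d1 d2 d3 : measure_display)
      (T1 : measurableType d1) (P1 : probability T1 R) (X : R -> T1 -> R)
      (T2 : measurableType d2) (P2 : probability T2 R) (Xh : R -> T2 -> R)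
      (T3 : measurableType d3) (P3 : probability T3 R) (B : R -> T3 -> R)
      (J : T3 -> \bar R),
    jumpy_brownian_motion P1 lam X -> (forall w, X 0 w = 0) ->
    jumpy_brownian_motion P2 lam Xh -> (forall w, Xh 0 w = pi) ->
    brownian_motion P3 B ->
    exponential_rv P3 (2 * lam) J ->
    independent2 P3 (sigma_rv J) (sigma_rv (hit_time B)) ->
    forall t : R, 0 <= t ->
      tv_dist (pushforward P1 (X t)) (pushforward P2 (Xh t))
        = ((expR (- (2 * lam * t)))%:E * P3 [set w | (t%:E < hit_time B w)%E])%E
      /\ ((expR (- (2 * lam * t)))%:E * P3 [set w | (t%:E < hit_time B w)%E])%E
        = P3 [set w | (t%:E < Order.min (J w) (hit_time B w))%E])
  /\
  (forall (d : measure_display) (T : measurableType d) (P : probability T R)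
      (B : R -> T -> R) (N : R -> T -> nat) (Y : nat -> T -> bool),
    construction_data P lam B N Y ->
    let X := constructed_X B N Y in
    let Xh := constructed_Xh B N Y in
    let Tstar := fun w => Order.min (incident_time N 0 w) (hit_time B w) in
    [/\ is_coupling P lam X Xh,
        (forall w, X 0 w = 0) /\ (forall w, Xh 0 w = pi),
        {ae P, forall w, coupling_time X Xh w = Tstar w},
        maximal_coupling P X Xh &
        (0 < lam -> ~ co_adapted P X Xh)]).
Proof.
have l20 : 0 <= 2 * lam by rewrite mulr_ge0.
split.
  move=> d1 d2 d3 T1 P1 X T2 P2 Xh T3 P3 B J jX X0 jXh Xh0 bB eJ indJ t t0.
  split; first exact: (jumpy_tv_dist lam_ge0 jX X0 jXh Xh0 bB t0).
  have s_gt (Z : T3 -> \bar R) : sigma_rv Z [set w | (t%:E < Z w)%E].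
    apply/sigma_rvE; exists `]t%:E, +oo[%classic; first exact: emeasurable_itv.
    by apply/seteqP; split => w /=; rewrite in_itv/= andbT.
  rewrite -(exponential_rv_tail eJ t0) -(indJ _ _ (s_gt _) (s_gt _)).
  by congr (P3 _); apply/seteqP; split => w /=; rewrite lt_min => /andP.
move=> d T P B N Y cd X Xh Tstar; split.
- exact: (constructed_is_coupling lam_ge0 cd).
- by split => w; [exact: (constructed_X0 cd)|exact: (constructed_Xh0 cd)].
- by apply: aeW => w; exact: (constructed_coupling_time cd).
- move=> t t0; have [jX jXh] := constructed_is_coupling lam_ge0 cd.
  rewrite (jumpy_tv_dist lam_ge0 jX (constructed_X0 cd) jXh (constructed_Xh0 cd) (cd_bm cd) t0).
  by rewrite (constructed_survival cd t0) (poisson_no_jump l20 t0 (cd_poisson cd)).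
- by move=> lam_gt0; exact: (constructed_not_co_adapted lam_gt0 cd).
Qed.
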